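(* Let $\mathcal H=L^2(\mathbb R,d\theta)$ and let $$H=\{\psi\in\mathbb H^2(\mathbb S_\pi):\ \overline{\psi(\theta+i\pi)}=\psi(\theta)\text{ for a.e. }\theta\in\mathbb R\},$$ where $\mathbb H^2(\mathbb S_\pi)$ is the Hardy space of the strip $\mathbb S_\pi=\{\zeta\in\mathbb C:0<\operatorname{Im}\zeta<\pi\}$ (identified with a subspace of $L^2(\mathbb R)$ via boundary values on $\mathbb R$). (a) The real orthogonal projection $E_H:\mathcal H\to H$ onto $H$ is given by, for $\psi\in L^2(\mathbb R,d\theta)$ and almost every $\theta$, $$(E_H\psi)(\theta)=\frac{i}{4\pi}\lim_{\varepsilon\searrow0}\int_{\mathbb R}\frac{\psi(\theta')}{\sinh\frac{\theta-\theta'+i\varepsilon}{2}}\,d\theta'+\frac1{4\pi}\int_{\mathbb R}\frac{\overline{\psi(\theta')}}{\cosh\frac{\theta-\theta'}{2}}\,d\theta'.$$ (b) The polarizer of $H$ is the restriction to $H$ of the map $$(D_H\psi)(\theta)=i\psi(\theta)+\frac{1}{2\pi}\lim_{\varepsilon\searrow0}\int_{\mathbb R}\frac{\psi(\theta')}{\sinh\frac{\theta-\theta'+i\varepsilon}{2}}\,d\theta'.$$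
   Context: Inner products are linear in the second argument. $\mathbb H^2(\mathbb S_\pi)$ consists of the holomorphic functions $\psi$ on $\mathbb S_\pi$ with $\sup_{0<\lambda<\pi}\int_{\mathbb R}|\psi(\theta+i\lambda)|^2d\theta<\infty$; these have $L^2$ boundary values on $\mathbb R$ and $\mathbb R+i\pi$. The space $H$ is a standard subspace of $L^2(\mathbb R)$ (closed real linear subspace, $H+iH=\mathbb H^2(\mathbb S_\pi)$ dense, $H\cap iH=\{0\}$), with modular group $(\Delta_H^{it}\psi)(\theta)=\psi(\theta-2\pi t)$ and modular conjugation $(J_H\psi)(\theta)=\overline{\psi(\theta)}$. $E_H$ is the orthogonal projection onto $H$ with respect to the real inner product $\operatorname{Re}\langle\cdot,\cdot\rangle$. The polarizer $D_H:H\to H$ is the unique bounded real linear operator with $\operatorname{Im}\langle h,k\rangle=\operatorname{Re}\langle h,D_Hk\rangle$ for all $h,k\in H$; equivalently $D_H=i(\Delta_H-1)(\Delta_H+1)^{-1}|_H$. *)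

(* Defs.v *)
From mathcomp Require Import all_boot all_order all_algebra.
From mathcomp Require Import complex.
From mathcomp Require Import all_classical all_reals all_analysis.

Set Implicit Arguments.
Unset Strict Implicit.
Unset Printing Implicit Defensive.
Import Order.TTheory GRing.Theory Num.Theory.
Import numFieldNormedType.Exports.

Local Open Scope classical_set_scope.
Local Open Scope ring_scope.
Local Open Scope complex_scope.

Section ComplexFunctions.
Context {R : realType}.
Local Notation C := R[i].
Local Notation mu := (@lebesgue_measure R).

Definition cmod (z : C) : R := ComplexField.Normc.normc z.

Definition cexp (z : C) : C :=
  (expR (complex.Re z))%:C * (cos (complex.Im z) +i* sin (complex.Im z)).

Definition csinh (z : C) : C := (cexp z - cexp (- z)) / 2.

Definition rcosh (x : R) : R := (expR x + expR (- x)) / 2.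

Definition cintegral (f : R -> C) : C :=
  (\int[mu]_t complex.Re (f t)) +i* (\int[mu]_t complex.Im (f t)).

Definition l2norm (psi : R -> C) : \bar R :=
  'N[mu]_2%:E[EFin \o (cmod \o psi)]%E.

(* Elements of L^2(R) are represented by functions; everything below is
   invariant under, and all identities are stated up to, a.e. equality. *)
Definition L2 : set (R -> C) :=
  [set psi | [/\ measurable_fun setT (fun t => complex.Re (psi t)),
                 measurable_fun setT (fun t => complex.Im (psi t))
               & (l2norm psi < +oo)%E]].

Definition ae_equal (psi phi : R -> C) : Prop :=
  {ae mu, forall t, psi t = phi t}.

(* Linear in the second argument. *)
Definition inner (psi phi : R -> C) : C :=
  cintegral (fun t => (psi t)^* * phi t).

Definition strip : set C := [set z | 0 < complex.Im z < pi].

(* [derivable] is taken over the field C: the difference quotients range over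
   complex increments, so this is complex differentiability. *)
Definition holomorphic_on (D : set C) (F : C -> C) : Prop :=
  forall z, D z -> derivable (F : C^o -> C^o) z 1.

Definition horizontal_line (F : C -> C) (lambda : R) : R -> C :=
  fun t => F (t +i* lambda).

(* The values of F outside the strip are irrelevant. *)
Definition hardy_strip : set (C -> C) :=
  [set F | holomorphic_on strip F /\
    (ereal_sup [set (\int[mu]_t ((cmod (horizontal_line F lambda t)) ^+ 2)%:E)%E
               | lambda in [set l : R | (0 < l < pi)%R]] < +oo)%E].

(* psi is the L^2 limit of the horizontal restrictions of F along the filter
   [side], which is 0^'+ for the boundary R and pi^'- for R + i pi. *)
Definition boundary_value (F : C -> C) (side : set_system R) (psi : R -> C) :=
  L2 psi /\
  l2norm (fun t => horizontal_line F lambda t - psi t)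
    @[lambda --> side] --> 0%E.

Definition hardy_real : set (R -> C) :=
  [set psi | exists F : C -> C, hardy_strip F /\
     boundary_value F 0^'+ psi /\
     exists2 psi_pi : R -> C, boundary_value F pi^'- psi_pi
       & ae_equal (fun t => (psi_pi t)^*) psi].

(* psi = E psi + (psi - E psi) with E psi in H and psi - E psi orthogonal to H
   for the real inner product. *)
Definition real_orthogonal_projection (H : set (R -> C))
    (E : (R -> C) -> (R -> C)) : Prop :=
  forall psi, L2 psi ->
    H (E psi) /\
    forall h, H h -> complex.Re (inner h (fun t => psi t - E psi t)) = 0.

(* The second clause says that D descends to a.e. classes. *)
Definition polarizer (H : set (R -> C)) (D : (R -> C) -> (R -> C)) : Prop :=
  [/\ forall h, H h -> H (D h),
      forall h k, H h -> H k -> ae_equal h k -> ae_equal (D h) (D k),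
      forall (a : R) h k, H h -> H k ->
        ae_equal (D (fun t => a%:C * h t + k t))
                 (fun t => a%:C * D h t + D k t),
      exists M : R, forall h, H h -> (l2norm (D h) <= M%:E * l2norm h)%E
    & forall h k, H h -> H k ->
        complex.Im (inner h k) = complex.Re (inner h (D k))].

Definition sinh_integral (psi : R -> C) (t eps : R) : C :=
  cintegral (fun s => psi s / csinh (((t - s) +i* eps) / 2)).

Definition cosh_integral (psi : R -> C) (t : R) : C :=
  cintegral (fun s => (psi s)^* / (rcosh ((t - s) / 2))%:C).

End ComplexFunctions.

Arguments hardy_real R : clear implicits.

(* Main.v *)
Require Import Defs.
From mathcomp Require Import all_boot all_order all_algebra.
From mathcomp Require Import complex.
From mathcomp Require Import all_classical all_reals all_analysis.
From mathcomp Require Import measurable_realfun.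
From mathcomp Require Import ring lra.
Import Order.TTheory GRing.Theory Num.Theory.
Import numFieldNormedType.Exports.
Set Implicit Arguments.
Unset Strict Implicit.
Unset Printing Implicit Defensive.
Local Open Scope classical_set_scope.
Local Open Scope ring_scope.
Local Open Scope complex_scope.

(** Write [H] for the real Hardy space and [ker x y] for [1 / sinh ((x + i y) / 2)].
    For [psi] in [L2] consider its Cauchy integral on the strip,
      [gint psi x y = i/(4 pi) (\int psi(s) ker (x - s) y ds
                               + \int psi(s)^* ker (x - s) (y + pi) ds)],
    in which the values on the upper edge have been replaced by the conjugates of
    the values on the real line, as is legitimate on [H]. Since
    [ker x pi = - i / cosh (x / 2)], the right-hand side of (a) is the limit of
    [gint psi x y] as [y] tends to [0], and the point is to show that [gint psi]
    is the analytic extension of the projection of [psi].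

    For [f] in [H], Cauchy's formula gives [hardy_reproducing]: [gint f] is the
    extension of [f] on the strip, and vanishes at the points reflected in the real
    line. It is obtained from rectangles ([goursat], [rect_simple_pole]): the
    vertical sides disappear along suitable sequences ([hardy_vertical]) and the
    horizontal sides move to the edges ([line_pairing_limit]). Conversely the two
    poles of [evaluator] fit together to an element of [H] that represents the
    value of [gint] at a point. Hence [gint f = gint psi] on the strip as soon as
    [f] lies in [H] and [psi - f] is orthogonal to [H] ([projection_gint]).

    The difference [tint] of the Cauchy integral at mirror points has, up to a term
    of order [y], the Poisson kernel as its kernel. This has two consequences. By
    Schur's test [tint] is bounded on [L2] uniformly in [y] ([tint_L2]), from which
    [H] is closed ([hardy_real_closed]); the projection theorem, based on
    [riesz_fischer], then provides projections. And [tint f] tends to [f] at the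
    Lebesgue points of [f] ([tint_cvg_ae]). As [tint f = gint f = gint psi] for the
    projection [f] of [psi], the limit exists almost everywhere and has the stated
    value ([projection_limit_ae]).

    For (b), [Im <h, k> = Re <h, - i k>], so that a polarizer is the same thing as
    multiplication by [- i] followed by the projection. If [l] is the limit of the
    regularized integral of [psi] in [H], then the formula of (a) for [psi], whose
    projection is [psi], and for [- i psi], whose projection is [D psi], are two
    equations in [l] and the [cosh] integral; eliminating the latter gives (b). *)

(** * Complex modulus and complex integrals *)

Section complex_modulus.
Context {R : realType}.
Local Notation C := R[i].
Local Notation Re := (@complex.Re R).
Local Notation Im := (@complex.Im R).
Implicit Types (z w : C) (x : R).

Lemma complex_eq z w : Re z = Re w -> Im z = Im w -> z = w.
Proof. by case: z => a b; case: w => c d /= -> ->. Qed.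

Lemma ReD z w : Re (z + w) = Re z + Re w. Proof. by case: z w => a b [c d]. Qed.
Lemma ImD z w : Im (z + w) = Im z + Im w. Proof. by case: z w => a b [c d]. Qed.
Lemma ReN z : Re (- z) = - Re z. Proof. by case: z. Qed.
Lemma ImN z : Im (- z) = - Im z. Proof. by case: z. Qed.
Lemma ReB z w : Re (z - w) = Re z - Re w. Proof. by rewrite ReD ReN. Qed.
Lemma ImB z w : Im (z - w) = Im z - Im w. Proof. by rewrite ImD ImN. Qed.
Lemma ReM z w : Re (z * w) = Re z * Re w - Im z * Im w.
Proof. by case: z w => a b [c d]. Qed.
Lemma ImM z w : Im (z * w) = Re z * Im w + Im z * Re w.
Proof. by case: z w => a b [c d] /=; rewrite addrC. Qed.
Lemma ReJ z : Re (z^*) = Re z. Proof. by case: z. Qed.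
Lemma ImJ z : Im (z^*) = - Im z. Proof. by case: z. Qed.

Definition ReImE := (ReD, ImD, ReN, ImN, ReM, ImM, ReJ, ImJ).

Lemma sqr_cmod z : cmod z ^+ 2 = Re z ^+ 2 + Im z ^+ 2.
Proof. by case: z => a b; rewrite /cmod /= sqr_sqrtr// addr_ge0// sqr_ge0. Qed.

Lemma cmod_ge0 z : 0 <= cmod z.
Proof. by case: z => a b; rewrite /cmod /= sqrtr_ge0. Qed.

Lemma cmod0 : cmod (0 : C) = 0. Proof. exact: ComplexField.Normc.normc0. Qed.
Lemma cmodM z w : cmod (z * w) = cmod z * cmod w.
Proof. exact: ComplexField.Normc.normcM. Qed.
Lemma cmodV z : cmod z^-1 = (cmod z)^-1.
Proof. exact: ComplexField.Normc.normcV. Qed.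
Lemma cmodN z : cmod (- z) = cmod z. Proof. exact: normcN. Qed.
Lemma cmodD z w : cmod (z + w) <= cmod z + cmod w.
Proof. exact: le_normcD. Qed.
Lemma cmodB z w : cmod (z - w) <= cmod z + cmod w.
Proof. by rewrite -(cmodN w); exact: cmodD. Qed.
Lemma cmodC z w : cmod (z - w) = cmod (w - z).
Proof. by rewrite -cmodN opprB. Qed.
Lemma cmod_eq0 z : cmod z = 0 -> z = 0.
Proof. exact: ComplexField.Normc.eq0_normc. Qed.
Lemma cmod_gt0 z : z != 0 -> 0 < cmod z.
Proof.
move=> z0; rewrite lt_neqAle cmod_ge0 andbT eq_sym.
by apply: contra z0 => /eqP/cmod_eq0 ->.
Qed.
Lemma cmodJ z : cmod (z^*) = cmod z.
Proof. by case: z => a b; rewrite /cmod /= sqrrN. Qed.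
Lemma cmod_real x : cmod (x%:C) = `|x|.
Proof. by rewrite /cmod /= expr0n /= addr0 sqrtr_sqr. Qed.
Lemma cmodi : cmod ('i%C : C) = 1.
Proof. by rewrite /cmod /= expr0n /= add0r expr1n sqrtr1. Qed.
Lemma norm_cmod z : `|z| = (cmod z)%:C.
Proof. by case: z. Qed.
Lemma Re_le_cmod z : `|Re z| <= cmod z.
Proof. by rewrite -ler_sqr ?nnegrE ?cmod_ge0// sqr_cmod -normrX ger0_norm ?sqr_ge0// lerDl sqr_ge0. Qed.
Lemma Im_le_cmod z : `|Im z| <= cmod z.
Proof. by rewrite -ler_sqr ?nnegrE ?cmod_ge0// sqr_cmod -normrX ger0_norm ?sqr_ge0// lerDr sqr_ge0. Qed.
Lemma cmod_le_ReIm z : cmod z <= `|Re z| + `|Im z|.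
Proof.
rewrite -ler_sqr ?nnegrE ?cmod_ge0 ?addr_ge0// sqr_cmod sqrrD !real_normK ?num_real//.
have : 0 <= `|Re z| * `|Im z| by rewrite mulr_ge0.
lra.
Qed.
Lemma cmod_conjM z : (z^* * z) = (cmod z ^+ 2)%:C.
Proof. by rewrite sqr_cmod; apply: complex_eq; case: z => a b /=; ring. Qed.

End complex_modulus.

Section complex_integral.
Context {R : realType}.
Local Notation C := R[i].
Local Notation Re := (@complex.Re R).
Local Notation Im := (@complex.Im R).
Local Notation mu := (@lebesgue_measure R).
Implicit Types (D : set R) (f g : R -> C).

Definition cmeasurable D f :=
  measurable_fun D (fun t => Re (f t)) /\ measurable_fun D (fun t => Im (f t)).

Definition cintegrable D f :=
  mu.-integrable D (EFin \o (fun t => Re (f t))) /\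
  mu.-integrable D (EFin \o (fun t => Im (f t))).

Definition cint D f : C :=
  (\int[mu]_(t in D) Re (f t)) +i* (\int[mu]_(t in D) Im (f t)).

Lemma eq_cint D f g : (forall t, D t -> f t = g t) -> cint D f = cint D g.
Proof.
move=> fg; congr Complex; apply: eq_Rintegral => t /set_mem Dt; by rewrite fg.
Qed.

Lemma cmeasurableD D f g : cmeasurable D f -> cmeasurable D g ->
  cmeasurable D (fun t => f t + g t).
Proof.
by move=> [f1 f2] [g1 g2]; split; under eq_fun do rewrite ReImE; exact: measurable_funD.
Qed.

Lemma cmeasurableN D f : cmeasurable D f -> cmeasurable D (fun t => - f t).
Proof.
by move=> [f1 f2]; split; under eq_fun do rewrite ReImE; exact: measurableT_comp.
Qed.

Lemma cmeasurableB D f g : cmeasurable D f -> cmeasurable D g ->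
  cmeasurable D (fun t => f t - g t).
Proof. by move=> mf mg; apply: cmeasurableD => //; exact: cmeasurableN. Qed.

Lemma cmeasurableM D f g : cmeasurable D f -> cmeasurable D g ->
  cmeasurable D (fun t => f t * g t).
Proof.
move=> [f1 f2] [g1 g2]; split; under eq_fun do rewrite ReImE.
- by apply: measurable_funB; exact: measurable_funM.
- by apply: measurable_funD; exact: measurable_funM.
Qed.

Lemma cmeasurable_cst D c : cmeasurable D (fun=> c).
Proof. by split; exact: measurable_cst. Qed.

Lemma cmeasurableJ D f : cmeasurable D f -> cmeasurable D (fun t => (f t)^*).
Proof.
move=> [f1 f2]; split; under eq_fun do rewrite ReImE; first by [].
exact: measurableT_comp.
Qed.

Lemma cmeasurable_real D (f : R -> R) : measurable_fun D f ->
  cmeasurable D (fun t => (f t)%:C).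
Proof. by move=> mf; split => //=; exact: measurable_cst. Qed.

Lemma cmeasurable_cmod D f : cmeasurable D f -> measurable_fun D (fun t => cmod (f t)).
Proof.
move=> [f1 f2].
rewrite (_ : (fun t => _) = (@Num.sqrt R) \o (fun t => Re (f t) ^+ 2 + Im (f t) ^+ 2)).
  apply: measurableT_comp; first exact: (continuous_measurable_fun (@sqrt_continuous R)).
  by apply: measurable_funD; exact: measurable_funX.
by apply/funext => t /=; rewrite /cmod; case: (f t).
Qed.

Lemma cmeasurable_sqr_cmod D f : cmeasurable D f ->
  measurable_fun D (fun t => cmod (f t) ^+ 2).
Proof. by move=> mf; apply: measurable_funX; exact: cmeasurable_cmod. Qed.

Lemma cintegrable_measurable D f : cintegrable D f -> cmeasurable D f.
Proof. by move=> [/measurable_int/measurable_EFinP ? /measurable_int/measurable_EFinP ?]. Qed.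

Lemma cintegrable_le D f (g : R -> R) : measurable D -> cmeasurable D f ->
  mu.-integrable D (EFin \o g) -> (forall t, D t -> cmod (f t) <= g t) ->
  cintegrable D f.
Proof.
move=> mD [f1 f2] ig fg; split; apply: (le_integrable _ _ _ ig) => //.
- exact/measurable_EFinP.
- move=> t Dt /=; rewrite lee_fin (le_trans (Re_le_cmod _))// (le_trans (fg _ Dt))//.
  exact: ler_norm.
- exact/measurable_EFinP.
- move=> t Dt /=; rewrite lee_fin (le_trans (Im_le_cmod _))// (le_trans (fg _ Dt))//.
  exact: ler_norm.
Qed.

Lemma cintegrable_cmod D f : measurable D -> cintegrable D f ->
  mu.-integrable D (EFin \o (fun t => cmod (f t))).
Proof.
move=> mD if_; have mf := cintegrable_measurable if_; case: if_ => i1 i2.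
have i3 : mu.-integrable D (EFin \o (fun t => `|Re (f t)| + `|Im (f t)|)).
  have := integrableD _ (integrable_norm i1) (integrable_norm i2).
  by move=> /(_ mD); apply: eq_integrable.
apply: (le_integrable _ _ _ i3) => //.
  by apply/measurable_EFinP; exact: cmeasurable_cmod.
move=> t Dt /=; rewrite lee_fin ger0_norm ?cmod_ge0// ger0_norm ?addr_ge0//.
exact: cmod_le_ReIm.
Qed.

Lemma cintegrableD D f g : measurable D -> cintegrable D f -> cintegrable D g ->
  cintegrable D (fun t => f t + g t).
Proof.
move=> mD if_ ig; apply: (@cintegrable_le _ _ (fun t => cmod (f t) + cmod (g t))) => //.
- by apply: cmeasurableD; exact: cintegrable_measurable.
- have := integrableD _ (cintegrable_cmod mD if_) (cintegrable_cmod mD ig).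
  by move=> /(_ mD); apply: eq_integrable.
- by move=> t _; exact: cmodD.
Qed.

Lemma cintegrableZ D f c : measurable D -> cintegrable D f ->
  cintegrable D (fun t => c * f t).
Proof.
move=> mD if_; apply: (@cintegrable_le _ _ (fun t => cmod c * cmod (f t))) => //.
- by apply: cmeasurableM; [exact: cmeasurable_cst|exact: cintegrable_measurable].
- have := integrableZl _ (cmod c) (cintegrable_cmod mD if_).
  by move=> /(_ mD); apply: eq_integrable => // t _ /=; rewrite EFinM.
- by move=> t _; rewrite cmodM.
Qed.

Lemma cintegrableN D f : measurable D -> cintegrable D f ->
  cintegrable D (fun t => - f t).
Proof.
move=> mD if_; rewrite (_ : (fun t => _) = (fun t => (-1) * f t)).
  exact: cintegrableZ.
by apply/funext => t; rewrite mulN1r.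
Qed.

Lemma cintegrableB D f g : measurable D -> cintegrable D f -> cintegrable D g ->
  cintegrable D (fun t => f t - g t).
Proof. by move=> mD if_ ig; apply: cintegrableD => //; exact: cintegrableN. Qed.

Lemma cintegrableJ D f : measurable D -> cintegrable D f ->
  cintegrable D (fun t => (f t)^*).
Proof.
move=> mD if_; apply: (cintegrable_le mD _ (cintegrable_cmod mD if_)).
  by apply: cmeasurableJ; exact: cintegrable_measurable.
by move=> t _; rewrite cmodJ.
Qed.

Lemma cintD D f g : measurable D -> cintegrable D f -> cintegrable D g ->
  cint D (fun t => f t + g t) = cint D f + cint D g.
Proof.
move=> mD [f1 f2] [g1 g2]; apply: complex_eq; rewrite ReImE /=.
- by under eq_Rintegral do rewrite ReD; rewrite RintegralD.
- by under eq_Rintegral do rewrite ImD; rewrite RintegralD.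
Qed.

Lemma cintZ D f c : measurable D -> cintegrable D f ->
  cint D (fun t => c * f t) = c * cint D f.
Proof.
move=> mD [f1 f2]; apply: complex_eq; rewrite ReImE /=.
- under eq_Rintegral do rewrite ReM.
  rewrite RintegralB//= ?RintegralZl//.
  + by have /(_ mD) := integrableZl _ (Re c) f1; apply: eq_integrable => // t _ /=; rewrite EFinM.
  + by have /(_ mD) := integrableZl _ (Im c) f2; apply: eq_integrable => // t _ /=; rewrite EFinM.
- under eq_Rintegral do rewrite ImM.
  rewrite RintegralD//= ?RintegralZl//.
  + by have /(_ mD) := integrableZl _ (Re c) f2; apply: eq_integrable => // t _ /=; rewrite EFinM.
  + by have /(_ mD) := integrableZl _ (Im c) f1; apply: eq_integrable => // t _ /=; rewrite EFinM.
Qed.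

Lemma cintN D f : measurable D -> cintegrable D f ->
  cint D (fun t => - f t) = - cint D f.
Proof.
move=> mD if_; rewrite -mulN1r -cintZ//.
by apply: eq_cint => t _; rewrite mulN1r.
Qed.

Lemma cintB D f g : measurable D -> cintegrable D f -> cintegrable D g ->
  cint D (fun t => f t - g t) = cint D f - cint D g.
Proof. by move=> mD if_ ig; rewrite cintD ?cintN//; exact: cintegrableN. Qed.

Lemma cintJ D f : measurable D -> cintegrable D f ->
  cint D (fun t => (f t)^*) = (cint D f)^*.
Proof.
move=> mD [f1 f2]; apply: complex_eq; rewrite ReImE /=.
  by under eq_Rintegral do rewrite ReJ.
under eq_Rintegral do rewrite ImJ -mulN1r.
by rewrite RintegralZl// mulN1r.
Qed.

(** Rotating the integral onto the positive real axis reduces this to the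
    monotonicity of a real integral. *)
Lemma cmod_cint_le D f : measurable D -> cintegrable D f ->
  cmod (cint D f) <= \int[mu]_(t in D) cmod (f t).
Proof.
move=> mD if_; set I := cint D f.
have [I0|I0] := eqVneq I 0.
  by rewrite I0 cmod0; apply: Rintegral_ge0 => t _; exact: cmod_ge0.
have I1 := cmod_gt0 I0.
pose c : C := (cmod I)^-1%:C * I^*.
have cI : cint D (fun t => c * f t) = (cmod I)%:C.
  rewrite cintZ// -/I /c -mulrA cmod_conjM -rmorphM /= expr2 mulrA mulVf ?mul1r//.
  by rewrite gt_eqF.
have c1 : cmod c = 1.
  by rewrite /c cmodM cmodJ cmod_real ger0_norm ?invr_ge0 ?cmod_ge0// mulVf// gt_eqF.
have -> : cmod I = \int[mu]_(t in D) Re (c * f t).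
  by have := congr1 (@complex.Re R) cI; rewrite /= => <-.
apply: le_Rintegral => //.
- by case: (cintegrableZ c mD if_).
- exact: cintegrable_cmod.
- move=> t Dt; rewrite (le_trans (ler_norm _))// (le_trans (Re_le_cmod _))//.
  by rewrite cmodM c1 mul1r.
Qed.

End complex_integral.

Section real_integral.
Context {R : realType}.
Local Notation mu := (@lebesgue_measure R).
Implicit Types (D : set R) (f g : R -> R).

Definition rintegrable D f := mu.-integrable D (EFin \o f).

Lemma eq_rintegrable D f g : measurable D -> (forall t, D t -> f t = g t) ->
  rintegrable D f -> rintegrable D g.
Proof.
by move=> mD fg; apply: eq_integrable => // t /set_mem Dt /=; rewrite fg.
Qed.

Lemma rintegrable_le D f g : measurable D -> measurable_fun D f ->
  rintegrable D g -> (forall t, D t -> `|f t| <= g t) -> rintegrable D f.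
Proof.
move=> mD mf ig fg; apply: (le_integrable _ _ _ ig) => //.
  exact/measurable_EFinP.
by move=> t Dt /=; rewrite lee_fin (le_trans (fg _ Dt))// ler_norm.
Qed.

Lemma rintegrable_measurable D f : rintegrable D f -> measurable_fun D f.
Proof. by move=> /measurable_int/measurable_EFinP. Qed.

Lemma rintegrableD D f g : measurable D -> rintegrable D f -> rintegrable D g ->
  rintegrable D (fun t => f t + g t).
Proof.
move=> mD if_ ig; have /(_ mD) := integrableD _ if_ ig.
by apply: eq_integrable.
Qed.

Lemma rintegrableZ D f c : measurable D -> rintegrable D f ->
  rintegrable D (fun t => c * f t).
Proof.
move=> mD if_; have /(_ mD) := integrableZl _ c if_.
by apply: eq_integrable.
Qed.

Lemma rintegrableS D E f : measurable E -> measurable D -> D `<=` E ->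
  rintegrable E f -> rintegrable D f.
Proof. by move=> mE mD DE if_; apply: integrableS if_. Qed.

Lemma RintegralE D f : measurable D -> rintegrable D f ->
  (\int[mu]_(t in D) (f t)%:E)%E = (\int[mu]_(t in D) f t)%:E.
Proof. by move=> mD if_; rewrite /Rintegral fineK//; apply: integrable_fin_num. Qed.

(** The form in which Tonelli and monotone convergence arguments conclude. *)
Lemma rintegrable_ge0 D f : measurable D -> measurable_fun D f ->
  (forall t, D t -> 0 <= f t) ->
  (\int[mu]_(t in D) (f t)%:E < +oo)%E -> rintegrable D f.
Proof.
move=> mD mf f0 foo; apply/integrableP; split; first exact/measurable_EFinP.
rewrite (_ : integral _ _ _ = \int[mu]_(t in D) (f t)%:E)%E//.
by apply: eq_integral => t /set_mem Dt /=; rewrite ger0_norm// f0.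
Qed.

Lemma Rintegral_le D f g : measurable D -> rintegrable D f -> rintegrable D g ->
  (forall t, D t -> f t <= g t) ->
  \int[mu]_(t in D) f t <= \int[mu]_(t in D) g t.
Proof. by move=> mD if_ ig fg; apply: le_Rintegral. Qed.

Lemma RintegralDr D f g : measurable D -> rintegrable D f -> rintegrable D g ->
  \int[mu]_(t in D) (f t + g t) = \int[mu]_(t in D) f t + \int[mu]_(t in D) g t.
Proof. by move=> mD if_ ig; rewrite RintegralD. Qed.

Lemma RintegralZr' D f c : measurable D -> rintegrable D f ->
  \int[mu]_(t in D) (c * f t) = c * \int[mu]_(t in D) f t.
Proof. by move=> mD if_; rewrite RintegralZl. Qed.

End real_integral.

Section almost_everywhere.
Context {R : realType}.
Local Notation mu := (@lebesgue_measure R).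
Implicit Types (P Q : R -> Prop).

Lemma ae_imp P Q : (forall t, P t -> Q t) ->
  {ae mu, forall t, P t} -> {ae mu, forall t, Q t}.
Proof.
move=> PQ [A [mA A0 PA]]; exists A; split => // t /= nQ; apply: PA => /=.
by move/PQ.
Qed.

Lemma ae_and P Q : {ae mu, forall t, P t} -> {ae mu, forall t, Q t} ->
  {ae mu, forall t, P t /\ Q t}.
Proof.
move=> [A [mA A0 PA]] [B [mB B0 QB]]; exists (A `|` B); split.
- exact: measurableU.
- by rewrite measureU0.
- move=> t /= nPQ; have [Pt|nPt] := pselect (P t); last by left; exact: PA.
  by right; apply: QB => /= Qt; exact: nPQ.
Qed.

Lemma ae_all P : (forall t, P t) -> {ae mu, forall t, P t}.
Proof. by move=> h; exists set0; split => // t /= []. Qed.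

End almost_everywhere.

(** * Square integrable functions *)

Section square_integrable.
Context {R : realType}.
Local Notation C := R[i].
Local Notation mu := (@lebesgue_measure R).
Implicit Types (f g : R -> C).

Definition sqint f : R := \int[mu]_t (cmod (f t) ^+ 2).

Lemma sqint_ge0 f : 0 <= sqint f.
Proof. by apply: Rintegral_ge0 => t _; rewrite exprn_ge0// cmod_ge0. Qed.

Lemma l2norm_integral f :
  l2norm f = poweR (\int[mu]_t (cmod (f t) ^+ 2)%:E)%E (2^-1).
Proof.
rewrite /l2norm unlock; congr (poweR _ _); apply: eq_integral => t _ /=.
by rewrite powR_mulrn ?normr_ge0// ger0_norm ?cmod_ge0.
Qed.

Lemma L2P f : L2 f <->
  cmeasurable setT f /\ rintegrable setT (fun t => cmod (f t) ^+ 2).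
Proof.
split.
  move=> [m1 m2 foo]; have mf : cmeasurable setT f by [].
  split => //; apply: rintegrable_ge0 => //; first exact: cmeasurable_sqr_cmod.
    by move=> t _; rewrite exprn_ge0// cmod_ge0.
  move: foo; rewrite l2norm_integral.
  rewrite !ltey; apply: contra => /eqP ->.
  by rewrite poweRyr// invr_neq0.
move=> [[m1 m2] if_]; split => //.
by rewrite l2norm_integral poweR_lty// RintegralE// ltry.
Qed.

Lemma l2norm_sqint f : L2 f -> l2norm f = (Num.sqrt (sqint f))%:E.
Proof.
move=> /L2P[_ if_]; rewrite l2norm_integral RintegralE//.
by rewrite poweR_EFin powR12_sqrt// sqint_ge0.
Qed.

(** The form of the triangle inequality that can be integrated. *)
Lemma sqr_cmodD_le (z w : C) : cmod (z + w) ^+ 2 <= 2 * cmod z ^+ 2 + 2 * cmod w ^+ 2.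
Proof.
have := cmodD z w; have := cmod_ge0 (z + w); have := cmod_ge0 z; have := cmod_ge0 w.
move: (cmod (z + w)) (cmod z) (cmod w) => c a b b0 a0 c0 h.
have : c ^+ 2 <= (a + b) ^+ 2 by rewrite ler_sqr ?nnegrE// addr_ge0.
have : 0 <= (a - b) ^+ 2 by exact: sqr_ge0.
rewrite !expr2; lra.
Qed.

Lemma L2_cmeasurable f : L2 f -> cmeasurable setT f. Proof. by case/L2P. Qed.

Lemma L2_le f (g : R -> R) : cmeasurable setT f -> rintegrable setT g ->
  (forall t, cmod (f t) ^+ 2 <= g t) -> L2 f.
Proof.
move=> mf ig fg; apply/L2P; split => //; apply: rintegrable_le ig _ => //.
  exact: cmeasurable_sqr_cmod.
by move=> t _; rewrite ger0_norm// exprn_ge0// cmod_ge0.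
Qed.

Lemma L2D f g : L2 f -> L2 g -> L2 (fun t => f t + g t).
Proof.
move=> /L2P[mf if_] /L2P[mg ig].
apply: L2_le (fun t => sqr_cmodD_le (f t) (g t)); first exact: cmeasurableD.
by apply: rintegrableD => //; exact: rintegrableZ.
Qed.

Lemma L2Z c f : L2 f -> L2 (fun t => c * f t).
Proof.
move=> /L2P[mf if_]; apply: (@L2_le _ (fun t => cmod c ^+ 2 * cmod (f t) ^+ 2)).
- by apply: cmeasurableM => //; exact: cmeasurable_cst.
- exact: rintegrableZ.
- by move=> t; rewrite cmodM exprMn.
Qed.

Lemma L2N f : L2 f -> L2 (fun t => - f t).
Proof.
by move=> /(L2Z (-1)); congr L2; apply/funext => t; rewrite mulN1r.
Qed.

Lemma L2B f g : L2 f -> L2 g -> L2 (fun t => f t - g t).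
Proof. by move=> Lf Lg; apply: L2D => //; exact: L2N. Qed.

Lemma L2J f : L2 f -> L2 (fun t => (f t)^*).
Proof.
move=> /L2P[mf if_]; apply: L2_le if_ _; first exact: cmeasurableJ.
by move=> t; rewrite cmodJ.
Qed.

Lemma sqintD f g : L2 f -> L2 g ->
  sqint (fun t => f t + g t) <= 2 * sqint f + 2 * sqint g.
Proof.
move=> Lf Lg; have /L2P[_ ifg] := L2D Lf Lg.
move: Lf Lg => /L2P[mf if_] /L2P[mg ig].
rewrite /sqint -!RintegralZr'// -RintegralDr//; last 2 first.
  exact: rintegrableZ.
  exact: rintegrableZ.
apply: Rintegral_le => //.
  by apply: rintegrableD => //; exact: rintegrableZ.
by move=> t _; exact: sqr_cmodD_le.
Qed.

Lemma sqintZ c f : L2 f -> sqint (fun t => c * f t) = cmod c ^+ 2 * sqint f.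
Proof.
move=> /L2P[_ if_]; rewrite /sqint -RintegralZr'//.
by apply: eq_Rintegral => t _; rewrite cmodM exprMn.
Qed.

Lemma sqintN f : sqint (fun t => - f t) = sqint f.
Proof. by apply: eq_Rintegral => t _; rewrite cmodN. Qed.

Lemma sqintJ f : sqint (fun t => (f t)^*) = sqint f.
Proof. by apply: eq_Rintegral => t _; rewrite cmodJ. Qed.

Lemma sqintB f g : L2 f -> L2 g ->
  sqint (fun t => f t - g t) <= 2 * sqint f + 2 * sqint g.
Proof. by move=> Lf Lg; rewrite -(sqintN g); apply: sqintD => //; exact: L2N. Qed.

Lemma sqint_le f (g : R -> R) : L2 f -> rintegrable setT g ->
  (forall t, cmod (f t) ^+ 2 <= g t) -> sqint f <= \int[mu]_t g t.
Proof. by move=> /L2P[_ if_] ig fg; exact: Rintegral_le. Qed.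

Lemma eq_sqint f g : f =1 g -> sqint f = sqint g.
Proof. by move=> fg; congr sqint; exact/funext. Qed.

Lemma mul_le_sqr (a b : R) : a * b <= a ^+ 2 + b ^+ 2.
Proof.
have : 0 <= (a - b) ^+ 2 by exact: sqr_ge0.
have := sqr_ge0 a; have := sqr_ge0 b.
rewrite !expr2; lra.
Qed.

Lemma L2_mul f g : L2 f -> L2 g -> cintegrable setT (fun t => f t * g t).
Proof.
move=> /L2P[mf if_] /L2P[mg ig].
apply: (cintegrable_le _ _ (rintegrableD _ if_ ig)) => //.
  exact: cmeasurableM.
by move=> t _; rewrite cmodM mul_le_sqr.
Qed.

(** The polynomial [x |-> \int (x * |f| - |g|)^2] is nonnegative, so its
    discriminant is not positive. *)
Lemma cauchy_schwarz f g : L2 f -> L2 g ->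
  \int[mu]_t (cmod (f t) * cmod (g t)) <= Num.sqrt (sqint f * sqint g).
Proof.
move=> Lf Lg; have mfg := cintegrable_cmod measurableT (L2_mul Lf Lg).
have {mfg} ifg : rintegrable setT (fun t => cmod (f t) * cmod (g t)).
  by apply: eq_rintegrable mfg => // t _; rewrite cmodM.
move: Lf Lg => /L2P[mf if_] /L2P[mg ig].
set B := \int[mu]_t _.
have B0 : 0 <= B by apply: Rintegral_ge0 => t _; rewrite mulr_ge0 ?cmod_ge0.
have quad x : 0 <= x ^+ 2 * sqint f - 2 * x * B + sqint g.
  rewrite -mulNr /sqint /B -!RintegralZr'//.
  rewrite -!RintegralDr//; do ?[exact: rintegrableZ | apply: rintegrableD => //].
  apply: Rintegral_ge0 => t _.
  rewrite (_ : _ + _ = (x * cmod (f t) - cmod (g t)) ^+ 2) ?sqr_ge0//; ring.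
rewrite -[leLHS]ger0_norm// -sqrtr_sqr ler_wsqrtr//.
have [f0|f0] := eqVneq (sqint f) 0.
  have [->|Bn0] := eqVneq B 0; first by rewrite expr0n/= mulr_ge0// sqint_ge0.
  have := quad ((sqint g + 1) / (2 * B)).
  rewrite f0 mulr0 add0r (_ : 2 * _ * B = sqint g + 1); last by field.
  by lra.
have fp : 0 < sqint f by rewrite lt_neqAle eq_sym f0 sqint_ge0.
have := quad (B / sqint f).
rewrite (_ : _ + _ = sqint g - B ^+ 2 / sqint f); last by field.
by rewrite subr_ge0 ler_pdivrMr// mulrC.
Qed.

Lemma cmod_cint_mul_le f g : L2 f -> L2 g ->
  cmod (cint setT (fun t => f t * g t)) <= Num.sqrt (sqint f * sqint g).
Proof.
move=> Lf Lg; apply: (le_trans (cmod_cint_le _ (L2_mul Lf Lg))) => //.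
by under eq_Rintegral do rewrite cmodM; exact: cauchy_schwarz.
Qed.

Lemma sqint_eq0 f : L2 f -> sqint f = 0 -> ae_equal f (fun=> 0).
Proof.
move=> /L2P[mf if_] f0.
have := RintegralE measurableT if_.
rewrite -/(sqint f) f0 => h.
have : (\int[mu]_t `|(cmod (f t) ^+ 2)%:E| = 0)%E.
  rewrite -[RHS]/(0%:E) -h; apply: eq_integral => t _ /=.
  by rewrite ger0_norm// exprn_ge0// cmod_ge0.
move/ae_eq_integral_abs => /(_ measurableT).
have mE : measurable_fun setT (fun t : R => (cmod (f t) ^+ 2)%:E).
  by apply/measurable_EFinP; exact: cmeasurable_sqr_cmod.
move=> /(_ mE); apply: ae_imp => t /(_ I) /= [] /eqP.
by rewrite sqrf_eq0 => /eqP/cmod_eq0.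
Qed.

Lemma ae_equal_sqint f g : ae_equal f g -> L2 f -> L2 g -> sqint f = sqint g.
Proof.
move=> fg /L2P[mf if_] /L2P[mg ig]; rewrite /sqint /Rintegral; congr fine.
apply: ae_eq_integral => //.
- by apply/measurable_EFinP; exact: cmeasurable_sqr_cmod.
- by apply/measurable_EFinP; exact: cmeasurable_sqr_cmod.
- by move: fg; apply: ae_imp => t /= ->.
Qed.

End square_integrable.

Arguments cmod : simpl never.
Arguments cint : simpl never.
Arguments sqint : simpl never.

(** * The hyperbolic kernel *)

Section hyperbolic.
Context {R : realType}.
Local Notation C := R[i].
Implicit Types (x y : R).

Definition rsinh x : R := (expR x - expR (- x)) / 2.

Arguments rsinh : simpl never.
Arguments rcosh : simpl never.
Arguments csinh : simpl never.
Arguments cexp : simpl never.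

Lemma rcosh_gt0 x : 0 < rcosh x.
Proof. by rewrite /rcosh divr_gt0// addr_gt0// expR_gt0. Qed.

Lemma sqr_rcosh x : rcosh x ^+ 2 = 1 + rsinh x ^+ 2.
Proof.
have e := expRxMexpNx_1 x; rewrite /rcosh /rsinh.
rewrite !expr_div_n sqrrD sqrrB e.
by field.
Qed.

Lemma rcosh_ge1 x : 1 <= rcosh x.
Proof.
have h := sqr_rcosh x; have h0 := rcosh_gt0 x; have := sqr_ge0 (rsinh x).
case: (lerP 1 (rcosh x)) => // h1 h2.
have : rcosh x ^+ 2 < 1 by rewrite expr2 mulr_ilt1// ltW.
lra.
Qed.

Lemma norm_rsinh_le x : `|rsinh x| <= rcosh x.
Proof.
rewrite -ler_sqr ?nnegrE ?(ltW (rcosh_gt0 x))// sqr_rcosh real_normK ?num_real//.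
by rewrite lerDr.
Qed.

Lemma rcoshN x : rcosh (- x) = rcosh x.
Proof. by rewrite /rcosh opprK addrC. Qed.

Lemma rsinhN x : rsinh (- x) = - rsinh x.
Proof. by rewrite /rsinh opprK -mulNr opprB. Qed.

Lemma rsinh0 : rsinh 0 = 0 :> R.
Proof. by rewrite /rsinh oppr0 subrr mul0r. Qed.

Lemma is_derive_expRN x : is_derive x 1 (fun t : R => expR (- t)) (- expR (- x)).
Proof.
have h : is_derive x 1 (fun t : R => - t) (-1) by apply: is_deriveN.
have := is_derive1_comp (is_derive_expR (- x)) h.
by rewrite mulrN1.
Qed.

Lemma is_derive_rsinh x : is_derive x 1 rsinh (rcosh x).
Proof.
have h1 := is_derive_expRN x.
have -> : rsinh = 2^-1 \*: (expR - (fun t => expR (- t))).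
  by apply/funext => t /=; rewrite /rsinh mulrC.
have -> : rcosh x = 2^-1 *: (expR x - - expR (- x)) by rewrite /rcosh opprK mulrC.
exact: is_deriveZ.
Qed.

Lemma is_derive_rcosh x : is_derive x 1 rcosh (rsinh x).
Proof.
have h1 := is_derive_expRN x.
have -> : @rcosh R = 2^-1 \*: (expR + (fun t => expR (- t))).
  by apply/funext => t /=; rewrite /rcosh mulrC.
have -> : rsinh x = 2^-1 *: (expR x + - expR (- x)) by rewrite /rsinh mulrC.
exact: is_deriveZ.
Qed.

Lemma continuous_rsinh : continuous rsinh.
Proof.
move=> x; apply/differentiable_continuous/derivable1_diffP.
by have [] := is_derive_rsinh x.
Qed.

Lemma continuous_rcosh : continuous (@rcosh R).
Proof.
move=> x; apply/differentiable_continuous/derivable1_diffP.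
by have [] := is_derive_rcosh x.
Qed.

Lemma le_norm_rsinh x : `|x| <= `|rsinh x|.
Proof.
wlog x0 : x / 0 < x.
  move=> h; have [x0|x0|->] := ltgtP x 0; last by rewrite rsinh0.
    by rewrite -normrN -(normrN (rsinh x)) -rsinhN h// oppr_gt0.
  exact: h.
have [c _] := @MVT R rsinh rcosh 0 x x0 (fun t _ => is_derive_rsinh t)
  (continuous_subspaceT continuous_rsinh).
rewrite rsinh0 !subr0 => ->; rewrite normrM ler_peMl// ger0_norm ?rcosh_ge1//.
by rewrite ltW// rcosh_gt0.
Qed.

Lemma dist_sin_le x y : `|sin x - sin y| <= `|x - y|.
Proof.
wlog xy : x y / y < x.
  move=> h; have [xy|xy|->] := ltgtP x y; last by rewrite !subrr.
    by rewrite distrC (distrC x) h.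
  exact: h.
have [c _ ->] := @MVT R sin cos y x xy (fun t _ => is_derive_sin t)
  (continuous_subspaceT (@continuous_sin R)).
by rewrite normrM ler_piMl// cos_max.
Qed.

Lemma dist_cos_le x y : `|cos x - cos y| <= `|x - y|.
Proof.
rewrite -!sinDpihalf (le_trans (dist_sin_le _ _))//.
by rewrite (_ : _ - _ = x - y)//; ring.
Qed.

Lemma norm_sin_le x : `|sin x| <= `|x|.
Proof. by have := dist_sin_le x 0; rewrite sin0 !subr0. Qed.

End hyperbolic.

Arguments rsinh : simpl never.
Arguments rcosh : simpl never.
Arguments csinh : simpl never.
Arguments cexp : simpl never.

Section complex_sinh.
Context {R : realType}.
Local Notation C := R[i].
Implicit Types (x y : R).

Lemma csinhE x y : csinh (x +i* y) = rsinh x * cos y +i* (rcosh x * sin y) :> C.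
Proof.
have -> : csinh (x +i* y) = (2^-1)%:C * (cexp (x +i* y) - cexp (- (x +i* y))) :> C.
  by rewrite /csinh mulrC fmorphV rmorph_nat.
rewrite /cexp /rsinh /rcosh; apply: complex_eq; rewrite /= cosN sinN; by field.
Qed.

Lemma sqr_cmod_csinh x y :
  cmod (csinh (x +i* y) : C) ^+ 2 = rsinh x ^+ 2 + sin y ^+ 2.
Proof.
by rewrite csinhE sqr_cmod /= (exprMn _ (rsinh x)) (exprMn _ (rcosh x)) cos2sin2 sqr_rcosh; ring.
Qed.

Lemma csinh_neq0 x y : sin y != 0 -> csinh (x +i* y) != 0 :> C.
Proof.
move=> s0; apply/eqP => /(congr1 (fun z => cmod z ^+ 2)) /eqP.
rewrite sqr_cmod_csinh cmod0 expr0n/= paddr_eq0 ?sqr_ge0// !sqrf_eq0.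
by rewrite (negbTE s0) andbF.
Qed.

Lemma cmod_csinh_ge x y : rcosh x * `|sin y| <= cmod (csinh (x +i* y) : C).
Proof.
rewrite -ler_sqr ?nnegrE ?cmod_ge0 ?mulr_ge0 ?(ltW (rcosh_gt0 x))//.
rewrite sqr_cmod_csinh exprMn real_normK ?num_real// sqr_rcosh.
have : 0 <= (rsinh x * cos y) ^+ 2 by exact: sqr_ge0.
rewrite exprMn cos2sin2; lra.
Qed.

Lemma cmod_csinh_ge_rsinh x y : `|rsinh x| <= cmod (csinh (x +i* y) : C).
Proof.
rewrite -ler_sqr ?nnegrE ?cmod_ge0//.
by rewrite sqr_cmod_csinh real_normK ?num_real// lerDl sqr_ge0.
Qed.

Lemma cmod_csinhB_le x y y' :
  cmod (csinh (x +i* y) - csinh (x +i* y') : C) <= 2 * rcosh x * `|y - y'|.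
Proof.
rewrite !csinhE (le_trans (cmod_le_ReIm _))//= -!mulrBr (normrM (rsinh x)) (normrM (rcosh x)).
rewrite (_ : 2 * _ * _ = rcosh x * `|y - y'| + rcosh x * `|y - y'|); last by ring.
rewrite lerD// ler_pM// ?norm_rsinh_le ?dist_cos_le ?dist_sin_le//.
by rewrite ger0_norm// ltW// rcosh_gt0.
Qed.

(** The kernel [1 / sinh ((x + i y) / 2)]; since [cosh z = sinh (z + i pi/2) / i]
    it also covers [1 / cosh], as [ker x (y + pi)]. *)
Definition ker x y : C := (csinh ((x / 2) +i* (y / 2)))^-1.

Definition rho x : R := (rcosh (x / 2))^-1.

Arguments ker : simpl never.
Arguments rho : simpl never.

Lemma half_complex x y : (x +i* y) / 2 = (x / 2) +i* (y / 2) :> C.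
Proof.
have -> : (2^-1 : C) = (2^-1)%:C by rewrite fmorphV rmorph_nat.
by apply: complex_eq => /=; ring.
Qed.

Lemma rho_gt0 x : 0 < rho x. Proof. by rewrite invr_gt0 rcosh_gt0. Qed.
Lemma rho_ge0 x : 0 <= rho x. Proof. by rewrite ltW// rho_gt0. Qed.
Lemma rho_le1 x : rho x <= 1.
Proof. by rewrite invf_le1 ?rcosh_gt0// rcosh_ge1. Qed.
Lemma rhoN x : rho (- x) = rho x. Proof. by rewrite /rho mulNr rcoshN. Qed.
Lemma sqr_rho_le x : rho x ^+ 2 <= rho x.
Proof. by rewrite expr2 ler_piMr ?rho_ge0// rho_le1. Qed.
Lemma continuous_rho : continuous rho.
Proof.
move=> x; apply: (@continuous_comp _ _ _ (fun t : R => rcosh (t / 2)) GRing.inv).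
  apply: (@continuous_comp _ _ _ (fun t : R => t / 2)).
    by apply: mulrr_continuous.
  exact: continuous_rcosh.
by apply: inv_continuous; rewrite gt_eqF// rcosh_gt0.
Qed.
Lemma measurable_rho (D : set R) : measurable_fun D rho.
Proof. by apply: measurable_funTS; exact: continuous_measurable_fun continuous_rho. Qed.

(** On a line that misses the pole, [rho] dominates the kernel and, up to a factor,
    its square. *)
Lemma ker_le x y : sin (y / 2) != 0 -> cmod (ker x y) <= rho x / `|sin (y / 2)|.
Proof.
move=> s0; rewrite /ker cmodV /rho -invfM lef_pV2 ?posrE.
- exact: cmod_csinh_ge.
- by rewrite cmod_gt0// csinh_neq0.
- by rewrite mulr_gt0 ?normr_gt0// rcosh_gt0.
Qed.

(** Uniform in [y]: it controls the kernel on whole vertical segments, where the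
    bound [ker_le] may degenerate. *)
Lemma ker_le_far x y : x != 0 -> cmod (ker x y) <= `|rsinh (x / 2)|^-1.
Proof.
move=> x0; have h := cmod_csinh_ge_rsinh (x / 2) (y / 2).
have h0 : 0 < `|rsinh (x / 2)|.
  apply: lt_le_trans (le_norm_rsinh _); rewrite normr_gt0.
  by rewrite mulf_neq0// invr_neq0.
by rewrite /ker cmodV lef_pV2// posrE (lt_le_trans h0).
Qed.

Lemma ker_lip x y y' : sin (y / 2) != 0 -> sin (y' / 2) != 0 ->
  cmod (ker x y - ker x y') <= rho x * (`|y - y'| / (`|sin (y / 2)| * `|sin (y' / 2)|)).
Proof.
move=> s0 s0'.
have n0 := csinh_neq0 (x / 2) s0; have n0' := csinh_neq0 (x / 2) s0'.
have -> : ker x y - ker x y' =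
    (csinh ((x / 2) +i* (y' / 2)) - csinh ((x / 2) +i* (y / 2))) * (ker x y * ker x y').
  by rewrite /ker; field; rewrite n0 n0'.
rewrite !cmodM.
apply: (@le_trans _ _ ((rcosh (x / 2) * `|y - y'|) *
   (rho x / `|sin (y / 2)| * (rho x / `|sin (y' / 2)|)))).
  rewrite ler_pM// ?cmod_ge0// ?mulr_ge0 ?cmod_ge0//.
    rewrite (le_trans (cmod_csinhB_le _ _ _))//.
    rewrite -mulrBl normrM (@ger0_norm _ 2^-1)// distrC.
    by rewrite le_eqVlt; apply/orP; left; apply/eqP; field.
  by rewrite ler_pM// ?cmod_ge0// ker_le.
rewrite le_eqVlt; apply/orP; left; apply/eqP; rewrite /rho; field.
by rewrite !normr_eq0 s0 s0' gt_eqF// rcosh_gt0.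
Qed.

Lemma kerJ x y : (ker x y)^* = ker x (- y).
Proof.
by rewrite /ker conjc_inv; congr (_^-1); rewrite !csinhE mulNr cosN sinN mulrN.
Qed.

Lemma kerN x y : ker (- x) (- y) = - ker x y.
Proof.
rewrite /ker -invrN; congr (_^-1); rewrite !csinhE !mulNr cosN sinN rsinhN rcoshN.
by apply: complex_eq; rewrite /= ?mulrN ?mulNr.
Qed.

Lemma kerD2pi x y : ker x (y + 2 * pi) = - ker x y.
Proof.
rewrite /ker -invrN; congr (_^-1).
rewrite mulrDl [2 * pi]mulrC mulfK// !csinhE sinDpi cosDpi.
by apply: complex_eq; rewrite /= mulrN.
Qed.

Lemma ker_pi x : ker x pi = - 'i%C * (rho x)%:C.
Proof.
rewrite /ker csinhE cos_pihalf sin_pihalf mulr0 mulr1.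
have r0 : (rcosh (x / 2))%:C != 0 :> C by rewrite fmorph_eq0 gt_eqF// rcosh_gt0.
apply: (mulIf r0); rewrite /rho fmorphV -mulrA mulVf// mulr1.
have -> : (0 +i* rcosh (x / 2)) = 'i%C * (rcosh (x / 2))%:C :> C.
  by apply: complex_eq; rewrite /=; ring.
have i0 : 'i%C != 0 :> C by rewrite eq_complex /= oner_eq0 andbF.
rewrite invfM mulfVK//; apply: (mulIf i0); rewrite mulVf// mulNr -expr2.
by rewrite sqr_i opprK.
Qed.

Lemma ker_subN x y : ker x y - ker x (- y) =
  - (2 * (rcosh (x / 2) * sin (y / 2) / (rsinh (x / 2) ^+ 2 + sin (y / 2) ^+ 2)))%:C * 'i%C.
Proof.
rewrite -kerJ /ker csinhE; apply: complex_eq => /=; first by ring.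
rewrite -[in RHS](_ : (rsinh (x / 2) * cos (y / 2)) ^+ 2 +
  (rcosh (x / 2) * sin (y / 2)) ^+ 2 = rsinh (x / 2) ^+ 2 + sin (y / 2) ^+ 2); first by ring.
by rewrite (exprMn _ (rsinh _)) (exprMn _ (rcosh _)) cos2sin2 sqr_rcosh; ring.
Qed.

Lemma den_gt0 x y : sin y != 0 -> 0 < rsinh x ^+ 2 + sin y ^+ 2.
Proof. by move=> s0; rewrite ltr_wpDl ?sqr_ge0// lt_neqAle sqr_ge0 eq_sym sqrf_eq0 s0. Qed.

Lemma Re_ker x y : complex.Re (ker x y) =
  rsinh (x / 2) * cos (y / 2) / (rsinh (x / 2) ^+ 2 + sin (y / 2) ^+ 2).
Proof.
rewrite /ker csinhE /= [in RHS](_ : rsinh (x / 2) ^+ 2 + sin (y / 2) ^+ 2 =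
  (rsinh (x / 2) * cos (y / 2)) ^+ 2 + (rcosh (x / 2) * sin (y / 2)) ^+ 2)//.
by rewrite (exprMn _ (rsinh _)) (exprMn _ (rcosh _)) cos2sin2 sqr_rcosh; ring.
Qed.

Lemma Im_ker x y : complex.Im (ker x y) =
  - (rcosh (x / 2) * sin (y / 2) / (rsinh (x / 2) ^+ 2 + sin (y / 2) ^+ 2)).
Proof.
rewrite /ker csinhE /= [in RHS](_ : rsinh (x / 2) ^+ 2 + sin (y / 2) ^+ 2 =
  (rsinh (x / 2) * cos (y / 2)) ^+ 2 + (rcosh (x / 2) * sin (y / 2)) ^+ 2)//.
by rewrite (exprMn _ (rsinh _)) (exprMn _ (rcosh _)) cos2sin2 sqr_rcosh; ring.
Qed.

Lemma continuous_half : continuous (fun t : R => t / 2).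
Proof. by move=> x; exact: mulrr_continuous. Qed.

Lemma continuous_den y : sin y != 0 ->
  continuous (fun x : R => (rsinh (x / 2) ^+ 2 + sin y ^+ 2)^-1).
Proof.
move=> s0 x; apply: cvgV; first by rewrite gt_eqF// den_gt0.
apply: cvgD; last exact: cvg_cst.
have h : rsinh (t / 2) @[t --> x] --> rsinh (x / 2).
  exact: (continuous_comp (@continuous_half x) (@continuous_rsinh R _)).
by rewrite expr2; under eq_fun do rewrite expr2; exact: cvgM.
Qed.

Lemma measurable_ker y : sin (y / 2) != 0 -> cmeasurable setT (fun x => ker x y).
Proof.
move=> s0; split.
- rewrite (funext (fun t => Re_ker t y)); apply: continuous_measurable_fun => x.
  apply: cvgM; last exact: continuous_den.
  apply: cvgM; last exact: cvg_cst.
  exact: (continuous_comp (@continuous_half x) (@continuous_rsinh R _)).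
- rewrite (funext (fun t => Im_ker t y)); apply: continuous_measurable_fun => x.
  apply: cvgN.
  apply: cvgM; last exact: continuous_den.
  apply: cvgM; last exact: cvg_cst.
  exact: (continuous_comp (@continuous_half x) (@continuous_rcosh R _)).
Qed.

End complex_sinh.

Arguments ker : simpl never.
Arguments rho : simpl never.

(** * Complex derivatives and integrals over segments *)

Section complex_derivative.
Context {R : realType}.
Local Notation C := R[i].
Implicit Types (F g : C -> C) (z w d : C).

(** Complex differentiability with a named derivative and a real modulus;
    [derivableP] relates it to [derivable]. *)
Definition cdiff F z d := forall e : R, 0 < e -> exists2 r : R, 0 < r &
  forall w, cmod (w - z) < r -> cmod (F w - F z - d * (w - z)) <= e * cmod (w - z).

Definition ccont F z := forall e : R, 0 < e -> exists2 r : R, 0 < r &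
  forall w, cmod (w - z) < r -> cmod (F w - F z) < e.

Lemma posC_real z : 0 < z -> exists2 r : R, 0 < r & z = r%:C.
Proof.
case: z => a b; rewrite ltcE /= => /andP[/eqP -> a0].
by exists a.
Qed.

Lemma derivableP F z :
  derivable (F : C^o -> C^o) z 1 <-> exists d, cdiff F z d.
Proof.
split.
  move=> /cvg_ex [d /cvgrPdist_le h]; exists d => e e0.
  have /h : 0 < e%:C by rewrite ltcR.
  move=> [r /= /posC_real [r' r'0 ->] rh].
  exists r' => // w wr; have [->|wz] := eqVneq w z.
    by rewrite !subrr mulr0 subrr cmod0 mulr0.
  have := rh (w - z); rewrite /= sub0r normrN norm_cmod ltcR => /(_ wr).
  rewrite subr_eq0 wz => /(_ isT) /=.
  rewrite -[_ *: 1]/((w - z) * 1) mulr1 subrK -[_ *: _]/((w - z)^-1 * (F w - F z)).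
  rewrite norm_cmod lecR => h1.
  have -> : F w - F z - d * (w - z) = - (d - (w - z)^-1 * (F w - F z)) * (w - z).
    by field; rewrite subr_eq0.
  by rewrite cmodM cmodN ler_wpM2r// cmod_ge0.
move=> [d hd]; apply/cvg_ex; exists d; apply/cvgrPdist_le => e /posC_real [e' e'0 ->].
have [r r0 hr] := hd _ e'0.
exists r%:C => /=; first by rewrite ltcR.
move=> h; rewrite /= sub0r normrN norm_cmod ltcR => hr' h0.
rewrite -[_ *: 1]/(h * 1) mulr1 -[_ *: _]/(h^-1 * (F (h + z) - F z)).
have := hr (h + z); rewrite addrK => /(_ hr') h1.
rewrite norm_cmod lecR.
have -> : d - h^-1 * (F (h + z) - F z) = - (F (h + z) - F z - d * h) * h^-1 by field.
rewrite cmodM cmodN cmodV ler_pdivrMr// cmod_gt0//.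
Qed.

Lemma cdiff_cont F z d : cdiff F z d -> ccont F z.
Proof.
move=> h e e0; have [r r0 hr] := h 1 ltr01.
have d1 : 0 < cmod d + 1 by rewrite ltr_wpDl// cmod_ge0.
exists (Num.min r (e / (cmod d + 1))); first by rewrite lt_min r0 divr_gt0.
move=> w; rewrite lt_min => /andP[/hr h1 h2].
have -> : F w - F z = (F w - F z - d * (w - z)) + d * (w - z) by ring.
apply: le_lt_trans (cmodD _ _) _; rewrite cmodM.
apply: le_lt_trans (_ : (cmod d + 1) * cmod (w - z) < e); last by rewrite mulrC -ltr_pdivlMr.
by rewrite mulrDl addrC lerD2l.
Qed.

Lemma ccont_affine F z (u v p : C) : ccont F z ->
  ccont (fun w => F w - u - v * (w - p)) z.
Proof.
move=> h e e0; have e2 : 0 < e / 2 by rewrite divr_gt0.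
have [r r0 hr] := h _ e2; have d1 : 0 < cmod v + 1 by rewrite ltr_wpDl// cmod_ge0.
exists (Num.min r (e / 2 / (cmod v + 1))); first by rewrite lt_min r0 divr_gt0.
move=> w; rewrite lt_min => /andP[/hr h1]; rewrite ltr_pdivlMr// mulrDr mulr1 => h2.
rewrite (_ : _ - _ = (F w - F z) - v * (w - z)); last by ring.
apply: le_lt_trans (cmodB _ _) _; rewrite cmodM.
have := cmod_ge0 (w - z); rewrite [cmod v * _]mulrC; lra.
Qed.

Lemma derivable_ccont F z : derivable (F : C^o -> C^o) z 1 -> ccont F z.
Proof. by move=> /derivableP [d /cdiff_cont]. Qed.

End complex_derivative.

Section segment_integral.
Context {R : realType}.
Local Notation C := R[i].
Local Notation mu := (@lebesgue_measure R).
Implicit Types (f g : R -> C) (a b c d x y : R).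

Definition rcont f x := forall e : R, 0 < e -> exists2 r : R, 0 < r &
  forall t, `|t - x| < r -> cmod (f t - f x) < e.

Lemma rcont_Re f x : rcont f x -> {for x, continuous (fun t => complex.Re (f t))}.
Proof.
move=> h; apply/cvgrPdist_lt => e e0; have [r r0 hr] := h _ e0.
exists r => // t /= tr; rewrite -ReB; apply: le_lt_trans (Re_le_cmod _) _.
by rewrite cmodC hr// distrC.
Qed.

Lemma rcont_Im f x : rcont f x -> {for x, continuous (fun t => complex.Im (f t))}.
Proof.
move=> h; apply/cvgrPdist_lt => e e0; have [r r0 hr] := h _ e0.
exists r => // t /= tr; rewrite -ImB; apply: le_lt_trans (Im_le_cmod _) _.
by rewrite cmodC hr// distrC.
Qed.

Lemma rcont_cmeasurable f : (forall x, rcont f x) -> cmeasurable setT f.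
Proof.
by move=> h; split; apply: continuous_measurable_fun => x; [exact: rcont_Re|exact: rcont_Im].
Qed.

Lemma rcont_cintegrable f a b : (forall x, a <= x <= b -> rcont f x) ->
  cintegrable `[a, b] f.
Proof.
move=> h; split; apply: continuous_compact_integrable; try exact: segment_compact.
- apply: continuous_in_subspaceT => x /set_mem; rewrite /= in_itv /= => /h; exact: rcont_Re.
- apply: continuous_in_subspaceT => x /set_mem; rewrite /= in_itv /= => /h; exact: rcont_Im.
Qed.

Lemma Rintegral_segment_cst a b M : a <= b -> \int[mu]_(t in `[a, b]) M = M * (b - a).
Proof.
move=> ab; rewrite Rintegral_cst//= lebesgue_measure_itv/= lte_fin.
have [//|] := ltP a b; move=> ba; have -> : a = b by apply/eqP; rewrite eq_le ab ba.
by rewrite subrr.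
Qed.

Lemma rintegrable_segment_cst a b M : rintegrable `[a, b] (fun=> M).
Proof.
apply: continuous_compact_integrable; first exact: segment_compact.
by apply: continuous_subspaceT => x; exact: cvg_cst.
Qed.

Lemma cint_segment_cst a b (k : C) : a <= b -> cint `[a, b] (fun=> k) = k * (b - a)%:C.
Proof.
move=> ab; apply: complex_eq; rewrite ReImE /= !Rintegral_segment_cst//.
  by rewrite mulr0 subr0.
by rewrite mulr0 add0r.
Qed.

Lemma cmod_cint_segment_le f a b M : a <= b -> cintegrable `[a, b] f ->
  (forall x, a <= x <= b -> cmod (f x) <= M) -> cmod (cint `[a, b] f) <= M * (b - a).
Proof.
move=> ab if_ fM; have mab : measurable (`[a, b]%classic : set R) by [].
apply: (le_trans (cmod_cint_le _ if_)) => //.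
rewrite -(Rintegral_segment_cst _ ab); apply: Rintegral_le => //.
- by apply: cintegrable_cmod.
- exact: rintegrable_segment_cst.
Qed.

Lemma Rintegral_segment_split (f : R -> R) a m b : a <= m <= b ->
  rintegrable `[a, b] f ->
  \int[mu]_(t in `[a, b]) f t = \int[mu]_(t in `[a, m]) f t + \int[mu]_(t in `[m, b]) f t.
Proof.
move=> /andP[am mb] if_.
have := @Rintegral_itvB R f (BLeft a) (BRight b) m if_.
rewrite !bnd_simp => /(_ am mb) /eqP; rewrite subr_eq => /eqP ->.
rewrite addrC; congr (_ + _); rewrite -Rintegral_itv_obnd_cbnd//.
apply: rintegrableS if_ => // t; rewrite /= !in_itv /= => /andP[mt ->].
by rewrite andbT (le_trans am)// ltW.
Qed.

Lemma cint_segment_split f a m b : a <= m <= b -> cintegrable `[a, b] f ->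
  cint `[a, b] f = cint `[a, m] f + cint `[m, b] f.
Proof.
by move=> amb [f1 f2]; apply: complex_eq; rewrite ReImE /=; exact: Rintegral_segment_split.
Qed.

Lemma cint_segment_point f a : cint `[a, a] f = 0.
Proof. by rewrite /cint set_itv1 !Rintegral_set1. Qed.

End segment_integral.

(** * Goursat's theorem on rectangles *)

Section rectangles.
Context {R : realType}.
Local Notation C := R[i].
Implicit Types (F g : C -> C) (a b c d x y : R).

(** The contour integral over the boundary of [[a, b] x [c, d]], with opposite
    sides paired so that constants cancel pointwise. *)
Definition rect g a b c d : C :=
  cint `[a, b] (fun x => g (x +i* c) - g (x +i* d)) +
  'i%C * cint `[c, d] (fun y => g (b +i* y) - g (a +i* y)).

Definition rect_cont g a b c d :=
  forall x y, a <= x <= b -> c <= y <= d -> ccont g (x +i* y).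

Lemma cmod_hor x t y : cmod ((t +i* y) - (x +i* y) : C) = `|t - x|.
Proof. by rewrite /cmod /= subrr expr0n/= addr0 sqrtr_sqr. Qed.

Lemma cmod_ver x t y : cmod ((y +i* t) - (y +i* x) : C) = `|t - x|.
Proof. by rewrite /cmod /= subrr expr0n/= add0r sqrtr_sqr. Qed.

Lemma ccont_hor g x y : ccont g (x +i* y) -> rcont (fun t => g (t +i* y)) x.
Proof.
move=> h e e0; have [r r0 hr] := h _ e0; exists r => // t tr.
by apply: hr; rewrite cmod_hor.
Qed.

Lemma ccont_ver g x y : ccont g (x +i* y) -> rcont (fun t => g (x +i* t)) y.
Proof.
move=> h e e0; have [r r0 hr] := h _ e0; exists r => // t tr.
by apply: hr; rewrite cmod_ver.
Qed.

Lemma rect_cont_hor g a b c d y : c <= y <= d -> rect_cont g a b c d ->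
  cintegrable `[a, b] (fun x => g (x +i* y)).
Proof. by move=> cyd h; apply: rcont_cintegrable => x axb; apply: ccont_hor; exact: h. Qed.

Lemma rect_cont_ver g a b c d x : a <= x <= b -> rect_cont g a b c d ->
  cintegrable `[c, d] (fun y => g (x +i* y)).
Proof. by move=> axb h; apply: rcont_cintegrable => y cyd; apply: ccont_ver; exact: h. Qed.

Lemma rect_contS g a b c d a' b' c' d' : a <= a' -> b' <= b -> c <= c' -> d' <= d ->
  rect_cont g a b c d -> rect_cont g a' b' c' d'.
Proof.
move=> aa bb cc dd h x y /andP[? ?] /andP[? ?]; apply: h; apply/andP; split.
- exact: le_trans aa _.
- exact: le_trans bb.
- exact: le_trans cc _.
- exact: le_trans dd.
Qed.

Lemma rect_split_hor' g a m b c d : a <= m <= b ->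
  cintegrable `[a, b] (fun x => g (x +i* c)) -> cintegrable `[a, b] (fun x => g (x +i* d)) ->
  cintegrable `[c, d] (fun y => g (a +i* y)) -> cintegrable `[c, d] (fun y => g (m +i* y)) ->
  cintegrable `[c, d] (fun y => g (b +i* y)) ->
  rect g a b c d = rect g a m c d + rect g m b c d.
Proof.
move=> amb hc hd va vm vb.
rewrite /rect (cint_segment_split amb); last exact: cintegrableB.
rewrite (cintB _ vb va)// (cintB _ vb vm)// (cintB _ vm va)//; ring.
Qed.

Lemma rect_split_ver' g a b c m d : c <= m <= d ->
  cintegrable `[a, b] (fun x => g (x +i* c)) -> cintegrable `[a, b] (fun x => g (x +i* m)) ->
  cintegrable `[a, b] (fun x => g (x +i* d)) ->
  cintegrable `[c, d] (fun y => g (a +i* y)) -> cintegrable `[c, d] (fun y => g (b +i* y)) ->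
  rect g a b c d = rect g a b c m + rect g a b m d.
Proof.
move=> cmd hc hm hd va vb.
rewrite /rect (cint_segment_split cmd); last exact: cintegrableB.
rewrite (cintB _ hc hd)// (cintB _ hc hm)// (cintB _ hm hd)//; ring.
Qed.

Lemma rect_split_hor g a m b c d : a <= m <= b -> c <= d -> rect_cont g a b c d ->
  rect g a b c d = rect g a m c d + rect g m b c d.
Proof.
move=> amb cd h; have /andP[am mb] := amb; have ab := le_trans am mb.
apply: rect_split_hor' => //.
- by apply: rect_cont_hor h; rewrite lexx.
- by apply: rect_cont_hor h; rewrite lexx cd.
- by apply: rect_cont_ver h; rewrite lexx.
- by apply: rect_cont_ver h.
- by apply: rect_cont_ver h; rewrite lexx ab.
Qed.

Lemma rect_split_ver g a b c m d : a <= b -> c <= m <= d -> rect_cont g a b c d ->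
  rect g a b c d = rect g a b c m + rect g a b m d.
Proof.
move=> ab cmd h; have /andP[cm md] := cmd; have cd := le_trans cm md.
apply: rect_split_ver' => //.
- by apply: rect_cont_hor h; rewrite lexx.
- by apply: rect_cont_hor h.
- by apply: rect_cont_hor h; rewrite lexx cd.
- by apply: rect_cont_ver h; rewrite lexx.
- by apply: rect_cont_ver h; rewrite lexx ab.
Qed.

Lemma rect_flat_hor g a c d : rect g a a c d = 0.
Proof.
rewrite /rect cint_segment_point add0r.
rewrite (_ : (fun y => _) = (fun=> 0)); last by apply/funext => y; rewrite subrr.
have [cd|dc] := leP c d; first by rewrite cint_segment_cst// mul0r mulr0.
by rewrite set_itv_ge ?bnd_simp -?ltNge// /cint !Rintegral_set0 mulr0.
Qed.

Lemma rect_flat_ver g a b c : rect g a b c c = 0.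
Proof.
rewrite /rect cint_segment_point mulr0 addr0.
rewrite (_ : (fun y => _) = (fun=> 0)); last by apply/funext => y; rewrite subrr.
have [cd|dc] := leP a b; first by rewrite cint_segment_cst// mul0r.
by rewrite set_itv_ge ?bnd_simp -?ltNge// /cint !Rintegral_set0.
Qed.

(** Subtracting an affine function does not change a contour integral; this is
    where the first order expansion of a differentiable function enters. *)
Lemma rect_affine g a b c d (u v z : C) : a <= b -> c <= d -> rect_cont g a b c d ->
  rect g a b c d = rect (fun w => g w - u - v * (w - z)) a b c d.
Proof.
move=> ab cd h; have iab : measurable (`[a, b]%classic : set R) by [].
have icd : measurable (`[c, d]%classic : set R) by [].
have hc : cintegrable `[a, b] (fun x => g (x +i* c)) by apply: rect_cont_hor h; rewrite lexx.
have hd : cintegrable `[a, b] (fun x => g (x +i* d)) by apply: rect_cont_hor h; rewrite lexx cd.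
have va : cintegrable `[c, d] (fun y => g (a +i* y)) by apply: rect_cont_ver h; rewrite lexx.
have vb : cintegrable `[c, d] (fun y => g (b +i* y)) by apply: rect_cont_ver h; rewrite lexx ab.
have icst (e f : R) (k : C) : cintegrable `[e, f] (fun=> k).
  by split; exact: rintegrable_segment_cst.
rewrite /rect.
rewrite [in RHS](@eq_cint _ _ _ (fun x => (g (x +i* c) - g (x +i* d)) + v * ('i%C * (d - c)%:C))); last first.
  move=> x _; rewrite (_ : 'i%C * (d - c)%:C = (x +i* d) - (x +i* c)); first by ring.
  by apply: complex_eq => /=; ring.
rewrite [X in _ = _ + 'i%C * X](@eq_cint _ _ _ (fun y => (g (b +i* y) - g (a +i* y)) - v * (b - a)%:C)); last first.
  move=> x _; rewrite (_ : (b - a)%:C = (b +i* x) - (a +i* x)); first by ring.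
  by apply: complex_eq => /=; ring.
rewrite (cintD iab (cintegrableB iab hc hd) (icst _ _ _)).
rewrite (cintB icd (cintegrableB icd vb va) (icst _ _ _)).
rewrite !cint_segment_cst//; ring.
Qed.

Lemma cmod_rect_le' g a b c d M : a <= b -> c <= d ->
  cintegrable `[a, b] (fun x => g (x +i* c)) -> cintegrable `[a, b] (fun x => g (x +i* d)) ->
  cintegrable `[c, d] (fun y => g (a +i* y)) -> cintegrable `[c, d] (fun y => g (b +i* y)) ->
  (forall x, a <= x <= b -> cmod (g (x +i* c)) <= M /\ cmod (g (x +i* d)) <= M) ->
  (forall y, c <= y <= d -> cmod (g (a +i* y)) <= M /\ cmod (g (b +i* y)) <= M) ->
  cmod (rect g a b c d) <= 2 * M * ((b - a) + (d - c)).
Proof.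
move=> ab cd hc hd va vb hM vM.
rewrite mulrDr; apply: le_trans (cmodD _ _) _; apply: lerD.
  apply: cmod_cint_segment_le => //; first exact: cintegrableB.
  move=> x xab; apply: le_trans (cmodB _ _) _.
  by have [h1 h2] := hM _ xab; rewrite mulr_natl mulr2n lerD.
rewrite cmodM cmodi mul1r.
apply: cmod_cint_segment_le => //; first exact: cintegrableB.
move=> x xab; apply: le_trans (cmodB _ _) _.
by have [h1 h2] := vM _ xab; rewrite mulr_natl mulr2n lerD.
Qed.

Lemma cmod_rect_le g a b c d M : a <= b -> c <= d -> rect_cont g a b c d ->
  (forall x y, a <= x <= b -> c <= y <= d -> cmod (g (x +i* y)) <= M) ->
  cmod (rect g a b c d) <= 2 * M * ((b - a) + (d - c)).
Proof.
move=> ab cd h gM; apply: cmod_rect_le' => //.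
- by apply: rect_cont_hor h; rewrite lexx.
- by apply: rect_cont_hor h; rewrite lexx cd.
- by apply: rect_cont_ver h; rewrite lexx.
- by apply: rect_cont_ver h; rewrite lexx ab.
- by move=> x xab; split; apply: gM => //; rewrite lexx ?cd.
- by move=> y ycd; split; apply: gM => //; rewrite lexx ?ab.
Qed.

End rectangles.

Section goursat.
Context {R : realType}.
Local Notation C := R[i].
Implicit Types (F g : C -> C) (a b c d x y : R) (I J : R * R).

Definition half (s : bool) I : R * R :=
  if s then (I.1, (I.1 + I.2) / 2) else ((I.1 + I.2) / 2, I.2).

Lemma half_width s I : (half s I).2 - (half s I).1 = (I.2 - I.1) / 2.
Proof. by case: s => /=; field. Qed.

Lemma half_le s I : I.1 <= I.2 ->
  [/\ I.1 <= (half s I).1, (half s I).1 <= (half s I).2 & (half s I).2 <= I.2].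
Proof. by move=> h; case: s => /=; split => //; lra. Qed.

Lemma nested_halves (I : nat -> R * R) : (I 0%N).1 <= (I 0%N).2 ->
  (forall n, exists s, I n.+1 = half s (I n)) ->
  (forall n, (I n).2 - (I n).1 = ((I 0%N).2 - (I 0%N).1) / 2 ^+ n) /\
  exists x, forall n, (I n).1 <= x <= (I n).2.
Proof.
move=> I0 Ih.
have Ile n : (I n).1 <= (I n).2.
  by elim: n => // n IHn; have [s ->] := Ih n; have [] := half_le s IHn.
have Imono n k : (I n).1 <= (I (n + k)%N).1 /\ (I (n + k)%N).2 <= (I n).2.
  elim: k => [|k [h1 h2]]; first by rewrite addn0.
  rewrite addnS; have [s ->] := Ih (n + k)%N; have [h3 _ h4] := half_le s (Ile (n + k)%N).
  by split; [exact: le_trans h3|exact: le_trans h2].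
split.
  elim=> [|n IHn]; first by rewrite expr0 divr1.
  have [s ->] := Ih n; rewrite half_width IHn exprS; field.
  by rewrite expf_neq0.
have cross n k : (I n).1 <= (I k).2.
  have [h1 _] := Imono n k; have [_ h2] := Imono k n.
  by apply: le_trans h1 _; apply: le_trans (Ile _) _; rewrite addnC.
have sI : has_sup (range (fun n => (I n).1)).
  split; first by exists (I 0%N).1; exists 0%N.
  by exists (I 0%N).2 => _ [n _ <-].
exists (sup (range (fun n => (I n).1))) => n; apply/andP; split.
  by apply: ub_le_sup; [exact: sI.2|exists n].
by apply: ge_sup; [exact: sI.1|move=> _ [k _ <-]].
Qed.

Lemma geometric_small (c e : R) : 0 <= c -> 0 < e -> exists N, forall n, (N <= n)%N -> c / 2 ^+ n < e.
Proof.
move=> c0 e0; have /cvgr0Pnorm_lt /(_ _ e0) [N _ hN] : c / 2 ^+ n @[n --> \oo] --> (0 : R).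
  rewrite (_ : (fun n => _) = geometric c (2^-1)).
    by apply: cvg_geometric; rewrite ger0_norm// invf_lt1// ltr1n.
  by apply/funext => n; rewrite /geometric /= exprVn.
by exists N => n /hN; apply: le_lt_trans; exact: ler_norm.
Qed.

(** Goursat's argument. If the contour integral exceeded [k] times the area,
    the same would hold for one quarter of the rectangle, and so on down to a
    point, where complex differentiability forbids it. *)
Theorem goursat g a b c d : a <= b -> c <= d ->
  (forall x y, a <= x <= b -> c <= y <= d -> derivable (g : C^o -> C^o) (x +i* y) 1) ->
  rect g a b c d = 0.
Proof.
rewrite le_eqVlt => /predU1P[-> _ _|ab]; first exact: rect_flat_hor.
rewrite le_eqVlt => /predU1P[-> _|cd]; first exact: rect_flat_ver.
move=> dg; apply/eqP; apply/negPn/negP => nz.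
have hcont : rect_cont g a b c d by move=> x y hx hy; apply: derivable_ccont; exact: dg.
pose area I J := (I.2 - I.1) * (J.2 - J.1).
pose rt I J := rect g I.1 I.2 J.1 J.2.
have A0 : 0 < area (a, b) (c, d) by rewrite /area /= mulr_gt0// subr_gt0.
(* half of the ratio to the area, to make [bad] a strict inequality *)
pose k := cmod (rect g a b c d) / (2 * area (a, b) (c, d)).
have k0 : 0 < k by rewrite divr_gt0 ?cmod_gt0// mulr_gt0.
pose bad I J := k * area I J < cmod (rt I J).
have bad0 : bad (a, b) (c, d).
  rewrite /bad /k /rt /=; set r := cmod _; set A := area _ _.
  have -> : r / (2 * A) * A = r / 2 by field; rewrite gt_eqF.
  have : 0 < r by exact: cmod_gt0.
  lra.
pose sub I J := [/\ a <= I.1, I.1 <= I.2, I.2 <= b & [/\ c <= J.1, J.1 <= J.2 & J.2 <= d]].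
have step I J : sub I J -> bad I J -> exists s t, bad (half s I) (half t J).
  move=> [aI I12 Ib [cJ J12 Jd]] bIJ.
  have hc : rect_cont g I.1 I.2 J.1 J.2 by exact: rect_contS hcont.
  pose m := (I.1 + I.2) / 2; pose n := (J.1 + J.2) / 2.
  have [hm1 hm2] : I.1 <= m /\ m <= I.2 by rewrite /m; split; lra.
  have [hn1 hn2] : J.1 <= n /\ n <= J.2 by rewrite /n; split; lra.
  have E : rt I J = rt (half true I) (half true J) + rt (half true I) (half false J)
     + (rt (half false I) (half true J) + rt (half false I) (half false J)).
    rewrite /rt /= -/m -/n (@rect_split_hor _ _ _ m)//; last by rewrite hm1.
    rewrite (@rect_split_ver _ _ _ _ _ n) ?hn1//; last exact: rect_contS hc.
    rewrite (@rect_split_ver _ _ m _ _ n) ?hn1//; last exact: rect_contS hc.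
  have B s t : ~ bad (half s I) (half t J) -> cmod (rt (half s I) (half t J)) <= k * area I J / 4.
    rewrite /bad => /negP; rewrite -leNgt /area !half_width.
    by rewrite (_ : _ / 2 * (_ / 2) = (I.2 - I.1) * (J.2 - J.1) / 4) ?mulrA//; field.
  apply: contrapT => h.
  have B' s t : cmod (rt (half s I) (half t J)) <= k * area I J / 4.
    by apply: B => bb; apply: h; exists s, t.
  move: bIJ; rewrite /bad E ltNge => /negP; apply.
  apply: (le_trans (cmodD _ _)); apply: (le_trans (lerD (cmodD _ _) (cmodD _ _))).
  have := B' true true; have := B' true false; have := B' false true; have := B' false false.
  lra.
pose T := {p : (R * R) * (R * R) | sub p.1 p.2 /\ bad p.1 p.2}.
have sub0 : sub (a, b) (c, d) by split => //=; [exact: ltW|split => //; exact: ltW].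
pose t0 : T := exist _ ((a, b), (c, d)) (conj sub0 bad0).
have nxt (p : T) : exists q : T, (exists s, (sval q).1 = half s (sval p).1) /\
    (exists t, (sval q).2 = half t (sval p).2).
  case: p => -[I J] [/= sIJ bIJ]; have [s [t bst]] := step _ _ sIJ bIJ.
  have sst : sub (half s I) (half t J).
    case: sIJ => aI I12 Ib [cJ J12 Jd].
    have [h1 h2 h3] := half_le s I12; have [h4 h5 h6] := half_le t J12.
    split => //; [exact: le_trans h1|exact: le_trans h3 _|split => //].
      exact: le_trans h4.
    exact: le_trans h6 _.
  exists (exist _ (half s I, half t J) (conj sst bst)) => /=.
  by split; [exists s|exists t].
have [f fP] := choice nxt.
pose q n := sval (iter n f t0).
have [wI [x xI]] := @nested_halves (fun n => (q n).1) (ltW ab) (fun n => (fP (iter n f t0)).1).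
have [wJ [y yJ]] := @nested_halves (fun n => (q n).2) (ltW cd) (fun n => (fP (iter n f t0)).2).
have xab : a <= x <= b by exact: (xI 0%N).
have ycd : c <= y <= d by exact: (yJ 0%N).
have /derivableP [v hv] := dg x y xab ycd.
pose W := (b - a) + (d - c); have W0 : 0 < W by rewrite addr_gt0// subr_gt0.
(* with this precision the final estimate is exactly [k] times the area of the [n]-th rectangle *)
pose e := k * area (a, b) (c, d) / (2 * W ^+ 2).
have e0 : 0 < e by rewrite divr_gt0// mulr_gt0// exprn_gt0.
have [r r0 hr] := hv _ e0.
have [n /(_ n (leqnn n)) Wn] := geometric_small (ltW W0) r0.
have [[aI I12 Ib [cJ J12 Jd]] badn] := svalP (iter n f t0).
move: aI I12 Ib cJ J12 Jd badn; rewrite -/(q n) => aI I12 Ib cJ J12 Jd badn.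
have WE : ((q n).1.2 - (q n).1.1) + ((q n).2.2 - (q n).2.1) = W / 2 ^+ n.
  by rewrite wI wJ /= /W; field; rewrite expf_neq0.
have hc : rect_cont g (q n).1.1 (q n).1.2 (q n).2.1 (q n).2.2 by exact: rect_contS hcont.
have := @rect_affine _ g _ _ _ _ (g (x +i* y)) v (x +i* y) I12 J12 hc.
move: badn; rewrite /bad /rt => badn E; move: badn; rewrite E ltNge => /negP; apply.
have near_p s t : (q n).1.1 <= s <= (q n).1.2 -> (q n).2.1 <= t <= (q n).2.2 ->
    cmod ((s +i* t) - (x +i* y) : C) <= W / 2 ^+ n.
  move=> /andP[h1 h2] /andP[h3 h4]; apply: le_trans (cmod_le_ReIm _) _ => /=.
  rewrite -WE; have /andP[h5 h6] := xI n; have /andP[h7 h8] := yJ n.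
  by apply: lerD; rewrite ler_norml; apply/andP; split; lra.
apply: (@le_trans _ _ (2 * (e * (W / 2 ^+ n)) * (W / 2 ^+ n))).
  rewrite -[X in _ <= _ * X]WE; apply: cmod_rect_le => //.
    by move=> s t hs ht; apply: ccont_affine; exact: hc.
  move=> s t hs ht; have h1 := near_p s t hs ht.
  apply: le_trans (hr _ (le_lt_trans h1 Wn)) _.
  by rewrite ler_pM2l.
rewrite le_eqVlt; apply/orP; left; apply/eqP.
rewrite /area wI wJ /e /area /=; field.
by rewrite expf_neq0//= gt_eqF.
Qed.

End goursat.

(** * The residue at a simple pole *)

Section residue.
Context {R : realType}.
Local Notation C := R[i].
Local Notation mu := (@lebesgue_measure R).
Implicit Types (F g q : C -> C) (a b c d x y : R).

Lemma is_derive_atan_scale (x0 r t : R) : 0 < r ->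
  is_derive t 1 (fun s : R => atan ((s - x0) / r)) (r / ((t - x0) ^+ 2 + r ^+ 2)).
Proof.
move=> r0.
have h : is_derive t 1 (fun s : R => (s - x0) / r) (r^-1).
  have -> : (fun s : R => (s - x0) / r) = r^-1 \*: (fun s : R => s - x0).
    by apply/funext => s /=; rewrite mulrC.
  have h1 : is_derive t 1 (fun s : R => s - x0) (1 - 0).
    exact: is_deriveB.
  have := is_deriveZ r^-1 h1.
  by rewrite subr0 -[_ *: _]/(r^-1 * 1) mulr1.
have := @is_derive1_comp R (@atan R) (fun s : R => (s - x0) / r) t _ _ (is_derive1_atan _) h.
have s0 : 0 < (t - x0) ^+ 2 + r ^+ 2 by rewrite ltr_wpDl ?sqr_ge0// exprn_gt0.
rewrite (_ : _^-1 * r^-1 = r / ((t - x0) ^+ 2 + r ^+ 2))//.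
by field; rewrite !gt_eqF//= addrC.
Qed.

Lemma Rintegral_poisson_segment (x0 r : R) : 0 < r ->
  \int[mu]_(t in `[x0 - r, x0 + r]) (r / ((t - x0) ^+ 2 + r ^+ 2)) = pi / 2.
Proof.
move=> r0.
have s0 t : 0 < (t - x0) ^+ 2 + r ^+ 2 by rewrite ltr_wpDl ?sqr_ge0// exprn_gt0.
have cF : continuous (fun s : R => atan ((s - x0) / r)).
  move=> t; apply/differentiable_continuous/derivable1_diffP.
  by have [] := is_derive_atan_scale x0 t r0.
have cf : continuous (fun t : R => r / ((t - x0) ^+ 2 + r ^+ 2)).
  move=> t; apply: cvgM; first exact: cvg_cst.
  apply: cvgV; first by rewrite gt_eqF.
  apply: cvgD; last exact: cvg_cst.
  have h : s - x0 @[s --> t] --> t - x0 by apply: cvgB; [exact: cvg_id|exact: cvg_cst].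
  by rewrite expr2; under eq_fun do rewrite expr2; exact: cvgM.
rewrite /Rintegral (@continuous_FTC2 _ _ (fun s : R => atan ((s - x0) / r))).
- rewrite -EFinB /= [x0 + r]addrC [x0 - r]addrC !addrK mulNr divff ?gt_eqF//.
  by rewrite atanN atan1; field.
- by lra.
- exact: continuous_subspaceT.
- split.
  + by move=> t _; have [] := is_derive_atan_scale x0 t r0.
  + by apply: cvg_at_right_filter; exact: cF.
  + by apply: cvg_at_left_filter; exact: cF.
- by move=> t _; rewrite derive1E; have [_ ->] := is_derive_atan_scale x0 t r0.
Qed.

Lemma neq_complex (x y x0 y0 : R) : (x != x0) || (y != y0) -> (x +i* y) - (x0 +i* y0) != 0 :> C.
Proof.
by rewrite subr_eq0 eq_complex /= negb_and.
Qed.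

Lemma cint_real D (f : R -> R) (k : C) : measurable D -> rintegrable D f ->
  cint D (fun t => k * (f t)%:C) = k * (\int[mu]_(t in D) f t)%:C.
Proof.
move=> mD if_; rewrite cintZ//; last first.
  split => //=; apply: (eq_rintegrable mD _ (rintegrableZ 0 mD if_)) => t _.
  by rewrite mul0r.
by congr (_ * _); rewrite /cint /= Rintegral_cst// mul0r.
Qed.

Lemma rintegrable_poisson_segment (x0 r u v : R) : 0 < r ->
  rintegrable `[u, v] (fun t => r / ((t - x0) ^+ 2 + r ^+ 2)).
Proof.
move=> r0; apply: continuous_compact_integrable; first exact: segment_compact.
have s0 t : 0 < (t - x0) ^+ 2 + r ^+ 2 by rewrite ltr_wpDl ?sqr_ge0// exprn_gt0.
apply: continuous_subspaceT => t; apply: cvgM; first exact: cvg_cst.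
apply: cvgV; first by rewrite gt_eqF.
apply: cvgD; last exact: cvg_cst.
have h : s - x0 @[s --> t] --> t - x0 by apply: cvgB; [exact: cvg_id|exact: cvg_cst].
by rewrite expr2; under eq_fun do rewrite expr2; exact: cvgM.
Qed.

(** Each pair of opposite sides contributes an arctangent integral, half of the
    full angle. *)
Lemma rect_inv_square (x0 y0 r : R) : 0 < r ->
  rect (fun w : C => (w - (x0 +i* y0))^-1) (x0 - r) (x0 + r) (y0 - r) (y0 + r)
  = (2 * pi)%:C * 'i%C.
Proof.
move=> r0; rewrite /rect.
have s0 t : 0 < (t - x0) ^+ 2 + r ^+ 2 by rewrite ltr_wpDl ?sqr_ge0// exprn_gt0.
rewrite (@eq_cint _ _ _ (fun x => (2%:C * 'i%C) * (r / ((x - x0) ^+ 2 + r ^+ 2))%:C)); last first.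
  move=> x _; apply: complex_eq => /=.
    by rewrite [y0 + r]addrC [y0 - r]addrC !addrK sqrrN; ring.
  by rewrite [y0 + r]addrC [y0 - r]addrC !addrK sqrrN; ring.
rewrite cint_real ?Rintegral_poisson_segment//; last exact: rintegrable_poisson_segment.
rewrite (@eq_cint _ (`[y0 - r, y0 + r]) _ (fun y => 2%:C * (r / ((y - y0) ^+ 2 + r ^+ 2))%:C)); last first.
  move=> y _; apply: complex_eq => /=.
    by rewrite [x0 + r]addrC [x0 - r]addrC !addrK sqrrN [(y - y0) ^+ 2 + _]addrC; ring.
  by rewrite [x0 + r]addrC [x0 - r]addrC !addrK sqrrN; ring.
rewrite cint_real ?Rintegral_poisson_segment//; last exact: rintegrable_poisson_segment.
by apply: complex_eq => /=; field.
Qed.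

Lemma ccont_inv_sub (w z : C) : w != z -> ccont (fun v => (v - z)^-1) w.
Proof.
move=> wz; apply: derivable_ccont.
apply: (@derivableV C C^o (fun v : C^o => v - z : C^o)).
  by rewrite subr_eq0.
by apply: derivableB => //; exact: derivable_cst.
Qed.

Lemma cint_subZ D (f1 f2 h1 h2 : R -> C) (k : C) : measurable D ->
  cintegrable D f1 -> cintegrable D f2 -> cintegrable D h1 -> cintegrable D h2 ->
  cint D (fun t => (f1 t - k * h1 t) - (f2 t - k * h2 t)) =
  cint D (fun t => f1 t - f2 t) - k * cint D (fun t => h1 t - h2 t).
Proof.
move=> mD i1 i2 j1 j2.
have k1 := cintegrableZ k mD j1; have k2 := cintegrableZ k mD j2.
rewrite (cintB mD (cintegrableB mD i1 k1) (cintegrableB mD i2 k2)).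
by rewrite !(cintB mD)// !(cintZ _ mD)//; ring.
Qed.

(** The residue theorem for a simple pole in a rectangle: by Goursat the contour
    shrinks to a small square, where only the value [q z] of the numerator
    matters. *)
Lemma rect_simple_pole g q a b c d x0 y0 : a < x0 < b -> c < y0 < d ->
  (forall x y, a <= x <= b -> c <= y <= d -> (x != x0) || (y != y0) ->
     derivable (g : C^o -> C^o) (x +i* y) 1) ->
  (forall w, w != x0 +i* y0 -> g w = q w / (w - (x0 +i* y0))) ->
  ccont q (x0 +i* y0) ->
  rect g a b c d = (2 * pi)%:C * 'i%C * q (x0 +i* y0).
Proof.
move=> /andP[ax xb] /andP[cy yd] dg gq cq; set z := x0 +i* y0.
have hor u v y : a <= u -> v <= b -> c <= y <= d -> y != y0 ->
    cintegrable `[u, v] (fun x => g (x +i* y)).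
  move=> au vb ycd yy; apply: rcont_cintegrable => x /andP[ux xv].
  apply/ccont_hor/derivable_ccont/dg => //; last by rewrite yy orbT.
  by rewrite (le_trans au)// (le_trans xv).
have ver u v x : c <= u -> v <= d -> a <= x <= b -> x != x0 ->
    cintegrable `[u, v] (fun y => g (x +i* y)).
  move=> au vb ycd yy; apply: rcont_cintegrable => y /andP[uy yv].
  apply/ccont_ver/derivable_ccont/dg => //; last by rewrite yy.
  by rewrite (le_trans au)// (le_trans yv).
have shrink r : 0 < r -> r < x0 - a -> r < b - x0 -> r < y0 - c -> r < d - y0 ->
    rect g a b c d = rect g (x0 - r) (x0 + r) (y0 - r) (y0 + r).
  move=> r0 /ltW; rewrite lerBrDl -lerBrDr => h1.
  move=> /ltW; rewrite lerBrDl => h2 /ltW; rewrite lerBrDl -lerBrDr => h3.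
  move=> /ltW; rewrite lerBrDl => h4.
  have xm' : x0 - r < x0 by rewrite gtrBl.
  have xp' : x0 < x0 + r by rewrite ltrDl.
  have ym' : y0 - r < y0 by rewrite gtrBl.
  have yp' : y0 < y0 + r by rewrite ltrDl.
  have xmp := ltW (lt_trans xm' xp'); have ymp := ltW (lt_trans ym' yp').
  have xmb := le_trans xmp h2; have ymd := le_trans ymp h4.
  have axp := le_trans h1 xmp; have cyp := le_trans h3 ymp.
  have ab := le_trans h1 xmb; have cd := le_trans h3 ymd.
  have xm : x0 - r != x0 by rewrite lt_eqF.
  have xp : x0 + r != x0 by rewrite gt_eqF.
  have ym : y0 - r != y0 by rewrite lt_eqF.
  have yp : y0 + r != y0 by rewrite gt_eqF.
  have yc : c != y0 by rewrite lt_eqF.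
  have yd' : d != y0 by rewrite gt_eqF.
  have xa : a != x0 by rewrite lt_eqF.
  have xb' : b != x0 by rewrite gt_eqF.
  rewrite (@rect_split_hor' _ _ _ (x0 - r)); first last.
  - by apply: ver; rewrite ?lexx ?ab.
  - by apply: ver; rewrite ?lexx ?h1.
  - by apply: ver; rewrite ?lexx ?ab.
  - by apply: hor; rewrite ?lexx ?cd.
  - by apply: hor; rewrite ?lexx ?cd.
  - by rewrite h1.
  rewrite [X in X + _]goursat ?add0r//; last first.
    move=> x y /andP[ax' xx] hy; apply: dg => //; first by rewrite ax' (le_trans xx).
    by rewrite lt_eqF// (le_lt_trans xx).
  rewrite (@rect_split_hor' _ _ _ (x0 + r)); first last.
  - by apply: ver; rewrite ?lexx ?ab.
  - by apply: ver; rewrite ?lexx ?axp.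
  - by apply: ver; rewrite ?lexx ?h1.
  - by apply: hor; rewrite ?lexx ?cd.
  - by apply: hor; rewrite ?lexx ?cd.
  - by rewrite xmp.
  rewrite [X in _ + X]goursat ?addr0//; last first.
    move=> x y /andP[xx xb''] hy; apply: dg => //; first by rewrite xb'' andbT (le_trans axp).
    by rewrite gt_eqF// (lt_le_trans xp').
  rewrite (@rect_split_ver' _ _ _ _ _ (y0 - r)); first last.
  - by apply: ver; rewrite ?lexx ?axp.
  - by apply: ver; rewrite ?lexx ?h1.
  - by apply: hor; rewrite ?lexx ?cd.
  - by apply: hor; rewrite ?lexx ?h3.
  - by apply: hor; rewrite ?lexx ?cd.
  - by rewrite h3.
  rewrite [X in X + _]goursat ?add0r//; last first.
    move=> x y /andP[ax' xx] /andP[cy' yy]; apply: dg.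
    - by rewrite (le_trans h1)// (le_trans xx).
    - by rewrite cy' (le_trans yy).
    - by rewrite orbC lt_eqF// (le_lt_trans yy).
  rewrite (@rect_split_ver' _ _ _ _ _ (y0 + r)); first last.
  - by apply: ver; rewrite ?lexx ?axp.
  - by apply: ver; rewrite ?lexx ?h1.
  - by apply: hor; rewrite ?lexx ?cd.
  - by apply: hor; rewrite ?lexx ?cyp.
  - by apply: hor; rewrite ?lexx ?h3.
  - by rewrite ymp.
  rewrite [X in _ + X]goursat ?addr0// => x y /andP[ax' xx] /andP[yy yd''].
  apply: dg.
  - by rewrite (le_trans h1)// (le_trans xx).
  - by rewrite yd'' andbT (le_trans cyp).
  - by rewrite orbC gt_eqF// (lt_le_trans yp').
apply/eqP; rewrite -subr_eq0; apply/eqP/cmod_eq0/eqP.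
rewrite eq_le cmod_ge0 andbT; apply/ler_addgt0Pr => e e0; rewrite add0r.
have e8 : 0 < e / 8 by rewrite divr_gt0.
(* [8 r] is the perimeter of the square of side [2 r] *)
have [r1 r10 hr1] := cq _ e8.
have [r [r0 [h1 h2 h3 h4] hr]] : exists r, [/\ 0 < r,
    [/\ r < x0 - a, r < b - x0, r < y0 - c & r < d - y0] & r + r < r1].
  pose m := Num.min (Num.min (x0 - a) (b - x0)) (Num.min (y0 - c) (d - y0)).
  have m0 : 0 < m.
    by rewrite lt_min; apply/andP; split; rewrite lt_min !subr_gt0 ?ax ?cy.
  pose n := Num.min m (r1 / 2); have n0 : 0 < n by rewrite lt_min m0 divr_gt0.
  have nm : n / 2 < m.
    have : n <= m by rewrite ge_min lexx.
    by move: n0; clear; lra.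
  have nr : n <= r1 / 2 by rewrite ge_min lexx orbT.
  exists (n / 2); split; first by rewrite divr_gt0.
    by move: nm; rewrite lt_min => /andP[]; rewrite !lt_min => /andP[-> ->] /andP[-> ->].
  by move: nr n0; clear; lra.
rewrite (shrink r)//.
have xm : x0 - r != x0 by rewrite lt_eqF// gtrBl.
have xp : x0 + r != x0 by rewrite gt_eqF// ltrDl.
have ym : y0 - r != y0 by rewrite lt_eqF// gtrBl.
have yp : y0 + r != y0 by rewrite gt_eqF// ltrDl.
have xmp : x0 - r <= x0 + r by rewrite lerD2l; move: r0; clear; lra.
have ymp : y0 - r <= y0 + r by rewrite lerD2l; move: r0; clear; lra.
pose g0 (w : C) := (w - z)^-1; pose g1 w := g w - q z * g0 w.
have hor0 u v y : y != y0 -> cintegrable `[u, v] (fun x => g0 (x +i* y)).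
  move=> yy; apply: rcont_cintegrable => x _; apply/ccont_hor; apply: ccont_inv_sub.
  by rewrite -subr_eq0 neq_complex// yy orbT.
have ver0 u v x : x != x0 -> cintegrable `[u, v] (fun y => g0 (x +i* y)).
  move=> xx; apply: rcont_cintegrable => y _; apply/ccont_ver; apply: ccont_inv_sub.
  by rewrite -subr_eq0 neq_complex// xx.
have hax : a <= x0 - r by rewrite lerBrDl -lerBrDr ltW.
have hbx : x0 + r <= b by rewrite -lerBrDl ltW.
have hcy : c <= y0 - r by rewrite lerBrDl -lerBrDr ltW.
have hdy : y0 + r <= d by rewrite -lerBrDl ltW.
have hM : cintegrable `[x0 - r, x0 + r] (fun x => g (x +i* (y0 - r))).
  by apply: hor; rewrite // hcy (le_trans ymp).
have hP : cintegrable `[x0 - r, x0 + r] (fun x => g (x +i* (y0 + r))).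
  by apply: hor; rewrite // hdy (le_trans hcy).
have vM : cintegrable `[y0 - r, y0 + r] (fun y => g ((x0 - r) +i* y)).
  by apply: ver; rewrite // hax (le_trans xmp).
have vP : cintegrable `[y0 - r, y0 + r] (fun y => g ((x0 + r) +i* y)).
  by apply: ver; rewrite // hbx (le_trans hax).
have hor1 y : y != y0 -> cintegrable `[x0 - r, x0 + r] (fun x => g (x +i* y)) ->
    cintegrable `[x0 - r, x0 + r] (fun x => g1 (x +i* y)).
  by move=> yy hg; apply: cintegrableB => //; apply: cintegrableZ => //; exact: hor0.
have ver1 x : x != x0 -> cintegrable `[y0 - r, y0 + r] (fun y => g (x +i* y)) ->
    cintegrable `[y0 - r, y0 + r] (fun y => g1 (x +i* y)).
  by move=> yy hg; apply: cintegrableB => //; apply: cintegrableZ => //; exact: ver0.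
have E : rect g (x0 - r) (x0 + r) (y0 - r) (y0 + r) =
    rect g1 (x0 - r) (x0 + r) (y0 - r) (y0 + r) + (2 * pi)%:C * 'i%C * q z.
  rewrite -(rect_inv_square x0 y0 r0) /rect -/g0.
  rewrite (cint_subZ (q z) _ hM hP (hor0 _ _ _ ym) (hor0 _ _ _ yp))//.
  rewrite (cint_subZ (q z) _ vP vM (ver0 _ _ _ xp) (ver0 _ _ _ xm))//.
  ring.
rewrite E addrK.
have bnd w : r <= cmod (w - z) -> cmod (w - z) < r1 -> cmod (g1 w) <= e / 8 / r.
  move=> rw wr; have wz : w != z.
    by apply/eqP => wz; move: rw; rewrite wz subrr cmod0 leNgt r0.
  rewrite /g1 /g0 gq// -mulrBl cmodM cmodV.
  apply: ler_pM => //; rewrite ?cmod_ge0// ?invr_ge0 ?cmod_ge0//.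
    exact/ltW/hr1.
  by rewrite lef_pV2 ?posrE// (lt_le_trans r0).
have inr (s t : R) : `|s - x0| <= r -> `|t - y0| <= r -> cmod ((s +i* t) - z) < r1.
  move=> hs ht; apply: (le_lt_trans (cmod_le_ReIm _)).
  by apply: le_lt_trans hr; rewrite /= lerD.
apply: (@le_trans _ _ (2 * (e / 8 / r) * ((x0 + r - (x0 - r)) + (y0 + r - (y0 - r))))).
  apply: cmod_rect_le' => //.
  - exact: hor1.
  - exact: hor1.
  - exact: ver1.
  - exact: ver1.
  - move=> x; rewrite -ler_distl => hx; split; apply: bnd.
    + by apply: le_trans (Im_le_cmod _); rewrite /= [y0 - r]addrC addrK normrN ger0_norm// ltW.
    + by apply: inr => //; rewrite [y0 - r]addrC addrK normrN ger0_norm// ltW.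
    + by apply: le_trans (Im_le_cmod _); rewrite /= [y0 + r]addrC addrK ger0_norm// ltW.
    + by apply: inr => //; rewrite [y0 + r]addrC addrK ger0_norm// ltW.
  - move=> x; rewrite -ler_distl => hx; split; apply: bnd.
    + by apply: le_trans (Re_le_cmod _); rewrite /= [x0 - r]addrC addrK normrN ger0_norm// ltW.
    + by apply: inr => //; rewrite [x0 - r]addrC addrK normrN ger0_norm// ltW.
    + by apply: le_trans (Re_le_cmod _); rewrite /= [x0 + r]addrC addrK ger0_norm// ltW.
    + by apply: inr => //; rewrite [x0 + r]addrC addrK ger0_norm// ltW.
rewrite le_eqVlt; apply/orP; left; apply/eqP; field.
by rewrite gt_eqF.
Qed.

End residue.

(** * The Poisson kernel of the strip *)

Section poisson_kernel.
Context {R : realType}.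
Local Notation mu := (@lebesgue_measure R).
Implicit Types (a x t : R).

(** For [a = sin (y / 2)] this is [i (ker x y - ker x (- y)) / 2]. The substitution
    [u = sinh (x / 2)] turns it into the Poisson kernel of the half plane, hence
    the arctangent as primitive. *)
Definition pois a x : R := rcosh (x / 2) * a / (rsinh (x / 2) ^+ 2 + a ^+ 2).

Lemma pois_den a x : 0 < a -> 0 < rsinh (x / 2) ^+ 2 + a ^+ 2.
Proof. by move=> a0; rewrite ltr_wpDl ?sqr_ge0// exprn_gt0. Qed.

Lemma pois_ge0 a x : 0 < a -> 0 <= pois a x.
Proof.
move=> a0; rewrite /pois divr_ge0 ?(ltW (pois_den x a0))// mulr_ge0 ?(ltW a0)//.
exact/ltW/rcosh_gt0.
Qed.

Lemma poisN a x : pois a (- x) = pois a x.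
Proof. by rewrite /pois mulNr rcoshN rsinhN sqrrN. Qed.

Lemma continuous_pois a : 0 < a -> continuous (pois a).
Proof.
move=> a0 x; rewrite /pois; apply: cvgM.
  apply: cvgM; last exact: cvg_cst.
  exact: (continuous_comp (@continuous_half R x) (@continuous_rcosh R _)).
apply: cvgV; first by rewrite gt_eqF// pois_den.
apply: cvgD; last exact: cvg_cst.
have h : rsinh (t / 2) @[t --> x] --> rsinh (x / 2).
  exact: (continuous_comp (@continuous_half R x) (@continuous_rsinh R _)).
by rewrite expr2; under eq_fun do rewrite expr2; exact: cvgM.
Qed.

Lemma is_derive_half x : is_derive x 1 (fun t : R => t / 2) (2^-1).
Proof.
have -> : (fun t : R => t / 2) = 2^-1 \*: id.
  by apply/funext => t /=; rewrite mulrC.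
have := is_deriveZ (2^-1 : R) (@is_derive_id R R^o x 1).
by rewrite -[_ *: _]/(2^-1 * 1) mulr1.
Qed.

Lemma is_derive_pois_primitive a x : 0 < a ->
  is_derive x 1 (fun t : R => 2 * atan (rsinh (t / 2) / a)) (pois a x).
Proof.
move=> a0.
have h1 := @is_derive1_comp R rsinh (fun t : R => t / 2) x _ _ (is_derive_rsinh (x / 2)) (is_derive_half x).
have h2 : is_derive x 1 (fun t : R => rsinh (t / 2) / a) (a^-1 * (rcosh (x / 2) * 2^-1)).
  have -> : (fun t : R => rsinh (t / 2) / a) = a^-1 \*: (fun t : R => rsinh (t / 2)).
    by apply/funext => t /=; rewrite mulrC.
  exact: is_deriveZ.
have h3 := @is_derive1_comp R (@atan R) (fun s : R => rsinh (s / 2) / a) x _ _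
  (is_derive1_atan _) h2.
have h4 := is_deriveZ (2 : R) h3.
rewrite (_ : pois a x = 2 *: ((1 + (rsinh (x / 2) / a) ^+ 2)^-1 * (a^-1 * (rcosh (x / 2) / 2)))); first by [].
rewrite -[_ *: _]/(2 * _) /pois.
have := pois_den x a0; have := sqr_ge0 (rsinh (x / 2)).
move: (rsinh (x / 2)) (rcosh (x / 2)) => s c s0 h0; field.
by rewrite !gt_eqF//= [X in 0 < X]addrC.
Qed.

Lemma integral_pois0 a : 0 < a -> (\int[mu]_x (pois a x)%:E = (2 * pi)%:E)%E.
Proof.
move=> a0; rewrite ge0_symfun_integralT; first last.
- by move=> x /=; rewrite poisN.
- exact: continuous_pois.
- by move=> x; exact: pois_ge0.
have cF : continuous (fun t : R => 2 * atan (rsinh (t / 2) / a)).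
  move=> t; apply/differentiable_continuous/derivable1_diffP.
  by have [] := is_derive_pois_primitive t a0.
rewrite (_ : [set x | 0 <= x] = `[0, +oo[%classic); last first.
  by apply/seteqP; split => x /=; rewrite in_itv/= andbT.
rewrite (@ge0_continuous_FTC2y _ _ (fun t : R => 2 * atan (rsinh (t / 2) / a)) _ pi).
- by rewrite mul0r rsinh0 mul0r atan0 mulr0 -EFinB subr0 -EFinM.
- by move=> x _; exact: pois_ge0.
- by apply: continuous_subspaceT; exact: continuous_pois.
- rewrite (_ : pi = 2 * (pi / 2)); last by field.
  apply: cvgM; first exact: cvg_cst.
  apply: (@cvg_comp _ _ _ (fun t : R => rsinh (t / 2) / a) (@atan R) _ +oo); last exact: cvgy_atan.
  apply: (@ger_cvgy _ _ _ _ (fun x : R => x / (2 * a))).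
    near=> x; have x0 : 0 <= x by near: x; exact: nbhs_pinfty_ge.
    rewrite invfM mulrA ler_pM2r ?invr_gt0//.
    have x2 : 0 <= x / 2 by rewrite divr_ge0.
    have := le_norm_rsinh (x / 2); rewrite (ger0_norm x2) => h; apply: (le_trans h).
    rewrite ger0_norm// /rsinh divr_ge0// subr_ge0 ler_expR.
    by move: x2; clear; lra.
  by apply: gt0_cvgMly; [rewrite invr_gt0 mulr_gt0|exact: cvg_id].
- by move=> x _; have [] := is_derive_pois_primitive x a0.
- by apply: cvg_at_right_filter; exact: cF.
- by move=> x _; rewrite derive1E; have [_ ->] := is_derive_pois_primitive x a0.
Unshelve. all: by end_near. Qed.

Lemma integral_shift (G : R -> R) t : continuous G -> (forall x, 0 <= G x) ->
  (\int[mu]_x (G (x - t))%:E = \int[mu]_x (G x)%:E)%E.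
Proof.
move=> cG G0; pose F (x : R) := x - t.
have dF x : is_derive x 1 F 1.
  have h1 : is_derive x 1 (fun s : R => s - t) (1 - 0) by exact: is_deriveB.
  by move: h1; rewrite subr0.
have F'E : F^`()%classic = cst 1.
  by apply/funext => x; rewrite derive1E; have [_ ->] := dF x.
rewrite (@increasing_ge0_integration_by_substitutionT _ F G) => //.
- apply: eq_integral => x _; rewrite F'E.
  by rewrite -[((G \o F) * cst 1) x]/(G (F x) * 1) mulr1.
- by move=> x y xy; rewrite ltrD2r.
- by rewrite F'E; exact: cst_continuous.
- by rewrite F'E; exact: is_cvg_cst.
- by rewrite F'E; exact: is_cvg_cst.
- exact: cvg_addrr_Ny.
- exact: cvg_addrr.
Qed.

Lemma integral_pois a t : 0 < a -> (\int[mu]_x (pois a (x - t))%:E = (2 * pi)%:E)%E.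
Proof.
move=> a0; rewrite integral_shift ?integral_pois0//.
- exact: continuous_pois.
- by move=> x; exact: pois_ge0.
Qed.

Lemma rintegrable_pois a t : 0 < a -> rintegrable setT (fun x => pois a (x - t)).
Proof.
move=> a0; apply: rintegrable_ge0 => //.
- apply: continuous_measurable_fun => x.
  apply: (@continuous_comp _ _ _ (fun x : R => x - t) (pois a)); last exact: continuous_pois.
  by apply: cvgB; [exact: cvg_id|exact: cvg_cst].
- by move=> x _; exact: pois_ge0.
- by rewrite integral_pois// ltry.
Qed.

Lemma Rintegral_pois a t : 0 < a -> \int[mu]_x (pois a (x - t)) = 2 * pi.
Proof. by move=> a0; rewrite /Rintegral integral_pois. Qed.

(** The bounded kernel is itself a Poisson kernel, which provides its integral. *)
Lemma rho_pois x : rho x = pois 1 x.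
Proof.
have c0 := rcosh_gt0 (x / 2).
by rewrite /rho /pois mulr1 expr1n addrC -sqr_rcosh; field; rewrite gt_eqF.
Qed.

Lemma rintegrable_rho t : rintegrable setT (fun x => rho (x - t)).
Proof. by under eq_fun do rewrite rho_pois; exact: rintegrable_pois. Qed.

Lemma Rintegral_rho t : \int[mu]_x (rho (x - t)) = 2 * pi.
Proof. by under eq_Rintegral do rewrite rho_pois; exact: Rintegral_pois. Qed.

End poisson_kernel.

(** * Joint measurability and tails of integrals *)

Section joint_measurability.
Context {R : realType}.
Local Notation mu := (@lebesgue_measure R).

Lemma floor_grid (n : nat) (y : R) :
  `|y - (Num.floor (n.+1%:R * y))%:~R / n.+1%:R| <= n.+1%:R^-1.
Proof.
have n0 : 0 < n.+1%:R :> R by rewrite ltr0n.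
have /andP[h1 h2] := floor_itv (n.+1%:R * y).
rewrite -(ler_pM2l n0) divff ?gt_eqF// -{1}(ger0_norm (ltW n0)) -normrM mulrBr.
rewrite mulrC [_ * (_ / _)]mulrC divfK ?gt_eqF// mulrC ger0_norm ?subr_ge0//.
by rewrite lerBlDl; apply/ltW; rewrite -[1]/(1%:~R) -intrD.
Qed.

(** The function is the pointwise limit of its values on finer and finer grids
    of the second variable. *)
Lemma measurable_caratheodory (f : R -> R -> R) :
  (forall y, measurable_fun setT (f ^~ y)) -> (forall x, continuous (f x)) ->
  measurable_fun setT (fun p : R * R => f p.1 p.2).
Proof.
move=> mf cf.
pose grid (n : nat) (k : int) : R := k%:~R / n.+1%:R.
pose cell (n : nat) (y : R) : int := Num.floor (n.+1%:R * y).
apply: (@measurable_fun_cvg _ _ _ _ (fun n (p : R * R) => f p.1 (grid n (cell n p.2)))).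
  move=> n _ B mB; rewrite setTI.
  rewrite (_ : _ @^-1` B = \bigcup_(k : int)
    (((f ^~ (grid n k)) @^-1` B) `*` ((cell n) @^-1` [set k]))); last first.
    apply/seteqP; split => -[x y] /=.
      by move=> h; exists (cell n y).
    by move=> [k _ [/= h kE]]; rewrite kE.
  apply: countable_bigcupT_measurable => // k; apply: measurableX.
    by rewrite -[_ @^-1` _]setTI; exact: mf.
  rewrite (_ : _ @^-1` _ = `[k%:~R / n.+1%:R, (k + 1)%:~R / n.+1%:R[%classic).
    exact: measurable_itv.
  have n0 : 0 < n.+1%:R :> R by rewrite ltr0n.
  apply/seteqP; split => y /=; rewrite in_itv /= ler_pdivrMr// ltr_pdivlMr// mulrC.
    by move=> <-; rewrite /cell; exact: floor_itv.
  by move=> /floor_def.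
move=> [x y] _ /=; apply: continuous_cvg; first exact: cf.
apply/cvgrPdist_le => e e0.
near=> n; apply: le_trans (floor_grid n y) _.
rewrite invf_ple ?posrE//.
have : e^-1 <= n%:R by near: n; exact: nbhs_infty_ger.
by move=> h; apply: le_trans h _; rewrite ler_nat.
Unshelve. all: by end_near. Qed.

Lemma Rdominated_convergence (u : nat -> R -> R) (v g : R -> R) :
  (forall n, measurable_fun setT (u n)) -> (forall x, u ^~ x @ \oo --> v x) ->
  rintegrable setT g -> (forall n x, `|u n x| <= g x) ->
  rintegrable setT v /\ \int[mu]_x u n x @[n --> \oo] --> \int[mu]_x v x.
Proof.
move=> mu_ uv ig ug.
have mv : measurable_fun setT v.
  by apply: (@measurable_fun_cvg _ _ _ _ u) => // x _; exact: uv.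
have uv' : {ae mu, forall x, setT x -> (EFin \o u n) x @[n --> \oo] --> (EFin \o v) x}.
  apply: ae_all => x _; apply: cvg_EFin; last exact: uv.
  by near=> n.
have ug' : {ae mu, forall x n, setT x -> (`|(EFin \o u n) x| <= (EFin \o g) x)%E}.
  by apply: ae_all => x n _ /=; rewrite lee_fin.
have [iv _ h] := @dominated_convergence _ _ _ mu setT measurableT
  (fun n => EFin \o u n) (EFin \o v) (EFin \o g)
  (fun n => (@measurable_EFinP _ _ _ _ _).2 (mu_ n)) ((@measurable_EFinP _ _ _ _ _).2 mv)
  uv' ig ug'.
split => //.
have iu n : rintegrable setT (u n) by apply: rintegrable_le ig _ => // x _; exact: ug.
move: h; rewrite (RintegralE _ iv)//.
rewrite (_ : [sequence _]_n = (fun n => (\int[mu]_x u n x)%:E)).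
  by move/fine_cvg.
by apply/funext => n; rewrite -RintegralE.
Unshelve. all: by end_near. Qed.

Lemma cint_indic (D : set R) (f : R -> R[i]) :
  cint D f = cint setT (fun t => (\1_D t)%:C * f t).
Proof.
have E (h : R -> R) : \int[mu]_(t in D) h t = \int[mu]_t (\1_D t * h t).
  rewrite Rintegral_mkcond; apply: eq_Rintegral => t _.
  by rewrite patchE indicE; case: ifP => _; rewrite ?mul1r ?mul0r.
by apply: complex_eq; rewrite /cint /= E; apply: eq_Rintegral => t _;
  rewrite ReImE /= mul0r ?subr0 ?addr0.
Qed.

(** By dominated convergence. It lets long segments replace the full line on the
    horizontal sides of a contour. *)
Lemma cint_tail_small (f : R -> R[i]) (e : R) : cintegrable setT f -> 0 < e ->
  exists N : R, forall S T, S <= - N -> N <= T -> cmod (cint setT f - cint `[S, T] f) <= e.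
Proof.
move=> if_ e0.
have iu : rintegrable setT (fun t => cmod (f t)) by exact: cintegrable_cmod.
have mu_ : measurable_fun setT (fun t => cmod (f t)) by exact: rintegrable_measurable iu.
pose A (S T : R) : set R := `[S, T]%classic.
pose u (n : nat) (t : R) := (1 - \1_(A (- n%:R) n%:R) t) * cmod (f t).
have indic01 S T (t : R) : 0 <= 1 - (\1_(A S T) t : R) <= 1.
  by rewrite indicE; case: (_ \in _); rewrite ?subrr ?subr0 ?lexx ?ler01.
have mA S T : measurable_fun setT (\1_(A S T) : R -> R).
  by apply: measurable_indic; exact: measurable_itv.
have mu1 S T : measurable_fun setT (fun t => (1 - \1_(A S T) t) * cmod (f t)).
  by apply: measurable_funM => //; apply: measurable_funB.
have bnd S T t : `|(1 - \1_(A S T) t) * cmod (f t)| <= cmod (f t).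
  have /andP[h0 h1] := indic01 S T t.
  by rewrite normrM !ger0_norm ?cmod_ge0// ler_piMl// cmod_ge0.
have u0 t : u n t @[n --> \oo] --> cst 0 t.
  apply: cvg_near_cst; near=> n.
  rewrite /u indicE mem_set; first by rewrite subrr mul0r.
  rewrite /A /= in_itv /= -ler_norml.
  by near: n; exact: nbhs_infty_ger.
have [_] := Rdominated_convergence (fun n => mu1 _ n%:R) u0 iu (fun n => bnd _ n%:R).
rewrite [X in _ --> X]Rintegral_cst// mul0r => /cvgr0Pnorm_le /(_ _ e0) [N _ /(_ N (leqnn N)) hN].
exists N%:R => S T SN NT; rewrite (@cint_indic `[S, T]) -/(A S T).
have i2 : cintegrable setT (fun t => (\1_(A S T) t)%:C * f t).
  apply: cintegrable_le iu _ => //.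
    apply: cmeasurableM; last exact: cintegrable_measurable.
    exact: cmeasurable_real.
  move=> t _; rewrite cmodM cmod_real indicE.
  by case: (_ \in _); rewrite ?normr1 ?normr0 ?mul1r// mul0r cmod_ge0.
rewrite -cintB// (le_trans (cmod_cint_le _ (cintegrableB _ if_ i2)))//.
apply: le_trans hN; apply: le_trans (ler_norm _); apply: Rintegral_le => //.
- by apply: cintegrable_cmod => //; exact: cintegrableB.
- by apply: rintegrable_le iu _ => // t _; exact: bnd.
move=> t _; rewrite -[X in X - _]mul1r -mulrBl cmodM /u ler_wpM2r ?cmod_ge0//.
rewrite -rmorphB /= cmod_real ger0_norm; last by have /andP[] := indic01 S T t.
rewrite lerB// !indicE /A; case: (boolP (t \in `[- N%:R, N%:R]%classic)) => //.
rewrite inE /= in_itv /= => /andP[h1 h2]; rewrite mem_set//= in_itv /=.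
by rewrite (le_trans SN)// (le_trans h2).
Unshelve. all: by end_near. Qed.

End joint_measurability.

(** * Differentiation rules and the analytic kernel *)

Section holomorphy.
Context {R : realType}.
Local Notation C := R[i].
Implicit Types (F g f : C -> C) (z w d : C).

Lemma ccont_cst (k : C) z : ccont (fun=> k) z.
Proof. by move=> e e0; exists 1 => // w _; rewrite subrr cmod0. Qed.

Lemma ccont_near F g z (r : R) : 0 < r -> (forall w, cmod (w - z) < r -> F w = g w) ->
  ccont F z -> ccont g z.
Proof.
move=> r0 Fg cF e e0; have [s s0 hs] := cF _ e0.
exists (Num.min r s); first by rewrite lt_min r0.
move=> w; rewrite lt_min => /andP[wr ws]; rewrite -!Fg//; first exact: hs.
by rewrite subrr cmod0.
Qed.

Lemma ccontD F g z : ccont F z -> ccont g z -> ccont (fun w => F w + g w) z.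
Proof.
move=> cF cg e e0; have e2 : 0 < e / 2 by rewrite divr_gt0.
have [r r0 hr] := cF _ e2; have [s s0 hs] := cg _ e2.
exists (Num.min r s); first by rewrite lt_min r0.
move=> w; rewrite lt_min => /andP[/hr h1 /hs h2].
rewrite (_ : _ - _ = (F w - F z) + (g w - g z)); last by ring.
by apply: le_lt_trans (cmodD _ _) _; move: h1 h2; clear; lra.
Qed.

Lemma ccontM F g z : ccont F z -> ccont g z -> ccont (fun w => F w * g w) z.
Proof.
move=> cF cg e e0.
pose M := cmod (F z) + cmod (g z) + 1.
have M0 : 0 < M by rewrite ltr_wpDl// addr_ge0 ?cmod_ge0.
have eM : 0 < Num.min 1 (e / (2 * M)) by rewrite lt_min ltr01 divr_gt0// mulr_gt0.
have [r r0 hr] := cF _ eM; have [s s0 hs] := cg _ eM.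
exists (Num.min r s); first by rewrite lt_min r0.
move=> w; rewrite lt_min => /andP[/hr h1 /hs h2].
move: h1 h2; rewrite !lt_min => /andP[h1 h1'] /andP[h2 h2'].
rewrite (_ : _ - _ = (F w - F z) * g w + F z * (g w - g z)); last by ring.
apply: le_lt_trans (cmodD _ _) _; rewrite !cmodM.
have gw : cmod (g w) <= M.
  rewrite (_ : g w = (g w - g z) + g z); last by ring.
  apply: (le_trans (cmodD _ _)); rewrite /M; have := cmod_ge0 (F z).
  by move: h2; clear; lra.
have Fz : cmod (F z) <= M by rewrite /M -addrA lerDl addr_ge0 ?cmod_ge0.
apply: (@le_lt_trans _ _ (cmod (F w - F z) * M + M * cmod (g w - g z))).
  by rewrite lerD// ?ler_wpM2l ?cmod_ge0// ler_wpM2r ?cmod_ge0.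
rewrite [M * _]mulrC -mulrDl -ltr_pdivlMr//.
rewrite (_ : e / M = e / (2 * M) + e / (2 * M)); first exact: ltrD.
by field; rewrite gt_eqF.
Qed.

Lemma ccontV F z : F z != 0 -> ccont F z -> ccont (fun w => (F w)^-1) z.
Proof.
move=> /[dup] F0 /cmod_gt0 m0 cF e e0; set m := cmod (F z) in m0.
have em : 0 < Num.min (m / 2) (e * (m ^+ 2 / 2)).
  by rewrite lt_min !divr_gt0//= mulr_gt0// divr_gt0// exprn_gt0.
have [r r0 hr] := cF _ em; exists r => // w /hr.
rewrite lt_min => /andP[h1 h2].
have Fw : m / 2 <= cmod (F w).
  have : m <= cmod (F z - F w) + cmod (F w) by rewrite (le_trans _ (cmodD _ _))// subrK.
  by rewrite cmodC; move: h1; clear; lra.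
have Fw0 : F w != 0.
  by apply/eqP => h; move: Fw; rewrite h cmod0 leNgt divr_gt0.
rewrite (_ : _ - _ = - (F w - F z) * ((F w)^-1 * (F z)^-1)); last by field; rewrite F0.
rewrite !cmodM !cmodV cmodN -/m.
apply: (@le_lt_trans _ _ (cmod (F w - F z) * ((m / 2)^-1 * m^-1))).
  rewrite ler_wpM2l ?cmod_ge0// ler_wpM2r ?invr_ge0 ?(ltW m0)// lef_pV2 ?posrE ?divr_gt0//.
  by rewrite (lt_le_trans _ Fw)// divr_gt0.
rewrite -invfM ltr_pdivrMr ?mulr_gt0 ?divr_gt0//.
by rewrite (_ : m / 2 * m = m ^+ 2 / 2)//; field.
Qed.

Lemma ccont_comp F g z : ccont g z -> ccont F (g z) -> ccont (fun w => F (g w)) z.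
Proof.
move=> cg cF e /cF [r r0 hr]; have [s s0 hs] := cg _ r0.
by exists s => // w /hs /hr.
Qed.

(** Caratheodory's form of differentiability: the difference quotient extends
    continuously. The differentiation rules then become continuity rules. *)
Lemma cdiff_quotient F z d : cdiff F z d <->
  exists q, [/\ forall w, F w = F z + q w * (w - z), q z = d & ccont q z].
Proof.
split.
  move=> h; exists (fun w => if w == z then d else (F w - F z) / (w - z)).
  split; last 2 first.
  - by rewrite eqxx.
  - move=> e e0; have e2 : 0 < e / 2 by rewrite divr_gt0.
    have [r r0 hr] := h _ e2; exists r => // w wr.
    rewrite eqxx; case: eqP => [_|/eqP wz]; first by rewrite subrr cmod0.
    have wz0 : 0 < cmod (w - z) by rewrite cmod_gt0// subr_eq0.
    rewrite (_ : _ - d = (F w - F z - d * (w - z)) / (w - z)); last first.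
      by field; rewrite subr_eq0.
    rewrite cmodM cmodV ltr_pdivrMr//; apply: le_lt_trans (hr _ wr) _.
    by rewrite ltr_pM2r// -[ltRHS](divfK (_ : 2 != 0))// ltr_pMr ?ltr1n.
  - move=> w; case: eqP => [->|/eqP wz]; first by rewrite subrr mulr0 addr0.
    by rewrite divfK ?subr_eq0// addrC subrK.
move=> [q [Fq <- cq]] e /cq [r r0 hr]; exists r => // w /hr h.
rewrite Fq (_ : _ - _ = (q w - q z) * (w - z)); last by ring.
by rewrite cmodM ler_wpM2r ?cmod_ge0// ltW.
Qed.

Lemma cdiff_id z : cdiff id z 1.
Proof.
apply/cdiff_quotient; exists (fun=> 1); split => //; last exact: ccont_cst.
by move=> w; rewrite mul1r addrC subrK.
Qed.

Lemma cdiff_cst (k : C) z : cdiff (fun=> k) z 0.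
Proof.
apply/cdiff_quotient; exists (fun=> 0); split => //; last exact: ccont_cst.
by move=> w; rewrite mul0r addr0.
Qed.

Lemma cdiffD F g z d d' : cdiff F z d -> cdiff g z d' -> cdiff (fun w => F w + g w) z (d + d').
Proof.
move=> /cdiff_quotient [p [pE <- cp]] /cdiff_quotient [q [qE <- cq]].
apply/cdiff_quotient; exists (fun w => p w + q w); split => //; last exact: ccontD.
by move=> w; rewrite pE qE; ring.
Qed.

Lemma cdiffM F g z d d' : cdiff F z d -> cdiff g z d' ->
  cdiff (fun w => F w * g w) z (d * g z + F z * d').
Proof.
move=> dF dg; have cg := cdiff_cont dg; move: dF dg.
move=> /cdiff_quotient [p [pE <- cp]] /cdiff_quotient [q [qE <- cq]].
apply/cdiff_quotient; exists (fun w => p w * g w + F z * q w); split => //.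
  by move=> w; rewrite {1}pE mulrDl {1}qE; ring.
apply: ccontD; first exact: ccontM.
by apply: ccontM => //; exact: ccont_cst.
Qed.

Lemma cdiff_comp F g z d d' : cdiff g z d -> cdiff F (g z) d' ->
  cdiff (fun w => F (g w)) z (d' * d).
Proof.
move=> dg; have cg := cdiff_cont dg; move: dg.
move=> /cdiff_quotient [p [pE <- cp]] /cdiff_quotient [q [qE <- cq]].
apply/cdiff_quotient; exists (fun w => q (g w) * p w); split => //.
  by move=> w; rewrite qE -mulrA; congr (_ + _ * _); rewrite {1}pE; ring.
apply: ccontM => //; exact: ccont_comp.
Qed.

Lemma cdiffV F z d : F z != 0 -> cdiff F z d ->
  cdiff (fun w => (F w)^-1) z (- d / F z ^+ 2).
Proof.
move=> F0 dF; have cF := cdiff_cont dF.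
have [r r0 hr] := cF _ (cmod_gt0 F0).
move: dF => /cdiff_quotient [p [pE <- cp]].
apply/cdiff_quotient.
exists (fun w => if w == z then - p z / F z ^+ 2 else ((F w)^-1 - (F z)^-1) / (w - z)).
split; last 2 first.
- by rewrite eqxx.
- apply: (@ccont_near (fun w => - p w * ((F w)^-1 * (F z)^-1)) _ _ r) => //.
    move=> w /hr h; case: eqP => [->|/eqP wz].
      by field.
    have Fw : F w != 0.
      by apply/eqP => Fw0; move: h; rewrite Fw0 sub0r cmodN ltxx.
    have -> : p w = (F w - F z) / (w - z) by rewrite {1}pE addrC addKr mulfK ?subr_eq0.
    have wz' : w - z != 0 by rewrite subr_eq0.
    by field; rewrite F0 Fw wz'.
  apply: ccontM.
    move=> e /cp [s s0 hs]; exists s => // w /hs.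
    by rewrite -opprD cmodN.
  apply: ccontM; last exact: ccont_cst.
  exact: ccontV.
- move=> w; case: eqP => [->|/eqP wz]; first by rewrite subrr mulr0 addr0.
  by rewrite divfK ?subr_eq0// addrC subrK.
Qed.

Lemma real_derivative_bound (f : R -> R) (x d : R) : is_derive x 1 f d ->
  forall e : R, 0 < e -> exists2 r : R, 0 < r &
    forall t, `|t| < r -> `|f (t + x) - f x - d * t| <= e * `|t|.
Proof.
move=> [/cvg_ex [l hl] dE] e e0.
have ld : l = d by rewrite -dE; apply/esym/cvg_lim.
move: hl => /cvgrPdist_le /(_ e e0) [r /= r0 rh]; exists r => // t tr.
have [->|t0] := eqVneq t 0; first by rewrite add0r subrr mulr0 subrr normr0 mulr0.
have := rh t; rewrite /= sub0r normrN => /(_ tr t0).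
rewrite -[_ *: 1]/(t * 1) mulr1 -[_ *: _]/(t^-1 * (f (t + x) - f x)) ld => h1.
have -> : f (t + x) - f x - d * t = - (d - t^-1 * (f (t + x) - f x)) * t by field.
by rewrite normrM normrN ler_wpM2r.
Qed.

Lemma cexpD z w : cexp (z + w) = cexp z * cexp w.
Proof.
case: z w => a b [c d]; rewrite /cexp /= expRD cosD sinD.
by apply: complex_eq => /=; ring.
Qed.

Lemma cexp0 : cexp (0 : C) = 1.
Proof. by rewrite /cexp /= expR0 cos0 sin0; apply: complex_eq => /=; ring. Qed.

Lemma cmod_cexp z : cmod (cexp z) = expR (complex.Re z).
Proof.
rewrite /cexp cmodM cmod_real ger0_norm ?expR_ge0//.
by rewrite /cmod /= cos2Dsin2 sqrtr1 mulr1.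
Qed.

Lemma cexp_neq0 z : cexp z != 0.
Proof.
apply/eqP => /(congr1 cmod); rewrite cmod_cexp cmod0 => /eqP.
by rewrite expR_eq0.
Qed.

(** An expansion at the origin suffices: the functional equation [cexpD] carries it
    to every point. *)
Lemma cexp_expansion (e : R) : 0 < e -> exists2 r : R, 0 < r &
  forall h : C, cmod h < r -> cmod (cexp h - 1 - h) <= e * cmod h.
Proof.
move=> e0; have e8 : 0 < e / 8 by rewrite divr_gt0.
have [r1 r10 h1] := real_derivative_bound (is_derive_expR (0 : R)) e8.
have [r2 r20 h2] := real_derivative_bound (is_derive_cos (0 : R)) e8.
have [r3 r30 h3] := real_derivative_bound (is_derive_sin (0 : R)) e8.
exists (Num.min (Num.min r1 r2) (Num.min (Num.min r3 1) (Num.min 1 (e / 8)))).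
  by rewrite !lt_min r10 r20 r30 ltr01 e8.
move=> [a b] hr; set h := a +i* b.
have aC : `|a| <= cmod h by exact: (Re_le_cmod h).
have bC : `|b| <= cmod h by exact: (Im_le_cmod h).
move: hr; rewrite !lt_min => /andP[/andP[c1 c2] /andP[/andP[c3 c4] /andP[_ c5]]].
have := h1 _ (le_lt_trans aC c1); rewrite addr0 expR0 mul1r => k1.
have := h2 _ (le_lt_trans bC c2); rewrite addr0 cos0 sin0 oppr0 mul0r subr0 => k2.
have := h3 _ (le_lt_trans bC c3); rewrite addr0 sin0 cos0 mul1r subr0 => k3.
apply: (le_trans (cmod_le_ReIm _)); rewrite !ReImE /cexp /= !mul0r !subr0 !addr0.
have -> : expR a * cos b - 1 - a =
   (expR a - 1 - a) * cos b + (1 + a) * (cos b - 1) by ring.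
have -> : expR a * sin b - b =
   (expR a - 1 - a) * sin b + a * sin b + (sin b - b) by ring.
have cm := cos_max b; have sm := sin_max b; have sb := norm_sin_le b.
set m := cmod h in aC bC c4 c5 *.
have m0 : 0 <= m by exact: cmod_ge0.
have a1 : `|1 + a| <= 2.
  by apply: (le_trans (ler_normD _ _)); rewrite normr1; move: aC c4; clear; lra.
have em : forall t, `|t| <= m -> e / 8 * `|t| <= e / 8 * m by move=> t tm; rewrite ler_pM2l.
have t1 : `|(expR a - 1 - a) * cos b| <= e / 8 * m.
  rewrite normrM; apply: le_trans (_ : e / 8 * m * 1 <= _); last by rewrite mulr1.
  by apply: ler_pM => //; apply: le_trans k1 _; exact: em.
have t2 : `|(1 + a) * (cos b - 1)| <= 2 * (e / 8 * m).
  by rewrite normrM; apply: ler_pM => //; apply: le_trans k2 _; exact: em.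
have t3 : `|(expR a - 1 - a) * sin b| <= e / 8 * m.
  rewrite normrM; apply: le_trans (_ : e / 8 * m * 1 <= _); last by rewrite mulr1.
  by apply: ler_pM => //; apply: le_trans k1 _; exact: em.
have t4 : `|a * sin b| <= e / 8 * m.
  rewrite normrM; apply: ler_pM => //; last exact: le_trans bC.
  by apply: le_trans aC _; exact: ltW.
have t5 : `|sin b - b| <= e / 8 * m by apply: le_trans k3 _; exact: em.
have em0 : 0 <= e * m by rewrite mulr_ge0// ltW.
apply: (@le_trans _ _ ((e / 8 * m + 2 * (e / 8 * m)) + (e / 8 * m + e / 8 * m + e / 8 * m))).
  apply: lerD; first by apply: (le_trans (ler_normD _ _)); exact: lerD.
  apply: (le_trans (ler_normD _ _)); apply: lerD => //.
  by apply: (le_trans (ler_normD _ _)); exact: lerD.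
by move: em0; clear; lra.
Qed.

Lemma cdiff_cexp z : cdiff cexp z (cexp z).
Proof.
move=> e e0; have c0 := cmod_gt0 (cexp_neq0 z).
have [r r0 hr] := cexp_expansion (divr_gt0 e0 c0).
exists r => // w wr; have -> : w = z + (w - z) by ring.
rewrite cexpD [z + (w - z) - z]addrC addKr.
have -> : cexp z * cexp (w - z) - cexp z - cexp z * (w - z) =
  cexp z * (cexp (w - z) - 1 - (w - z)) by ring.
rewrite cmodM mulrC -ler_pdivlMr//; apply: le_trans (hr _ wr) _.
by rewrite le_eqVlt; apply/orP; left; apply/eqP; field; rewrite gt_eqF.
Qed.

Lemma cdiff_affine (k c z : C) : cdiff (fun w => k * w + c) z k.
Proof.
have := cdiffD (cdiffM (cdiff_cst k z) (cdiff_id z)) (cdiff_cst c z).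
by rewrite mul0r mulr1 add0r addr0.
Qed.

Lemma cdiff_csinh z : cdiff csinh z ((cexp z + cexp (- z)) / 2).
Proof.
have h1 := cdiff_comp (cdiff_affine (-1) 0 z) (@cdiff_cexp (-1 * z + 0)).
have h2 := cdiffM (cdiff_cst (2^-1) z) (cdiffD (cdiff_cexp z) (cdiffM (cdiff_cst (-1) z) h1)).
move: h2; rewrite addr0 (mulN1r z) (_ : _ + 2^-1 * _ = (cexp z + cexp (- z)) / 2); last first.
  by move: (cexp z) (cexp (- z)) => u v; ring.
by congr cdiff; apply/funext => w; rewrite /csinh mulN1r mulN1r addr0; ring.
Qed.

Lemma csinh0 : csinh (0 : C) = 0.
Proof. by rewrite /csinh oppr0 subrr mul0r. Qed.

Definition kerz (z0 w : C) : C :=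
  ker (complex.Re w - complex.Re z0) (complex.Im w - complex.Im z0).

Lemma kerzE z0 w : kerz z0 w = (csinh ((w - z0) / 2))^-1.
Proof.
case: z0 w => x0 y0 [x y]; rewrite /kerz /ker -half_complex /=.
by congr (csinh (_ / _))^-1; apply: complex_eq.
Qed.

Lemma cdiff_kerz z0 w : csinh ((w - z0) / 2) != 0 -> exists d, cdiff (kerz z0) w d.
Proof.
move=> n0; rewrite (_ : kerz z0 = (fun w => (csinh (2^-1 * w + (- z0 / 2)))^-1)); last first.
  by apply/funext => v; rewrite kerzE mulrBl mulNr [v / 2]mulrC.
eexists; apply: cdiffV.
  by move: n0; rewrite mulrBl mulNr [w / 2]mulrC.
apply: (cdiff_comp (cdiff_affine _ _ _)); exact: cdiff_csinh.
Qed.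

(** The quotient [w / sinh (w / 2)] extends continuously by [2] at the origin. *)
Lemma kerz_pole z0 : exists2 q : C -> C, ccont q z0 &
  q z0 = 2 /\ forall w, w != z0 -> kerz z0 w = q w / (w - z0).
Proof.
have h := cdiff_comp (cdiff_affine (2^-1) (- z0 / 2) z0) (@cdiff_csinh (2^-1 * z0 + (- z0 / 2))).
have z00 : 2^-1 * z0 + - z0 / 2 = 0 by ring.
move: h => /cdiff_quotient [p [pE pz cp]].
have {}pE w : csinh ((w - z0) / 2) = p w * (w - z0).
  by have := pE w; rewrite z00 csinh0 add0r => <-; congr csinh; ring.
have {}pz : p z0 = 2^-1.
  by rewrite pz z00 oppr0 cexp0; field.
exists (fun w => (p w)^-1).
  by apply: ccontV cp; rewrite pz invr_eq0.
split; first by rewrite pz invrK.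
by move=> w wz; rewrite kerzE pE invfM.
Qed.

End holomorphy.

(** * Hardy functions on horizontal and vertical lines *)

Section hardy_space.
Context {R : realType}.
Local Notation C := R[i].
Local Notation mu := (@lebesgue_measure R).
Implicit Types (F : C -> C) (x y l : R).

Lemma hardy_ccont F x y : hardy_strip F -> 0 < y < pi -> ccont F (x +i* y).
Proof. by move=> [hF _] ypi; apply: derivable_ccont; exact: hF. Qed.

Lemma hardy_line_measurable F l : hardy_strip F -> 0 < l < pi ->
  cmeasurable setT (horizontal_line F l).
Proof.
by move=> hF lpi; apply: rcont_cmeasurable => x; apply: ccont_hor; exact: hardy_ccont.
Qed.

Lemma hardy_line_bound F : hardy_strip F -> exists2 M : R, 0 <= M &
  forall l, 0 < l < pi -> (\int[mu]_t (cmod (horizontal_line F l t) ^+ 2)%:E <= M%:E)%E.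
Proof.
move=> [_]; set S := [set _ | _ in _] => Soo.
have lS l : 0 < l < pi ->
    (\int[mu]_t (cmod (horizontal_line F l t) ^+ 2)%:E <= ereal_sup S)%E.
  by move=> lpi; apply: ereal_sup_ubound; exists l.
have p0 := pi_gt0 R.
have S0 : (0 <= ereal_sup S)%E.
  have p2 : 0 < @pi R / 2 < pi by apply/andP; split; move: p0; clear; lra.
  apply: le_trans (lS _ p2); apply: integral_ge0 => t _.
  by rewrite lee_fin exprn_ge0// cmod_ge0.
have Sfin : ereal_sup S \is a fin_num by rewrite ge0_fin_numE.
exists (fine (ereal_sup S)); first exact: fine_ge0.
by move=> l /lS; rewrite fineK.
Qed.

Lemma hardy_line_L2 F l : hardy_strip F -> 0 < l < pi -> L2 (horizontal_line F l).
Proof.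
move=> hF lpi; have mF := hardy_line_measurable hF lpi; apply/L2P; split => //.
have [M _ hM] := hardy_line_bound hF.
apply: rintegrable_ge0 => //.
- exact: cmeasurable_sqr_cmod.
- by move=> t _; rewrite exprn_ge0// cmod_ge0.
- exact: le_lt_trans (hM _ lpi) (ltry _).
Qed.

Lemma hardy_strip_intro F (M : R) : holomorphic_on strip F ->
  (forall l, 0 < l < pi -> L2 (horizontal_line F l) /\ sqint (horizontal_line F l) <= M) ->
  hardy_strip F.
Proof.
move=> hF hM; split => //; apply: le_lt_trans (ltry M).
apply: ge_ereal_sup => _ [l /= lpi <-]; have [/L2P[_ i2] h] := hM _ lpi.
by rewrite RintegralE// lee_fin.
Qed.

(** Truncating the second variable to [[a, b]] extends a function that is
    continuous on the open strip to one that is continuous in every real [y]. *)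
Definition clamp (a b y : R) := Num.max a (Num.min y b).

Lemma clamp_lip a b y y' : `|clamp a b y - clamp a b y'| <= `|y - y'|.
Proof.
wlog yy : y y' / y <= y'.
  move=> h; have [yy|yy] := leP y y'; first exact: h.
  by rewrite distrC (distrC y); apply: h; exact: ltW.
rewrite distrC (distrC y) (ger0_norm (_ : 0 <= y' - y)) ?subr_ge0//.
have mono : clamp a b y <= clamp a b y'.
  rewrite /clamp ge_max !le_max lexx /= orbC le_min !ge_min yy /= lexx.
  by rewrite orbT.
rewrite ger0_norm ?subr_ge0// lerBlDr /clamp ge_max; apply/andP; split.
  by rewrite -[X in X <= _]add0r lerD ?subr_ge0// le_max lexx.
rewrite ge_min; have [by_|by_] := leP b y.
  apply/orP; right; rewrite -[X in X <= _]add0r lerD ?subr_ge0//.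
  by rewrite le_max lexx orbT.
apply/orP; left; rewrite -[X in X <= _](subrK y) lerD// le_max; apply/orP; right.
by rewrite lexx.
Qed.

Lemma clampE a b y : a <= y <= b -> clamp a b y = y.
Proof. by move=> /andP[ay yb]; rewrite /clamp (min_idPl yb) (max_idPr ay). Qed.

Lemma clamp_itv a b y : a <= b -> a <= clamp a b y <= b.
Proof. by move=> ab; rewrite /clamp le_max lexx /= ge_max ab ge_min lexx orbT. Qed.

Lemma le_integral_ge0 (f g : R -> \bar R) : (forall x, (0 <= f x)%E) ->
  measurable_fun setT f -> measurable_fun setT g -> (forall x, (f x <= g x)%E) ->
  (\int[mu]_x f x <= \int[mu]_x g x)%E.
Proof.
move=> f0 mf mg fg.
exact: (@ge0_le_integral _ _ R mu setT measurableT f g (fun x _ => f0 x) mf mg (fun x _ => fg x)).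
Qed.

(** An iterated integral is bounded, in the other order, by any integrable majorant
    of its inner integrals. *)
Lemma tonelli_le (f : R -> R -> R) (g : R -> R) :
  measurable_fun setT (fun p : R * R => f p.1 p.2) -> (forall x y, 0 <= f x y) ->
  rintegrable setT g -> (forall y, (\int[mu]_x (f x y)%:E <= (g y)%:E)%E) ->
  (\int[mu]_x \int[mu]_y (f x y)%:E <= (\int[mu]_y g y)%:E)%E /\
  measurable_fun setT (fun x => \int[mu]_y (f x y)%:E)%E.
Proof.
move=> mf f0 ig fg.
have f0' p : (0 <= (EFin \o (fun p : R * R => f p.1 p.2)) p)%E by rewrite lee_fin.
have mf' := (@measurable_EFinP _ _ _ _ _).2 mf.
have E := @fubini_tonelli _ _ _ _ R mu mu _ mf' f0'.
have mF := @measurable_fun_fubini_tonelli_F _ _ _ _ R mu _ mf' f0'.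
have mG := @measurable_fun_fubini_tonelli_G _ _ _ _ R mu _ mf' f0'.
split; last exact: mF.
rewrite -RintegralE// [leLHS]E.
have mg := (@measurable_EFinP _ _ _ _ _).2 (rintegrable_measurable ig).
have G0 y : (0 <= \int[mu]_x (f x y)%:E)%E.
  by apply: integral_ge0 => x _; rewrite lee_fin.
exact: le_integral_ge0.
Qed.

(** Since [F] is square integrable over a horizontal strip, it cannot stay large
    on all vertical segments in a set of infinite measure: this lets the
    vertical sides of contours disappear at infinity. *)
Lemma hardy_vertical F (l1 l2 : R) (P : set R) : hardy_strip F ->
  0 < l1 -> l1 < l2 -> l2 < pi -> measurable P -> mu P = +oo%E ->
  exists2 x, P x & \int[mu]_(y in `[l1, l2]) (cmod (F (x +i* y)) ^+ 2) <= 1.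
Proof.
move=> hF l10 l12 l2pi mP Poo; apply: contrapT => nh.
have big x : P x -> 1 < \int[mu]_(y in `[l1, l2]) (cmod (F (x +i* y)) ^+ 2).
  by move=> Px; rewrite ltNge; apply/negP => h; apply: nh; exists x.
have [M M0 hM] := hardy_line_bound hF.
pose c := clamp l1 l2.
have c_in y : 0 < c y < pi.
  have /andP[h1 h2] := clamp_itv y (ltW l12).
  by rewrite (lt_le_trans l10 h1) (le_lt_trans h2 l2pi).
pose H (x y : R) : C := F (x +i* c y).
have Hx y : cmeasurable setT (H ^~ y) by exact: hardy_line_measurable.
have Hy x y : rcont (H x) y.
  move=> e e0; have [r r0 hr] := hardy_ccont x hF (c_in y) e0.
  exists r => // t tr; apply: hr; rewrite cmod_ver.
  exact: le_lt_trans (clamp_lip _ _ _ _) tr.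
have mRe : measurable_fun setT (fun p : R * R => complex.Re (H p.1 p.2)).
  apply: (@measurable_caratheodory _ (fun x y => complex.Re (H x y))).
    by move=> y; case: (Hx y).
  by move=> x y; exact: rcont_Re.
have mIm : measurable_fun setT (fun p : R * R => complex.Im (H p.1 p.2)).
  apply: (@measurable_caratheodory _ (fun x y => complex.Im (H x y))).
    by move=> y; case: (Hx y).
  by move=> x y; exact: rcont_Im.
pose f x y : R := \1_`[l1, l2] y * cmod (H x y) ^+ 2.
have f0 x y : 0 <= f x y by rewrite /f mulr_ge0// ?indicE// exprn_ge0// cmod_ge0.
have mI : measurable_fun setT (\1_`[l1, l2] : R -> R) by exact: measurable_indic.
have mf : measurable_fun setT (fun p : R * R => f p.1 p.2).
  apply: measurable_funM; first exact: (measurableT_comp mI).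
  rewrite (_ : (fun p : R * R => _) = (fun p => complex.Re (H p.1 p.2) ^+ 2 + complex.Im (H p.1 p.2) ^+ 2)).
    by apply: measurable_funD; exact: measurable_funX.
  by apply/funext => p; rewrite sqr_cmod.
have ig : rintegrable setT (fun y => M * \1_`[l1, l2] y).
  by apply: rintegrableZ => //; exact: integrable_indic_itv.
have fg y : (\int[mu]_x (f x y)%:E <= (M * \1_`[l1, l2] y)%:E)%E.
  rewrite /f /= indicE; case: (_ \in _).
    rewrite mulr1; under eq_integral do rewrite mul1r.
    exact: hM.
  by rewrite mulr0; under eq_integral do rewrite mul0r; rewrite integral0.
have [E mF] := tonelli_le mf f0 ig fg.
have : (\int[mu]_x (\1_P x)%:E <= \int[mu]_x \int[mu]_y (f x y)%:E)%E.
  have mP' := (@measurable_EFinP _ _ _ _ _).2 (@measurable_indic _ _ R setT P mP).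
  have P0 x : (0 <= (\1_P x : R)%:E)%E by rewrite lee_fin indicE.
  apply: (le_integral_ge0 P0 mP' mF) => x; rewrite /= indicE.
  case: (boolP (x \in P)) => [/set_mem Px|_]; last first.
    by apply: integral_ge0 => y _; rewrite lee_fin.
  have i1 : rintegrable `[l1, l2] (fun y => cmod (F (x +i* y)) ^+ 2).
    have h : rintegrable `[l1, l2] (fun y => complex.Re (H x y) ^+ 2 + complex.Im (H x y) ^+ 2).
      apply: continuous_compact_integrable; first exact: segment_compact.
      apply: continuous_subspaceT => y.
      by apply: cvgD; apply: cvgM; first [exact: (rcont_Re (Hy x y))|exact: (rcont_Im (Hy x y))].
    apply: eq_rintegrable h => // y; rewrite /= in_itv /= => /clampE yE.
    by rewrite sqr_cmod /H /c yE.
  have := big _ Px; rewrite -lte_fin -RintegralE// => /ltW h; apply: (le_trans h).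
  rewrite le_eqVlt; apply/orP; left; apply/eqP.
  rewrite integral_mkcond; apply: eq_integral => y _.
  rewrite patchE /f /= indicE; case: ifPn => [/set_mem|_]; last by rewrite mul0r.
  by rewrite /= in_itv /= => /clampE yE; rewrite mul1r /H /c yE.
have -> : (\int[mu]_x (\1_P x)%:E = +oo)%E by rewrite integral_indic// setIT; exact: Poo.
move=> h.
by have := le_trans h E; rewrite leNgt ltry.
Qed.

End hardy_space.

(** * Cauchy's formula on horizontal lines *)

Section kernel_L2.
Context {R : realType}.
Local Notation C := R[i].
Local Notation mu := (@lebesgue_measure R).
Implicit Types (x y : R).

Lemma cmeasurable_comp (f : R -> C) (u : R -> R) : cmeasurable setT f ->
  measurable_fun setT u -> cmeasurable setT (fun x => f (u x)).
Proof.
by move=> [f1 f2] mu_; split; [exact: (measurableT_comp f1)|exact: (measurableT_comp f2)].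
Qed.

Lemma measurable_shift x0 : measurable_fun setT (fun x : R => x - x0).
Proof. by apply: measurable_funB. Qed.

Lemma ker_shift_L2 x0 y : sin (y / 2) != 0 -> L2 (fun x => ker (x - x0) y) /\
  sqint (fun x => ker (x - x0) y) <= 2 * pi / sin (y / 2) ^+ 2.
Proof.
move=> s0; have s2 : 0 < sin (y / 2) ^+ 2 by rewrite lt_neqAle sqr_ge0 eq_sym sqrf_eq0 s0.
have b x : cmod (ker (x - x0) y) ^+ 2 <= (sin (y / 2) ^+ 2)^-1 * rho (x - x0).
  apply: (@le_trans _ _ ((rho (x - x0) / `|sin (y / 2)|) ^+ 2)).
    by rewrite ler_sqr ?nnegrE ?cmod_ge0 ?divr_ge0 ?rho_ge0// ker_le.
  by rewrite expr_div_n real_normK ?num_real// mulrC ler_pM2l ?invr_gt0// sqr_rho_le.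
have ir := rintegrableZ (sin (y / 2) ^+ 2)^-1 measurableT (rintegrable_rho x0).
have LK : L2 (fun x => ker (x - x0) y).
  apply: (L2_le _ ir b).
  by apply: (cmeasurable_comp (measurable_ker s0)); exact: measurable_shift.
split => //; apply: (le_trans (sqint_le LK ir b)).
by rewrite (RintegralZr' _ measurableT (rintegrable_rho x0)) Rintegral_rho mulrC.
Qed.

Lemma ker_shift_lip x0 y y' : sin (y / 2) != 0 -> sin (y' / 2) != 0 ->
  sqint (fun x => ker (x - x0) y - ker (x - x0) y') <=
  2 * pi * (`|y - y'| / (`|sin (y / 2)| * `|sin (y' / 2)|)) ^+ 2.
Proof.
move=> s0 s0'; set k := `|y - y'| / _.
have k0 : 0 <= k by rewrite /k divr_ge0// mulr_ge0.
have b x : cmod (ker (x - x0) y - ker (x - x0) y') ^+ 2 <= k ^+ 2 * rho (x - x0).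
  apply: (@le_trans _ _ ((rho (x - x0) * k) ^+ 2)).
    by rewrite ler_sqr ?nnegrE ?cmod_ge0 ?mulr_ge0 ?rho_ge0// ker_lip.
  by rewrite exprMn mulrC ler_wpM2l ?sqr_ge0// sqr_rho_le.
have ir := rintegrableZ (k ^+ 2) measurableT (rintegrable_rho x0).
have L := L2B (ker_shift_L2 x0 s0).1 (ker_shift_L2 x0 s0').1.
apply: (le_trans (sqint_le L ir b)).
by rewrite (RintegralZr' _ measurableT (rintegrable_rho x0)) Rintegral_rho mulrC.
Qed.

End kernel_L2.

Section strip_cauchy.
Context {R : realType}.
Local Notation C := R[i].
Local Notation mu := (@lebesgue_measure R).
Implicit Types (F : C -> C) (x y l a b : R).

Lemma sin_half_neq0 y : 0 < `|y| < 2 * pi -> sin (y / 2) != 0.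
Proof.
move=> /andP[y0 y2].
have h : 0 < sin (`|y| / 2).
  by apply: sin_gt0_pi; rewrite divr_gt0// ltr_pdivrMr// mulrC.
have [yp|yn] := leP 0 y; first by move: h; rewrite ger0_norm// => /gt_eqF ->.
by move: h; rewrite ltr0_norm// mulNr sinN oppr_gt0 => /lt_eqF ->.
Qed.

Lemma derivable_hardy_kernel F (x0 y0 x y : R) : hardy_strip F -> 0 < y < pi ->
  `|y - y0| < 2 * pi -> (x != x0) || (y != y0) ->
  derivable ((fun w => F w * kerz (x0 +i* y0) w) : C^o -> C^o) (x +i* y) 1.
Proof.
move=> [hF _] ypi yy ne; apply/derivableP.
have /derivableP [d hd] := hF (x +i* y) ypi.
have [|d' hd'] := @cdiff_kerz R (x0 +i* y0) (x +i* y).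
  have -> : ((x +i* y) - (x0 +i* y0)) / 2 = ((x - x0) / 2) +i* ((y - y0) / 2) :> C.
    by rewrite -half_complex; congr (_ / 2); apply: complex_eq.
  have [yE|yne] := eqVneq y y0; last first.
    by apply: csinh_neq0; apply: sin_half_neq0; rewrite normr_gt0 subr_eq0 yne.
  move: ne; rewrite yE eqxx orbF => xne.
  apply/eqP => h; have := cmod_csinh_ge_rsinh ((x - x0) / 2) ((y0 - y0) / 2).
  rewrite h cmod0 => /(le_trans (le_norm_rsinh _)); rewrite normr_le0.
  by rewrite mulf_eq0 invr_eq0 subr_eq0 (negbTE xne) pnatr_eq0.
by exists (d * kerz (x0 +i* y0) (x +i* y) + F (x +i* y) * d'); exact: cdiffM.
Qed.

Lemma rect_kernel_outside F x0 y0 a b l1 l2 : hardy_strip F ->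
  0 < l1 -> l1 <= l2 -> l2 < pi -> y0 < l1 -> l2 - y0 < 2 * pi -> a <= b ->
  rect (fun w => F w * kerz (x0 +i* y0) w) a b l1 l2 = 0.
Proof.
move=> hF l10 l12 l2pi yl yl2 ab; apply: goursat => // x y _ /andP[h1 h2].
have yy : y0 < y := lt_le_trans yl h1.
apply: derivable_hardy_kernel => //.
- by rewrite (lt_le_trans l10 h1) (le_lt_trans h2 l2pi).
- by rewrite ger0_norm ?subr_ge0 ?(ltW yy)// (le_lt_trans _ yl2)// lerD2r.
- by rewrite (gt_eqF yy) orbT.
Qed.

Lemma rect_kernel_inside F x0 y0 a b l1 l2 : hardy_strip F ->
  0 < l1 -> l1 < y0 -> y0 < l2 -> l2 < pi -> a < x0 -> x0 < b ->
  rect (fun w => F w * kerz (x0 +i* y0) w) a b l1 l2 = (4 * pi)%:C * 'i%C * F (x0 +i* y0).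
Proof.
move=> hF l10 ly yl l2pi ax xb; have [q cq [qz qE]] := kerz_pole (x0 +i* y0).
rewrite (@rect_simple_pole _ _ (fun w => F w * q w) _ _ _ _ x0 y0) ?ax ?ly//.
- by rewrite qz; apply: complex_eq; rewrite !ReImE /=; ring.
- move=> x y _ /andP[h1 h2] ne.
  have /andP[y0p yp] : 0 < y < pi by rewrite (lt_le_trans l10 h1) (le_lt_trans h2 l2pi).
  apply: derivable_hardy_kernel => //; first by rewrite y0p.
  rewrite ltr_norml; move: (pi_gt0 R) y0p yp l10 ly yl l2pi.
  by clear => *; apply/andP; split; lra.
- by move=> w wz; rewrite qE// mulrA.
- apply: ccontM => //; apply: hardy_ccont => //.
  by rewrite (lt_trans l10 ly) (lt_trans yl l2pi).
Qed.

(** The contour integral over longer and longer rectangles: the vertical sides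
    vanish along a suitable sequence and the horizontal ones become full lines. *)
Lemma strip_lines F x0 y0 l1 l2 (k : C) : hardy_strip F ->
  0 < l1 -> l1 < l2 -> l2 < pi -> `|y0| < pi ->
  sin ((l1 - y0) / 2) != 0 -> sin ((l2 - y0) / 2) != 0 ->
  (forall a b, a < x0 -> x0 < b -> rect (fun w => F w * kerz (x0 +i* y0) w) a b l1 l2 = k) ->
  cint setT (fun x => F (x +i* l1) * ker (x - x0) (l1 - y0)) -
  cint setT (fun x => F (x +i* l2) * ker (x - x0) (l2 - y0)) = k.
Proof.
move=> hF l10 l12 l2pi y0pi s1 s2 hk.
have l20 := lt_trans l10 l12; have l1pi := lt_trans l12 l2pi.
pose g (w : C) := F w * kerz (x0 +i* y0) w.
have i1 : cintegrable setT (fun x => g (x +i* l1)).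
  apply: L2_mul; last exact: (ker_shift_L2 x0 s1).1.
  by apply: hardy_line_L2 => //; rewrite l10.
have i2 : cintegrable setT (fun x => g (x +i* l2)).
  apply: L2_mul; last exact: (ker_shift_L2 x0 s2).1.
  by apply: hardy_line_L2 => //; rewrite l20.
rewrite -(cintB measurableT i1 i2).
apply/eqP; rewrite -subr_eq0; apply/eqP/cmod_eq0/eqP.
rewrite eq_le cmod_ge0 andbT; apply/ler_addgt0Pr => e e0; rewrite add0r.
have e2 : 0 < e / 2 by rewrite divr_gt0.
have [N hN] := cint_tail_small (cintegrableB measurableT i1 i2) e2.
(* beyond distance [40 / e] the kernel is at most [e / 20], and the integral of [1 + |F| ^ 2] is at most [5] *)
pose T := `|N| + `|x0| + 40 / e + 1.
have e40 : 0 < 40 / e by rewrite divr_gt0.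
have NT : N <= T.
  rewrite /T; have := ler_norm N; have := normr_ge0 x0; move: e40; clear; lra.
have x0T : `|x0| + 40 / e < T.
  rewrite /T; have := normr_ge0 N; move: e40; clear; lra.
have xT : `|x0| < T by move: x0T e40; clear; lra.
have vert X : T <= `|X| -> \int[mu]_(y in `[l1, l2]) (cmod (F (X +i* y)) ^+ 2) <= 1 ->
    cintegrable `[l1, l2] (fun y => g (X +i* y)) /\
    cmod (cint `[l1, l2] (fun y => g (X +i* y))) <= e / 4.
  move=> TX mX.
  have d0 : 40 / e < `|X - x0|.
    have : `|X| <= `|X - x0| + `|x0| by rewrite (le_trans _ (ler_normD _ _))// subrK.
    by move: TX x0T; clear; lra.
  have Xx0 : X - x0 != 0 by rewrite -normr_gt0 (lt_trans e40).
  have iv : cintegrable `[l1, l2] (fun y => g (X +i* y)).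
    apply: rcont_cintegrable => y /andP[h1 h2]; apply/ccont_ver/derivable_ccont.
    apply: derivable_hardy_kernel => //.
    - by rewrite (lt_le_trans l10 h1) (le_lt_trans h2 l2pi).
    - move: y0pi; rewrite !ltr_norml => /andP[h3 h4].
      by move: (lt_le_trans l10 h1) (le_lt_trans h2 l2pi) h3 h4; clear => *; apply/andP; split; lra.
    - by rewrite -subr_eq0 Xx0.
  split => //.
  have iF : rintegrable `[l1, l2] (fun y => cmod (F (X +i* y)) ^+ 2).
    have cF y : l1 <= y <= l2 -> rcont (fun y => F (X +i* y)) y.
      move=> /andP[h1 h2]; apply: ccont_ver; apply: hardy_ccont => //.
      by rewrite (lt_le_trans l10 h1) (le_lt_trans h2 l2pi).
    have h : rintegrable `[l1, l2] (fun y => complex.Re (F (X +i* y)) ^+ 2 + complex.Im (F (X +i* y)) ^+ 2).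
      apply: continuous_compact_integrable; first exact: segment_compact.
      apply: continuous_in_subspaceT => y /set_mem; rewrite /= in_itv /= => /cF cFy.
      by apply: cvgD; apply: cvgM; first [exact: (rcont_Re cFy)|exact: (rcont_Im cFy)].
    by apply: eq_rintegrable h => // y _; rewrite sqr_cmod.
  apply: (le_trans (cmod_cint_le _ iv)) => //.
  have ib : rintegrable `[l1, l2] (fun y => e / 20 * (1 + cmod (F (X +i* y)) ^+ 2)).
    by apply: rintegrableZ => //; apply: rintegrableD => //; exact: rintegrable_segment_cst.
  apply: (@le_trans _ _ (\int[mu]_(y in `[l1, l2]) (e / 20 * (1 + cmod (F (X +i* y)) ^+ 2)))).
    apply: Rintegral_le => //; first exact: cintegrable_cmod.
    move=> y _; rewrite /g cmodM mulrC; apply: ler_pM; rewrite ?cmod_ge0//.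
      apply: (le_trans (ker_le_far _ Xx0)) => /=.
      rewrite invf_ple ?posrE//; last 2 first.
      - by rewrite (lt_le_trans _ (le_norm_rsinh _))// normr_gt0 mulf_neq0// invr_neq0.
      - by rewrite divr_gt0.
      apply: le_trans (le_norm_rsinh _); rewrite normrM [`|2^-1|]ger0_norm// invf_div.
      by move: d0; rewrite (_ : 40 / e = 2 * (20 / e)); [clear; lra|ring].
    move: (cmod _) (cmod_ge0 (F (X +i* y))) => u u0.
    have : 0 <= (u - 1) ^+ 2 by exact: sqr_ge0.
    by rewrite sqrrB; move: u0; clear; lra.
  rewrite RintegralZr'//; last by apply: rintegrableD => //; exact: rintegrable_segment_cst.
  rewrite RintegralDr//; last exact: rintegrable_segment_cst.
  rewrite Rintegral_segment_cst ?(ltW l12)// mul1r.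
  have pi4 : pi < 4 :> R by have := pihalf_lt2 R; clear; lra.
  apply: (@le_trans _ _ (e / 20 * 5)).
    by rewrite ler_pM2l ?divr_gt0//; move: mX pi4 l10 l2pi; clear; lra.
  by move: e0; clear; lra.
have T0 : 0 < T by rewrite (le_lt_trans _ xT).
have [b /= bT mb] : exists2 x, `[T, +oo[%classic x &
    \int[mu]_(y in `[l1, l2]) (cmod (F (x +i* y)) ^+ 2) <= 1.
  by apply: hardy_vertical => //; rewrite lebesgue_measure_itv/= ltry.
have [a /= aT ma] : exists2 x, `]-oo, - T]%classic x &
    \int[mu]_(y in `[l1, l2]) (cmod (F (x +i* y)) ^+ 2) <= 1.
  by apply: hardy_vertical => //; rewrite lebesgue_measure_itv/= ltNyr.
move: aT bT; rewrite !in_itv /= andbT => aT bT.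
have b0 : 0 < b := lt_le_trans T0 bT.
have a0 : a < 0 by rewrite (le_lt_trans aT)// oppr_lt0.
have [ib vb] := vert b (le_trans bT (ler_norm b)) mb.
have [ia va] : cintegrable `[l1, l2] (fun y => g (a +i* y)) /\
    cmod (cint `[l1, l2] (fun y => g (a +i* y))) <= e / 4.
  by apply: vert => //; rewrite ltr0_norm// lerNr.
have ax0 : a < x0 by move: xT; rewrite ltr_norml => /andP[h _]; exact: le_lt_trans h.
have x0b : x0 < b by apply: lt_le_trans bT; exact: le_lt_trans (ler_norm _) xT.
rewrite -(hk a b ax0 x0b) /rect -/g.
rewrite (cintB (measurable_itv _) ib ia) opprD addrA.
apply: (le_trans (cmodB _ _)); rewrite cmodM cmodi mul1r.
have := hN a b (le_trans aT _) (le_trans NT bT); rewrite lerN2 => /(_ NT) h.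
apply: (le_trans (lerD h (cmodB _ _))).
apply: (le_trans (lerD (lexx (e / 2)) (lerD vb va))).
by rewrite le_eqVlt; apply/orP; left; apply/eqP; field.
Qed.

End strip_cauchy.

(** * Boundary values and the reproducing formula *)

Section boundary_limits.
Context {R : realType}.
Local Notation C := R[i].
Local Notation mu := (@lebesgue_measure R).
Implicit Types (F : C -> C) (f g : R -> C) (x y l e : R).

Lemma eq_cint_ae f g : cmeasurable setT f -> cmeasurable setT g -> ae_equal f g ->
  cint setT f = cint setT g.
Proof.
move=> [f1 f2] [g1 g2] fg; apply: complex_eq; rewrite /cint /= /Rintegral; congr fine.
- apply: ae_eq_integral => //; [exact/measurable_EFinP|exact/measurable_EFinP|].
  by move: fg; apply: ae_imp => t /= ->.
- apply: ae_eq_integral => //; [exact/measurable_EFinP|exact/measurable_EFinP|].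
  by move: fg; apply: ae_imp => t /= ->.
Qed.

(** The two one-sided boundary conditions in a common quantitative form. *)
Definition line_limit F (l0 : R) f := L2 f /\ forall e, 0 < e ->
  exists2 d : R, 0 < d & forall l, 0 < l < pi -> `|l - l0| < d ->
    sqint (fun t => F (t +i* l) - f t) <= e.

Lemma line_limit_cvg F f (side : set_system R) (l0 : R) : Filter side ->
  (forall l, 0 < l < pi -> L2 (horizontal_line F l)) ->
  (forall P : set R, side P <-> exists2 d : R, 0 < d &
     forall l, 0 < l < pi -> `|l - l0| < d -> P l) ->
  boundary_value F side f <-> line_limit F l0 f.
Proof.
move=> fside LF sideP.
have nE l : L2 f -> 0 < l < pi -> l2norm (fun t => horizontal_line F l t - f t) =
    (Num.sqrt (sqint (fun t => F (t +i* l) - f t)))%:E.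
  by move=> Lf lpi; rewrite l2norm_sqint//; apply: L2B => //; exact: LF.
split=> -[Lf h]; split => //.
- move=> e e0; have se0 : 0 < Num.sqrt e by rewrite sqrtr_gt0.
  move/fine_cvgP : h => [_ /cvgrPdist_le /(_ _ se0)] /sideP [d d0 hd].
  exists d => // l lpi ld; have := hd l lpi ld.
  rewrite /= sub0r normrN nE//= ger0_norm ?sqrtr_ge0// => h.
  by move: h; rewrite ler_sqrt// ltW.
- apply/fine_cvgP; split.
    apply/sideP; exists 1 => // l lpi _.
    by rewrite nE.
  apply/cvgrPdist_le => e e0; have [d d0 hd] := h _ (exprn_gt0 2 e0).
  apply/sideP; exists d => // l lpi ld.
  rewrite /= sub0r normrN nE//= ger0_norm ?sqrtr_ge0//.
  by rewrite -(ger0_norm (ltW e0)) -sqrtr_sqr ler_wsqrtr// hd.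
Qed.

Lemma boundary_value_lower F f : (forall l, 0 < l < pi -> L2 (horizontal_line F l)) ->
  boundary_value F 0^'+ f <-> line_limit F 0 f.
Proof.
move=> LF; apply: line_limit_cvg => // P; split.
  move=> [d /= d0 hd]; exists d => // l /andP[l0 _] ld; apply: hd => //=.
  by rewrite distrC.
move=> [d d0 hd]; exists (Num.min d pi); first by rewrite /= lt_min d0 pi_gt0.
move=> l /=; rewrite lt_min sub0r normrN => /andP[ld lpi] l0; apply: hd.
  by rewrite l0 (le_lt_trans (ler_norm _) lpi).
by rewrite subr0.
Qed.

Lemma boundary_value_upper F f : (forall l, 0 < l < pi -> L2 (horizontal_line F l)) ->
  boundary_value F pi^'- f <-> line_limit F pi f.
Proof.
move=> LF; apply: line_limit_cvg => // P; split.
  move=> [d /= d0 hd]; exists d => // l /andP[_ l0] ld; apply: hd => //=.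
  by rewrite distrC.
move=> [d d0 hd]; exists (Num.min d pi); first by rewrite /= lt_min d0 pi_gt0.
move=> l /=; rewrite lt_min => /andP[ld lpi] l0; apply: hd.
  rewrite l0 andbT; move: lpi; rewrite ger0_norm ?subr_ge0 ?(ltW l0)//.
  by rewrite ltrBlDl ltrDr.
by rewrite distrC.
Qed.

Lemma cmod_pairing_dist f g (h k : R -> C) : L2 f -> L2 g -> L2 h -> L2 k ->
  cmod (cint setT (fun t => f t * h t) - cint setT (fun t => g t * k t)) <=
  Num.sqrt (sqint (fun t => f t - g t) * sqint h) +
  Num.sqrt (sqint g * sqint (fun t => h t - k t)).
Proof.
move=> Lf Lg Lh Lk.
have i1 := L2_mul (L2B Lf Lg) Lh; have i2 := L2_mul Lg (L2B Lh Lk).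
rewrite -(cintB measurableT (L2_mul Lf Lh) (L2_mul Lg Lk)).
rewrite (@eq_cint _ _ _ (fun t => (f t - g t) * h t + g t * (h t - k t))); last first.
  by move=> t _; ring.
rewrite (cintD measurableT i1 i2); apply: (le_trans (cmodD _ _)).
by apply: lerD; apply: cmod_cint_mul_le => //; exact: L2B.
Qed.

Lemma sin_half_ge (l l0 y : R) : `|l - l0| <= `|sin ((l0 - y) / 2)| ->
  `|sin ((l0 - y) / 2)| / 2 <= `|sin ((l - y) / 2)|.
Proof.
move=> h; have h1 := dist_sin_le ((l0 - y) / 2) ((l - y) / 2).
have : `|sin ((l0 - y) / 2)| <= `|sin ((l0 - y) / 2) - sin ((l - y) / 2)| + `|sin ((l - y) / 2)|.
  by rewrite (le_trans _ (ler_normD _ _))// subrK.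
have E : `|(l0 - y) / 2 - (l - y) / 2| = `|l - l0| / 2.
  rewrite (_ : _ - _ = (l0 - l) / 2); last by ring.
  by rewrite normrM distrC [`|2^-1|]ger0_norm.
by move: h1 h; rewrite E; clear; lra.
Qed.

(** Pairing with the kernel is continuous up to the edges: by Cauchy-Schwarz, with
    the convergence of [F] in the mean and the Lipschitz bound of the kernel. *)
Lemma line_pairing_limit F f (l0 x0 y0 e : R) : line_limit F l0 f ->
  (forall l, 0 < l < pi -> L2 (horizontal_line F l)) ->
  sin ((l0 - y0) / 2) != 0 -> 0 < e ->
  exists2 d : R, 0 < d & forall l, 0 < l < pi -> `|l - l0| < d ->
    sin ((l - y0) / 2) != 0 /\
    cmod (cint setT (fun t => F (t +i* l) * ker (t - x0) (l - y0)) -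
          cint setT (fun t => f t * ker (t - x0) (l0 - y0))) <= e.
Proof.
move=> [Lf hF] LF s0 e0; set s := `|sin ((l0 - y0) / 2)|.
have sp : 0 < s by rewrite normr_gt0.
pose B := 2 * pi / (s / 2) ^+ 2.
have B0 : 0 < B by rewrite /B divr_gt0 ?mulr_gt0 ?pi_gt0// exprn_gt0// divr_gt0.
have eB : 0 < (e / 2) ^+ 2 / B by rewrite divr_gt0// exprn_gt0// divr_gt0.
have [d d0 hd] := hF _ eB.
pose A := Num.sqrt (sqint f * (2 * pi)) + 1.
have A0 : 0 < A by rewrite /A ltr_wpDl// sqrtr_ge0.
pose c := s * (s / 2).
have c0 : 0 < c by rewrite /c mulr_gt0// divr_gt0.
exists (Num.min (Num.min d s) (e / 2 / A * c)).
  by rewrite !lt_min d0 sp !mulr_gt0 ?invr_gt0.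
move=> l lpi; rewrite !lt_min => /andP[/andP[ld ls] lA].
have sl := sin_half_ge (ltW ls).
have sl0 : 0 < `|sin ((l - y0) / 2)| by rewrite (lt_le_trans _ sl)// divr_gt0.
have sn0 : sin ((l - y0) / 2) != 0 by rewrite -normr_gt0.
split => //.
have [Lk0 _] := ker_shift_L2 x0 s0; have [Lk hk] := ker_shift_L2 x0 sn0.
apply: (le_trans (cmod_pairing_dist (LF l lpi) Lf Lk Lk0)).
rewrite (_ : e = e / 2 + e / 2); last by field.
apply: lerD.
  rewrite -[leRHS](@ger0_norm _ (e / 2)) ?divr_ge0 ?(ltW e0)// -sqrtr_sqr ler_wsqrtr//.
  apply: (@le_trans _ _ ((e / 2) ^+ 2 / B * B)); last by rewrite divfK// gt_eqF.
  apply: ler_pM; rewrite ?sqint_ge0//; first exact: hd.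
  apply: (le_trans hk); rewrite /B ler_pM2l ?mulr_gt0 ?pi_gt0//.
  rewrite lef_pV2; last 2 first.
  - by rewrite posrE lt_neqAle sqr_ge0 eq_sym sqrf_eq0 sn0.
  - by rewrite posrE exprn_gt0// divr_gt0.
  by rewrite -[X in _ <= X]real_normK ?num_real// ler_sqr ?nnegrE// divr_ge0// ltW.
apply: (@le_trans _ _ (A * (`|l - l0| / c))); last first.
  by rewrite mulrC -ler_pdivlMr// ler_pdivrMr// ltW.
apply: (@le_trans _ _ (Num.sqrt (sqint f * (2 * pi) * (`|l - l0| / c) ^+ 2))).
  rewrite ler_wsqrtr// -mulrA ler_wpM2l ?sqint_ge0//.
  apply: (le_trans (ker_shift_lip x0 sn0 s0)).
  have -> : l - y0 - (l0 - y0) = l - l0 by ring.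
  rewrite ler_pM2l ?mulr_gt0 ?pi_gt0// ler_sqr ?nnegrE ?divr_ge0 ?mulr_ge0 ?(ltW c0) ?(ltW sp)//.
  rewrite ler_wpM2l// lef_pV2 ?posrE// ?mulr_gt0//.
  by rewrite /c mulrC; exact: ler_wpM2r (ltW sp) _ _ sl.
rewrite sqrtrM ?mulr_ge0 ?sqint_ge0 ?pi_ge0// sqrtr_sqr.
rewrite ger0_norm ?divr_ge0 ?(ltW c0)//.
by rewrite ler_wpM2r ?divr_ge0 ?(ltW c0)// /A lerDl.
Qed.

End boundary_limits.

Section reproducing.
Context {R : realType}.
Local Notation C := R[i].
Local Notation mu := (@lebesgue_measure R).
Implicit Types (F : C -> C) (f psi : R -> C) (x y l e : R).

Definition cauchy_int psi x y : C := cint setT (fun s => psi s * ker (x - s) y).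

(** The Cauchy integral of the strip, with the boundary values on the upper edge
    replaced by the conjugates of those on the real line. *)
Definition gint psi x y : C :=
  'i%C / (4 * pi)%:C * (cauchy_int psi x y + cauchy_int (fun s => (psi s)^*) x (y + pi)).

(** Cauchy's formula for the whole strip: the two lines of [strip_lines] are moved
    to the edges. *)
Lemma cauchy_line_identity F f fpi x0 y0 : hardy_strip F ->
  line_limit F 0 f -> line_limit F pi fpi -> 0 < `|y0| < pi ->
  cint setT (fun t => f t * ker (t - x0) (- y0)) -
  cint setT (fun t => fpi t * ker (t - x0) (pi - y0)) =
  if 0 < y0 then (4 * pi)%:C * 'i%C * F (x0 +i* y0) else 0.
Proof.
move=> hF h0 hpi /andP[y00 y0pi]; set k := (if _ then _ else _).
have LF l (lpi : 0 < l < pi) := hardy_line_L2 hF lpi.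
have pi0 := pi_gt0 R.
have s0 : sin ((0 - y0) / 2) != 0.
  apply: sin_half_neq0; rewrite sub0r normrN y00.
  by move: y0pi pi0; clear; lra.
have spi : sin ((pi - y0) / 2) != 0.
  apply: sin_half_neq0; move: y0pi; rewrite ltr_norml => /andP[h1 h2].
  rewrite ger0_norm ?subr_ge0 ?(ltW h2)// subr_gt0 h2.
  by move: h1 h2; clear; lra.
apply/eqP; rewrite -subr_eq0; apply/eqP/cmod_eq0/eqP.
rewrite eq_le cmod_ge0 andbT; apply/ler_addgt0Pr => e e0; rewrite add0r.
have e2 : 0 < e / 2 by rewrite divr_gt0.
have [d1 d10 hd1] := line_pairing_limit x0 h0 LF s0 e2.
have [d2 d20 hd2] := line_pairing_limit x0 hpi LF spi e2.
pose m := Num.min (Num.min d1 d2) `|y0|.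
pose m' := Num.min m (pi - `|y0|).
have m0 : 0 < m' by rewrite !lt_min d10 d20 y00 subr_gt0 y0pi.
pose l1 := m' / 2; pose l2 := pi - m' / 2.
have m2 : m' / 2 < m' by move: m0; clear; lra.
have l10 : 0 < l1 by rewrite divr_gt0.
have [md1 md2 my mpi] : [/\ m' <= d1, m' <= d2, m' <= `|y0| & m' <= pi - `|y0|].
  by rewrite /m' /m !ge_min !lexx ?orbT.
have l12 : l1 < l2 by rewrite /l1 /l2; move: y0pi my mpi m0; clear; lra.
have l2pi : l2 < pi by rewrite /l2 gtrBl.
have l1pi : 0 < l1 < pi by rewrite l10 (lt_trans l12 l2pi).
have l2pi' : 0 < l2 < pi by rewrite l2pi (lt_trans l10 l12).
have a1 : `|l1 - 0| < d1 by rewrite subr0 (gtr0_norm l10) (lt_le_trans m2).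
have a2 : `|l2 - pi| < d2.
  by rewrite /l2 addrC addKr normrN (gtr0_norm (divr_gt0 m0 _))// (lt_le_trans m2).
have [sl1 c1] := hd1 l1 l1pi a1; have [sl2 c2] := hd2 l2 l2pi' a2.
have hk a b : a < x0 -> x0 < b ->
    rect (fun w => F w * kerz (x0 +i* y0) w) a b l1 l2 = k.
  move=> ax xb; rewrite /k; case: ltP => [yp|yn].
    apply: rect_kernel_inside => //.
      by rewrite (lt_le_trans m2)// (le_trans my)// ger0_norm// ltW.
    rewrite /l2; move: mpi m2; rewrite (gtr0_norm yp); clear; lra.
  have yN : y0 < 0 by rewrite lt_neqAle yn andbT -normr_gt0.
  apply: rect_kernel_outside => //.
  - exact: ltW.
  - exact: lt_trans yN l10.
  - rewrite /l2; move: m0 y0pi; rewrite (ltr0_norm yN); clear; lra.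
  - exact: ltW (lt_trans ax xb).
have E := strip_lines hF l10 l12 l2pi y0pi sl1 sl2 hk.
rewrite -E -{1}[- y0]add0r.
set I1 := cint setT _ in c1 *; set J0 := cint setT _ in c1 *.
set I2 := cint setT _ in c2 *; set J1 := cint setT _ in c2 *.
rewrite (_ : _ - _ = (I2 - J1) - (I1 - J0)); last by ring.
apply: (le_trans (cmodB _ _)); rewrite (_ : e = e / 2 + e / 2); last by field.
exact: lerD.
Qed.

Lemma ker_reflect x0 t y : ker (t - x0) (- y) = - ker (x0 - t) y :> C.
Proof. by rewrite -kerN opprB. Qed.

Lemma ker_reflect_pi x0 t y : ker (t - x0) (pi - y) = ker (x0 - t) (y + pi) :> C.
Proof.
have -> : pi - y = - (y - pi) by rewrite opprB.
rewrite ker_reflect -kerD2pi; congr ker; ring.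
Qed.

Lemma ker_refl_L2 x0 y : sin (y / 2) != 0 -> L2 (fun s => ker (x0 - s) y : C).
Proof.
move=> s0; have h := (ker_shift_L2 x0 (y := - y) _).1.
have -> : (fun s => ker (x0 - s) y : C) = (fun s => - ker (s - x0) (- y)).
  by apply/funext => s; rewrite ker_reflect opprK.
by apply: L2N; apply: h; rewrite mulNr sinN oppr_eq0.
Qed.

Lemma sin_half_addpi_neq0 y : `|y| < pi -> sin ((y + pi) / 2) != 0 :> R.
Proof.
rewrite ltr_norml => /andP[h1 h2]; apply: sin_half_neq0.
have y0 : 0 < y + pi by rewrite -(opprK pi) subr_gt0.
by rewrite gtr0_norm// y0 /=; move: h2; clear; lra.
Qed.

(** This is [cauchy_line_identity] with [fpi] replaced by the conjugate of [f]. For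
    [y0 < 0] the pole of the kernel lies outside the strip, hence the zero. *)
Theorem hardy_reproducing F f fpi x0 y0 : hardy_strip F ->
  line_limit F 0 f -> line_limit F pi fpi -> ae_equal (fun t => (fpi t)^*) f ->
  0 < `|y0| < pi -> gint f x0 y0 = if 0 < y0 then F (x0 +i* y0) else 0.
Proof.
move=> hF h0 hpi ae y0pi; have := cauchy_line_identity x0 hF h0 hpi y0pi.
have /andP[y00 yp] := y0pi.
have Lf := h0.1; have Lfpi := hpi.1.
have s0 : sin (y0 / 2) != 0.
  by apply: sin_half_neq0; rewrite y00; move: yp (pi_gt0 R); clear; lra.
have s1 := sin_half_addpi_neq0 yp.
have K0 := ker_refl_L2 x0 s0; have K1 := ker_refl_L2 x0 s1.
rewrite (@eq_cint _ _ _ (fun t => - (f t * ker (x0 - t) y0))); last first.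
  by move=> t _; rewrite ker_reflect mulrN.
rewrite (cintN measurableT (L2_mul Lf K0)) -/(cauchy_int f x0 y0).
rewrite (@eq_cint _ _ (fun t => fpi t * _) (fun t => fpi t * ker (x0 - t) (y0 + pi))); last first.
  by move=> t _; rewrite ker_reflect_pi.
have -> : cint setT (fun t => fpi t * ker (x0 - t) (y0 + pi)) =
          cauchy_int (fun s => (f s)^*) x0 (y0 + pi).
  apply: eq_cint_ae.
  - exact: cintegrable_measurable (L2_mul Lfpi K1).
  - exact: cintegrable_measurable (L2_mul (L2J Lf) K1).
  - by move: ae; apply: ae_imp => t <-; rewrite conjcK.
move=> E; rewrite /gint.
have -> : cauchy_int f x0 y0 + cauchy_int (fun s => (f s)^*) x0 (y0 + pi) =
   - (if 0 < y0 then (4 * pi)%:C * 'i%C * F (x0 +i* y0) else 0) by rewrite -E; ring.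
have pi0 : (4 * pi)%:C != 0 :> C.
  by rewrite fmorph_eq0 mulf_neq0// gt_eqF// pi_gt0.
case: ifP => _; last by rewrite oppr0 mulr0.
have -> : 'i%C / (4 * pi)%:C * - ((4 * pi)%:C * 'i%C * F (x0 +i* y0)) =
   - ('i%C ^+ 2) * F (x0 +i* y0).
  by move: (4 * pi)%:C pi0 => p p0; field.
by rewrite sqr_i opprK mul1r.
Qed.

End reproducing.

(** * Holomorphy of the Cauchy integral *)

Section cauchy_integral_holomorphic.
Context {R : realType}.
Local Notation C := R[i].
Local Notation mu := (@lebesgue_measure R).
Implicit Types (psi : R -> C) (x y s : R) (w v : C).

Lemma cexp_real s : cexp (s%:C) = (expR s)%:C :> C.
Proof. by rewrite /cexp /= cos0 sin0; apply: complex_eq => /=; ring. Qed.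

Lemma kerz_exp w s : kerz s%:C w =
  2 * cexp (w / 2) * ((expR (s / 2))%:C / (cexp w - (expR s)%:C)).
Proof.
rewrite kerzE /csinh.
have e1 : cexp ((w - s%:C) / 2) = cexp (w / 2) / (expR (s / 2))%:C.
  have -> : (w - s%:C) / 2 = w / 2 + (- (s / 2))%:C.
    rewrite mulrBl; congr (_ + _); rewrite rmorphN /= rmorphM /= fmorphV rmorph_nat.
    by [].
  by rewrite cexpD cexp_real expRN fmorphV.
have e2 : cexp (- ((w - s%:C) / 2)) = (expR (s / 2))%:C / cexp (w / 2).
  apply: (mulIf (cexp_neq0 ((w - s%:C) / 2))); rewrite -cexpD addNr cexp0 e1.
  have h1 := cexp_neq0 (w / 2).
  have h2 : (expR (s / 2))%:C != 0 :> C by rewrite fmorph_eq0 gt_eqF// expR_gt0.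
  by move: (cexp _) (expR _)%:C h1 h2 => a b a0 b0; field; rewrite a0 b0.
have e3 : cexp w = cexp (w / 2) ^+ 2.
  by rewrite expr2 -cexpD; congr cexp; field.
have e4 : (expR s)%:C = (expR (s / 2))%:C ^+ 2 :> C.
  by rewrite expr2 -rmorphM /= -expRD; congr (expR _)%:C; field.
rewrite e1 e2 e3 e4.
have h1 := cexp_neq0 (w / 2).
have h2 : (expR (s / 2))%:C != 0 :> C by rewrite fmorph_eq0 gt_eqF// expR_gt0.
move: (cexp (w / 2)) (expR (s / 2))%:C h1 h2 => a b a0 b0.
have -> : (a / b - b / a) / 2 = (a ^+ 2 - b ^+ 2) / (2 * a * b) by field; rewrite a0 b0.
by rewrite invf_div; ring.
Qed.

Lemma rcont_expR s : rcont (fun t => (expR t)%:C) s.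
Proof.
move=> e e0; have := @continuous_expR R s => /cvgrPdist_lt /(_ e e0) [r /= r0 hr].
exists r => // t tr; rewrite -rmorphB /= cmod_real distrC; apply: hr => /=.
by rewrite distrC.
Qed.

Lemma ccont_rcont_comp (F : C -> C) (f : R -> C) s : rcont f s -> ccont F (f s) ->
  rcont (fun t => F (f t)) s.
Proof.
move=> cf cF e /cF [r r0 hr]; have [r' r'0 hr'] := cf _ r0.
by exists r' => // t /hr' /hr.
Qed.

Lemma cmeasurable_inv_sub_exp v : (forall s, v != (expR s)%:C) ->
  cmeasurable setT (fun s => (v - (expR s)%:C)^-1).
Proof.
move=> h; apply: rcont_cmeasurable => s.
apply: (@ccont_rcont_comp (fun w => (v - w)^-1)); first exact: rcont_expR.
apply: ccontV; first by rewrite subr_eq0.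
move=> e e0; exists e => // w we.
by rewrite (_ : _ - _ = - (w - (expR s)%:C)) ?cmodN//; ring.
Qed.

(** Up to the factor [2 exp (w / 2)] the kernel is a Cauchy kernel in the variable
    [exp w]; its second order remainder is an explicit rational function. *)
Lemma cdiff_stieltjes psi (v0 : C) (m : R) : 0 < m ->
  (forall s, m <= cmod (v0 - (expR s)%:C)) ->
  cmeasurable setT psi ->
  cintegrable setT (fun s => psi s * (v0 - (expR s)%:C)^-1) ->
  exists d, cdiff (fun v => cint setT (fun s => psi s * (v - (expR s)%:C)^-1)) v0 d.
Proof.
move=> m0 mv mpsi i0; pose k v s := (v - (expR s)%:C)^-1.
pose u s := psi s * k v0 s.
have n0 s : v0 - (expR s)%:C != 0.
  by apply/eqP => h; have := mv s; rewrite h cmod0 leNgt m0.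
have iu := cintegrable_cmod measurableT i0.
have i1 : cintegrable setT (fun s => u s * k v0 s).
  apply: (cintegrable_le _ _ (rintegrableZ m^-1 measurableT iu)) => //.
    apply: cmeasurableM; first exact: cintegrable_measurable i0.
    by apply: cmeasurable_inv_sub_exp => s; rewrite -subr_eq0.
  move=> s _; rewrite cmodM mulrC; apply: ler_wpM2r; first exact: cmod_ge0.
  by rewrite /k cmodV lef_pV2 ?posrE// (lt_le_trans m0).
(* the derivative of [1 / (v - a)] under the integral sign *)
exists (- cint setT (fun s => u s * k v0 s)) => e e0.
pose K := \int[mu]_s cmod (u s).
have K0 : 0 <= K by apply: Rintegral_ge0 => s _; exact: cmod_ge0.
pose c := 2 / m ^+ 2; have c0 : 0 < c by rewrite divr_gt0// exprn_gt0.
have cK : 0 < c * K + 1 by rewrite ltr_wpDl// mulr_ge0// ltW.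
exists (Num.min (m / 2) (e / (c * K + 1))); first by rewrite lt_min !divr_gt0.
move=> v; rewrite lt_min => /andP[vm ve].
have vb s : cmod (v0 - (expR s)%:C) / 2 <= cmod (v - (expR s)%:C).
  have : cmod (v0 - (expR s)%:C) <= cmod (v0 - v) + cmod (v - (expR s)%:C).
    by rewrite (le_trans _ (cmodD _ _))// addrA subrK.
  by rewrite (cmodC v0 v); move: vm (mv s); clear; lra.
have n1 s : v - (expR s)%:C != 0.
  apply/eqP => h; have := vb s; rewrite h cmod0 leNgt divr_gt0//.
  exact: lt_le_trans (mv s).
have mk : cmeasurable setT (k v) by apply: cmeasurable_inv_sub_exp => s; rewrite -subr_eq0.
have kb s : cmod (k v s * (v0 - (expR s)%:C)) <= 2.
  have a0 : 0 < cmod (v0 - (expR s)%:C) := lt_le_trans m0 (mv s).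
  rewrite cmodM /k cmodV mulrC ler_pdivrMr; last by rewrite (lt_le_trans _ (vb s))// divr_gt0.
  by rewrite mulrC -ler_pdivrMr.
have iv : cintegrable setT (fun s => psi s * k v s).
  apply: (cintegrable_le _ _ (rintegrableZ 2 measurableT iu)) => //; first exact: cmeasurableM.
  move=> s _; rewrite (_ : psi s * _ = (k v s * (v0 - (expR s)%:C)) * (psi s * (v0 - (expR s)%:C)^-1)).
    by rewrite (cmodM (k v s * _)); apply: ler_wpM2r; [exact: cmod_ge0|exact: kb].
  by have := n0 s; move: (v0 - _) => a a0; field.
have i3 := cintegrableZ (- (v - v0)) measurableT i1.
rewrite mulNr mulrC -mulNr -(cintZ (- (v - v0)) measurableT i1).
rewrite -(cintB measurableT iv i0) -(cintB measurableT (cintegrableB measurableT iv i0) i3).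
have E s : psi s * k v s - psi s * k v0 s - (- (v - v0) * (u s * k v0 s)) =
    (v - v0) ^+ 2 * (u s * (k v0 s * k v s)).
  rewrite /u /k; have := n0 s; have := n1 s; move: (expR s)%:C => a n n'.
  by field; rewrite n n'.
have iR := cintegrableB measurableT (cintegrableB measurableT iv i0) i3.
apply: (le_trans (cmod_cint_le measurableT iR)).
apply: (@le_trans _ _ (\int[mu]_s (cmod (v - v0) ^+ 2 * c * cmod (u s)))).
  apply: Rintegral_le => //; first exact: cintegrable_cmod.
    exact: rintegrableZ.
  move=> s _; rewrite E (cmodM (_ ^+ 2)) expr2 (cmodM (v - v0)) (cmodM (u s)) -expr2 -mulrA.
  apply: ler_wpM2l; first by rewrite sqr_ge0.
  rewrite mulrC; apply: ler_wpM2r; first exact: cmod_ge0.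
  rewrite cmodM.
  have a0 : m / 2 <= cmod (v - (expR s)%:C).
    by apply: le_trans (vb s); rewrite ler_pM2r.
  rewrite /c /k !cmodV (_ : 2 / m ^+ 2 = m^-1 * (m / 2)^-1); last by field; rewrite gt_eqF.
  have m2 : 0 < m / 2 by rewrite divr_gt0.
  apply: ler_pM; rewrite ?invr_ge0 ?cmod_ge0//.
    by rewrite lef_pV2 ?posrE// (lt_le_trans m0).
  by rewrite lef_pV2 ?posrE// (lt_le_trans m2).
rewrite RintegralZr'// -/K -mulrA expr2 -mulrA mulrC.
rewrite ler_wpM2r ?cmod_ge0//.
apply: (@le_trans _ _ (cmod (v - v0) * (c * K + 1))).
  by rewrite ler_wpM2l ?cmod_ge0// lerDl.
by rewrite -ler_pdivlMr// ltW.
Qed.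

Lemma cauchy_int_exp psi w : cauchy_int psi (complex.Re w) (complex.Im w) =
  cint setT (fun s => 2 * cexp (w / 2) *
    ((psi s * (expR (s / 2))%:C) * (cexp w - (expR s)%:C)^-1)).
Proof.
apply: eq_cint => s _; have := kerz_exp w s.
rewrite /kerz /= subr0 => ->; ring.
Qed.

(** The left-hand side is the distance from [exp w] to the whole real axis. *)
Lemma cexp_dist w s :
  expR (complex.Re w) * `|sin (complex.Im w)| <= cmod (cexp w - (expR s)%:C).
Proof.
apply: le_trans (Im_le_cmod _); case: w => x y; rewrite !ReImE /cexp /= !mul0r !addr0 oppr0 addr0.
by rewrite normrM (ger0_norm (expR_ge0 x)).
Qed.

Lemma cdiff_near (F G : C -> C) z d (r : R) : 0 < r ->
  (forall w, cmod (w - z) < r -> F w = G w) -> cdiff F z d -> cdiff G z d.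
Proof.
move=> r0 FG dF e e0; have [s s0 hs] := dF _ e0.
exists (Num.min r s); first by rewrite lt_min r0.
move=> w; rewrite lt_min => /andP[wr ws]; rewrite -!FG//; first exact: hs.
by rewrite subrr cmod0.
Qed.

(** The composition of [cdiff_stieltjes] with the exponential, away from the lines on
    which the exponential is real. *)
Lemma cdiff_cauchy_int psi x0 y0 : L2 psi -> sin y0 != 0 ->
  exists d, cdiff (fun w => cauchy_int psi (complex.Re w) (complex.Im w)) (x0 +i* y0) d.
Proof.
move=> Lp s0; have h0 : sin (y0 / 2) != 0.
  apply: contra s0 => /eqP h; have -> : y0 = (y0 / 2) *+ 2 by rewrite mulr2n; field.
  by rewrite sin_mulr2n h mulr0 mul0rn.
have mexp : cmeasurable setT (fun s => (expR (s / 2))%:C : C).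
  apply: cmeasurable_real; apply: continuous_measurable_fun => s.
  exact: (continuous_comp (@continuous_half R s) (@continuous_expR R _)).
pose phi s := psi s * (expR (s / 2))%:C.
have mphi : cmeasurable setT phi.
  by apply: cmeasurableM => //; exact: L2_cmeasurable.
have c0 w : 2 * cexp (w / 2) != 0 :> C by rewrite mulf_neq0 ?cexp_neq0// pnatr_eq0.
have iphi w : sin (complex.Im w / 2) != 0 ->
    cintegrable setT (fun s => phi s * (cexp w - (expR s)%:C)^-1).
  move=> sw; have := cintegrableZ (2 * cexp (w / 2))^-1 measurableT
    (L2_mul Lp (ker_refl_L2 (complex.Re w) sw)).
  rewrite (_ : (fun t => _) = (fun s => phi s * (cexp w - (expR s)%:C)^-1))//.
  apply/funext => s; have := kerz_exp w s; rewrite /kerz /= subr0 => ->.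
  rewrite /phi; have := c0 w; move: (2 * _) => c cn0.
  by move: (psi s) (expR (s / 2))%:C (cexp w - _)^-1 => p b k; field.
have [d hd] := @cdiff_stieltjes phi (cexp (x0 +i* y0)) (expR x0 * `|sin y0|)
  (mulr_gt0 (expR_gt0 _) (etrans (normr_gt0 _) s0)) (cexp_dist (x0 +i* y0)) mphi (iphi (x0 +i* y0) h0).
have dE := cdiffM (cdiffM (cdiff_cst 2 (x0 +i* y0))
   (cdiff_comp (cdiff_affine (2^-1) 0 (x0 +i* y0)) (@cdiff_cexp _ _)))
   (cdiff_comp (@cdiff_cexp R (x0 +i* y0)) hd).
eexists; apply: (@cdiff_near _ _ _ _ `|sin (y0 / 2)|) dE; first by rewrite normr_gt0.
move=> w wr; rewrite cauchy_int_exp addr0 [2^-1 * w]mulrC.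
have sw : sin (complex.Im w / 2) != 0.
  have := Im_le_cmod (w - (x0 +i* y0)); rewrite ImB /= => h1.
  have := dist_sin_le (y0 / 2) (complex.Im w / 2).
  rewrite -mulrBl normrM [`|2^-1|]ger0_norm// (distrC y0) => h2.
  apply/eqP => sw; move: h2; rewrite sw subr0.
  by move: (le_lt_trans h1 wr) (normr_ge0 (sin (y0 / 2))); clear; lra.
by rewrite (cintZ _ measurableT (iphi _ sw)).
Qed.

Lemma cdiff_gint psi x0 y0 : L2 psi -> sin y0 != 0 ->
  exists d, cdiff (fun w => gint psi (complex.Re w) (complex.Im w)) (x0 +i* y0) d.
Proof.
move=> Lp s0; have [d1 h1] := cdiff_cauchy_int x0 Lp s0.
have s1 : sin (y0 + pi) != 0 by rewrite sinDpi oppr_eq0.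
have [d2 h2] := cdiff_cauchy_int x0 (L2J Lp) s1.
have h3 : cdiff (fun w => 1 * w + 0 +i* pi) (x0 +i* y0) 1 by exact: cdiff_affine.
have E : 1 * (x0 +i* y0) + 0 +i* pi = x0 +i* (y0 + pi) :> C by rewrite mul1r; apply: complex_eq => /=; ring.
have h4 := @cdiff_comp R _ (fun w => 1 * w + 0 +i* pi) (x0 +i* y0) _ _ h3.
rewrite E in h4; have {}h4 := h4 _ _ h2.
have h5 := cdiffM (cdiff_cst ('i%C / (4 * pi)%:C) (x0 +i* y0)) (cdiffD h1 h4).
eexists; apply: cdiff_near ltr01 _ h5 => w _.
by rewrite /gint mul1r !ReImE /= addr0.
Qed.

End cauchy_integral_holomorphic.

(** * Boundedness of the Cauchy integral on horizontal lines *)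

Section schur.
Context {R : realType}.
Local Notation C := R[i].
Local Notation mu := (@lebesgue_measure R).
Implicit Types (f T : R -> C) (K : R -> R) (x s l : R).

(** Schur's test for a convolution kernel: Cauchy-Schwarz for the measure
    [K (x - s) ds], followed by Tonelli. *)
Lemma schur_test K (k : R) f T : 0 < k -> (forall u, 0 <= K u) -> measurable_fun setT K ->
  (forall x, rintegrable setT (fun s => K (x - s)) /\ \int[mu]_s K (x - s) = k) ->
  (forall s, (\int[mu]_x (K (x - s))%:E = k%:E)%E) ->
  L2 f -> cmeasurable setT T ->
  (forall x, cmod (T x) <= \int[mu]_s (K (x - s) * cmod (f s))) ->
  L2 T /\ sqint T <= k ^+ 2 * sqint f.
Proof.
move=> k0 K0 mK K1 K2 Lf mT bT; have /L2P[mf if2] := Lf.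
have msub x : measurable_fun setT (fun s : R => x - s) by exact: measurable_funB.
have mKx x : measurable_fun setT (fun s => K (x - s)) by exact: (measurableT_comp mK).
have mf2 : measurable_fun setT (fun s => cmod (f s) ^+ 2) := cmeasurable_sqr_cmod mf.
have point x : ((cmod (T x) ^+ 2)%:E <= \int[mu]_s (k * (K (x - s) * cmod (f s) ^+ 2))%:E)%E.
  have mKf : measurable_fun setT (fun s => k * (K (x - s) * cmod (f s) ^+ 2)).
    by apply: measurable_funM => //; exact: measurable_funM.
  have Kf0 s : 0 <= k * (K (x - s) * cmod (f s) ^+ 2).
    by rewrite mulr_ge0 ?(ltW k0)// mulr_ge0// sqr_ge0.
  have [foo|] := boolP ((\int[mu]_s (k * (K (x - s) * cmod (f s) ^+ 2))%:E < +oo)%E); last first.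
    by rewrite -leNgt leye_eq => /eqP ->; rewrite leey.
  have iKf := rintegrable_ge0 measurableT mKf (fun s _ => Kf0 s) foo.
  have iKf' : rintegrable setT (fun s => K (x - s) * cmod (f s) ^+ 2).
    have := rintegrableZ k^-1 measurableT iKf; apply: eq_rintegrable => // s _.
    by rewrite mulrA mulVf ?mul1r// gt_eqF.
  rewrite RintegralE// lee_fin RintegralZr'//.
  pose u s : C := (Num.sqrt (K (x - s)))%:C.
  pose v s : C := (Num.sqrt (K (x - s)) * cmod (f s))%:C.
  have msq : measurable_fun setT (fun s => Num.sqrt (K (x - s))).
    by apply: measurableT_comp (mKx x); exact: (continuous_measurable_fun (@sqrt_continuous R)).
  have u2 s : cmod (u s) ^+ 2 = K (x - s).
    by rewrite /u cmod_real real_normK ?num_real// sqr_sqrtr.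
  have v2 s : cmod (v s) ^+ 2 = K (x - s) * cmod (f s) ^+ 2.
    by rewrite /v cmod_real real_normK ?num_real// exprMn sqr_sqrtr.
  have [iKx EKx] := K1 x.
  have Lu : L2 u.
    by apply/L2P; split; [exact: cmeasurable_real|apply: eq_rintegrable iKx => // s _; rewrite u2].
  have Lv : L2 v.
    apply/L2P; split; last by apply: eq_rintegrable iKf' => // s _; rewrite v2.
    by apply: cmeasurable_real; apply: measurable_funM => //; exact: cmeasurable_cmod.
  have uE : sqint u = k by rewrite -EKx; apply: eq_Rintegral => s _; exact: u2.
  have vE : sqint v = \int[mu]_s (K (x - s) * cmod (f s) ^+ 2).
    by apply: eq_Rintegral => s _; exact: v2.
  have := cauchy_schwarz Lu Lv; rewrite uE vE => cs.
  have I0 : 0 <= \int[mu]_s (K (x - s) * cmod (f s) ^+ 2).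
    by apply: Rintegral_ge0 => s _; rewrite mulr_ge0// sqr_ge0.
  rewrite -[leRHS]sqr_sqrtr ?mulr_ge0 ?(ltW k0)// ler_sqr ?nnegrE ?cmod_ge0 ?sqrtr_ge0//.
  apply: (le_trans (bT x)); apply: le_trans cs; rewrite le_eqVlt; apply/orP; left; apply/eqP.
  apply: eq_Rintegral => s _; rewrite /u /v !cmod_real !ger0_norm ?sqrtr_ge0//.
    by rewrite mulrA -expr2 sqr_sqrtr.
  by rewrite mulr_ge0 ?sqrtr_ge0 ?cmod_ge0.
have mjoint : measurable_fun setT (fun p : R * R => k * (K (p.1 - p.2) * cmod (f p.2) ^+ 2)).
  apply: measurable_funM => //; apply: measurable_funM.
    by apply: (measurableT_comp mK); exact: measurable_funB.
  exact: (measurableT_comp mf2).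
have j0 x s : 0 <= k * (K (x - s) * cmod (f s) ^+ 2).
  by rewrite mulr_ge0 ?(ltW k0)// mulr_ge0// sqr_ge0.
have ig : rintegrable setT (fun s => k ^+ 2 * cmod (f s) ^+ 2) by exact: rintegrableZ.
have jg s : (\int[mu]_x (k * (K (x - s) * cmod (f s) ^+ 2))%:E <= (k ^+ 2 * cmod (f s) ^+ 2)%:E)%E.
  have mKs : measurable_fun setT (fun x => (K (x - s))%:E).
    by apply/measurable_EFinP; apply: (measurableT_comp mK); exact: measurable_funB.
  rewrite (_ : (fun x => _) = (fun x => (k * cmod (f s) ^+ 2)%:E * (K (x - s))%:E)%E); last first.
    by apply/funext => x; rewrite -EFinM; congr EFin; ring.
  rewrite ge0_integralZl//.
  - by rewrite K2 -EFinM lee_fin expr2 le_eqVlt; apply/orP; left; apply/eqP; ring.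
  - by move=> x _; rewrite lee_fin.
  - by rewrite lee_fin mulr_ge0 ?(ltW k0)// sqr_ge0.
have [E mF] := tonelli_le mjoint j0 ig jg.
have mT2 : measurable_fun setT (fun x => (cmod (T x) ^+ 2)%:E).
  by apply/measurable_EFinP; exact: cmeasurable_sqr_cmod.
have T20 x : (0 <= (cmod (T x) ^+ 2)%:E)%E by rewrite lee_fin sqr_ge0.
have := le_trans (le_integral_ge0 T20 mT2 mF point) E.
rewrite RintegralZr'// -/(sqint f) => h.
have iT : rintegrable setT (fun x => cmod (T x) ^+ 2).
  apply: rintegrable_ge0 => //; first exact: cmeasurable_sqr_cmod.
    by move=> x _; exact: sqr_ge0.
  exact: le_lt_trans h (ltry _).
split; first exact/L2P.
by move: h; rewrite RintegralE// lee_fin.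
Qed.

End schur.

Section poisson_representation.
Context {R : realType}.
Local Notation C := R[i].
Local Notation mu := (@lebesgue_measure R).
Implicit Types (f : R -> C) (x s l u : R).

Definition pk l u : R := (2 * pi)^-1 * pois (sin (l / 2)) u.

(** The probability density [pk] is the kernel of the singular half of [tint]; the
    second summand dominates the regular half, which is of order [l]. *)
Definition kk l u : R := pk l u + l / pi * rho u.

(** On a Hardy function this is the Cauchy integral, since the reflected value
    vanishes. On all of [L2] it remains bounded up to the edge [l = 0], where the
    Cauchy integral alone is a singular integral: the difference of the kernels is
    a Poisson kernel. *)
Definition tint f l x : C := gint f x l - gint f x (- l).

Lemma sin_half_gt0 l : 0 < l < pi -> 0 < sin (l / 2) :> R.
Proof.
move=> /andP[l0 lpi]; apply: sin_gt0_pi; rewrite divr_gt0//=.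
by move: l0 lpi; clear; lra.
Qed.

Lemma ker_sub_pk l u : 0 < l < pi ->
  'i%C / (4 * pi)%:C * (ker u l - ker u (- l)) = (pk l u)%:C.
Proof.
move=> lpi; have p0 := pi_gt0 R; rewrite ker_subN -/(pois _ u) /pk.
have p0C : pi%:C != 0 :> C by rewrite fmorph_eq0 gt_eqF.
have E4 : (4 * pi)%:C = 4 * pi%:C :> C by rewrite rmorphM rmorph_nat.
have E2 : (2 * pois (sin (l / 2)) u)%:C = 2 * (pois (sin (l / 2)) u)%:C :> C.
  by rewrite rmorphM rmorph_nat.
have Ep : ((2 * pi)^-1 * pois (sin (l / 2)) u)%:C = (2 * pi%:C)^-1 * (pois (sin (l / 2)) u)%:C :> C.
  by rewrite rmorphM fmorphV rmorphM rmorph_nat.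
rewrite E4 E2 Ep.
move: (pois _ u)%:C pi%:C p0C => q p pn0.
have -> : 'i%C / (4 * p) * (- (2 * q) * 'i%C) = - ('i%C ^+ 2) * ((2 * p)^-1 * q) by field.
by rewrite sqr_i opprK mul1r.
Qed.

(** Near height [pi] the kernel is regular, so mirror points give values at distance
    of order [l]. *)
Lemma ker_addpi_dist l u : 0 < l <= pi / 2 ->
  cmod (ker u (l + pi) - ker u (- l + pi) : C) <= 4 * l * rho u.
Proof.
move=> /andP[l0 lpi]; have p0 := pi_gt0 R.
have E1 : sin ((l + pi) / 2) = cos (l / 2) :> R by rewrite mulrDl sinDpihalf.
have E2 : sin ((- l + pi) / 2) = cos (l / 2) :> R by rewrite mulrDl sinDpihalf mulNr cosN.
have cE : 2^-1 <= cos (l / 2) ^+ 2 :> R.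
  have : 0 <= cos l :> R by apply: cos_ge0_pihalf; apply/andP; split; move: l0 lpi p0; clear; lra.
  have -> : l = (l / 2) *+ 2 by rewrite mulr2n; field.
  by rewrite cos_mulr2n mulr2n; rewrite (_ : l / 2 *+ 2 / 2 = l / 2); [clear; lra|rewrite mulr2n; field].
have c0 : cos (l / 2) != 0 :> R.
  by apply/eqP => h; move: cE; rewrite h expr0n/=; clear; lra.
have := @ker_lip R u (l + pi) (- l + pi); rewrite E1 E2 => /(_ c0 c0) h.
apply: (le_trans h); rewrite mulrC ler_wpM2r ?rho_ge0//.
have -> : l + pi - (- l + pi) = 2 * l by ring.
rewrite -normrM -expr2 (ger0_norm (sqr_ge0 _)) ger0_norm ?mulr_ge0 ?(ltW l0)//.
rewrite ler_pdivrMr; last by rewrite (lt_le_trans _ cE).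
rewrite (_ : 4 * l * _ = (2 * l) * (2 * cos (l / 2) ^+ 2)); last by ring.
by rewrite ler_pMr ?mulr_gt0//; move: cE; clear; lra.
Qed.

Lemma pk_L2 l x : 0 < l < pi -> L2 (fun s => (pk l (x - s))%:C : C).
Proof.
move=> lpi; have s0 := lt0r_neq0 (sin_half_gt0 lpi).
have h := L2Z ('i%C / (4 * pi)%:C) (L2B (ker_refl_L2 x s0) (ker_refl_L2 x (y := - l) _)).
rewrite (_ : (fun s => _) = (fun s => 'i%C / (4 * pi)%:C * (ker (x - s) l - ker (x - s) (- l)))).
  by apply: h; rewrite mulNr sinN oppr_eq0.
by apply/funext => s; rewrite ker_sub_pk.
Qed.

Lemma tintE f l x : L2 f -> 0 < l < pi ->
  tint f l x = cint setT (fun s => f s * (pk l (x - s))%:C) +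
   'i%C / (4 * pi)%:C * cint setT (fun s => (f s)^* * (ker (x - s) (l + pi) - ker (x - s) (- l + pi))).
Proof.
move=> Lf lpi; have s0 := lt0r_neq0 (sin_half_gt0 lpi).
have s0N : sin (- l / 2) != 0 by rewrite mulNr sinN oppr_eq0.
have /andP[l0 lp] := lpi.
have s1 : sin ((l + pi) / 2) != 0 by apply: sin_half_addpi_neq0; rewrite ger0_norm// ltW.
have s2 : sin ((- l + pi) / 2) != 0.
  by apply: sin_half_addpi_neq0; rewrite normrN ger0_norm// ltW.
have i1 := L2_mul Lf (ker_refl_L2 x s0); have i2 := L2_mul Lf (ker_refl_L2 x s0N).
have i3 := L2_mul (L2J Lf) (ker_refl_L2 x s1); have i4 := L2_mul (L2J Lf) (ker_refl_L2 x s2).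
rewrite /tint /gint /cauchy_int.
rewrite (_ : 'i%C / _ * (_ + _) - _ = 'i%C / (4 * pi)%:C *
  ((cint setT (fun s => f s * ker (x - s) l) - cint setT (fun s => f s * ker (x - s) (- l))) +
   (cint setT (fun s => (f s)^* * ker (x - s) (l + pi)) -
    cint setT (fun s => (f s)^* * ker (x - s) (- l + pi))))); last by ring.
rewrite -(cintB measurableT i1 i2) -(cintB measurableT i3 i4) mulrDr; congr (_ + _).
  rewrite -(cintZ _ measurableT (cintegrableB measurableT i1 i2)).
  by apply: eq_cint => s _; rewrite -ker_sub_pk//; ring.
by congr (_ * _); apply: eq_cint => s _; ring.
Qed.

Lemma pois_measurable a : 0 < a -> measurable_fun setT (pois a : R -> R).
Proof. by move=> a0; exact: continuous_measurable_fun (continuous_pois a0). Qed.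

Lemma kkN l u : kk l (- u) = kk l u.
Proof. by rewrite /kk /pk poisN rhoN. Qed.

Lemma kk_ge0 l u : 0 < l < pi -> 0 <= kk l u.
Proof.
move=> lpi; have /andP[l0 _] := lpi; have p0 := pi_gt0 R.
have v0 : 0 <= pi^-1 :> R by rewrite invr_ge0 ltW.
rewrite addr_ge0// mulr_ge0 ?rho_ge0 ?pois_ge0 ?invr_ge0 ?mulr_ge0 ?(ltW l0) ?(ltW p0)//.
exact: sin_half_gt0.
Qed.

Lemma rintegrable_pk l x : 0 < l < pi -> rintegrable setT (fun s => pk l (s - x)) /\
  \int[mu]_s pk l (s - x) = 1.
Proof.
move=> lpi; have s0 := sin_half_gt0 lpi; have p0 := pi_gt0 R.
have ip := rintegrable_pois x s0.
split; first exact: rintegrableZ.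
by rewrite RintegralZr'// Rintegral_pois// mulVf// mulf_neq0// gt_eqF.
Qed.

Lemma rintegrable_kk l x : 0 < l < pi -> rintegrable setT (fun s => kk l (s - x)) /\
  \int[mu]_s kk l (s - x) = 1 + 2 * l.
Proof.
move=> lpi; have [i1 E1] := rintegrable_pk x lpi; have p0 := pi_gt0 R.
have i2 := rintegrableZ (l / pi) measurableT (rintegrable_rho x).
split; first exact: rintegrableD.
rewrite RintegralDr// E1 (RintegralZr' _ measurableT (rintegrable_rho x)) Rintegral_rho.
have pn : pi != 0 :> R by rewrite gt_eqF.
by congr (_ + _); clear -pn; move: (pi : R) pn => p pn; field.
Qed.

Lemma rho_shift_L2 x : L2 (fun s => (rho (x - s))%:C : C).
Proof.
have h := ker_refl_L2 x (y := pi) _; have := L2Z 'i%C (h _).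
rewrite (_ : (fun t => _) = (fun s => (rho (x - s))%:C)); last first.
  by apply/funext => s; rewrite ker_pi mulrA mulrN -expr2 sqr_i opprK mul1r.
by apply; rewrite sin_pihalf oner_eq0.
Qed.

Lemma tint_bound f l x : L2 f -> 0 < l <= pi / 2 ->
  rintegrable setT (fun s => kk l (x - s) * cmod (f s)) /\
  cmod (tint f l x) <= \int[mu]_s (kk l (x - s) * cmod (f s)).
Proof.
move=> Lf lpi2; have p0 := pi_gt0 R.
have lpi : 0 < l < pi.
  by move/andP: lpi2 => [-> h] /=; move: h p0; clear; lra.
have /andP[l0 _] := lpi; have s0 := sin_half_gt0 lpi.
have Lpk := pk_L2 x lpi.
have Lrho := rho_shift_L2 x.
have i1 := cintegrable_cmod measurableT (L2_mul Lf Lpk).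
have i2 := cintegrable_cmod measurableT (L2_mul Lf Lrho).
have ikk : rintegrable setT (fun s => kk l (x - s) * cmod (f s)).
  have := rintegrableD measurableT i1 (rintegrableZ (l / pi) measurableT i2).
  apply: eq_rintegrable => // s _; rewrite !cmodM !cmod_real /kk !ger0_norm ?rho_ge0//.
    by ring.
  by rewrite /pk mulr_ge0 ?pois_ge0// invr_ge0 mulr_ge0// ltW.
split => //; rewrite tintE//; apply: (le_trans (cmodD _ _)); rewrite cmodM.
have /andP[_ lp] := lpi.
have s1 : sin ((l + pi) / 2) != 0 by apply: sin_half_addpi_neq0; rewrite ger0_norm// ltW.
have s2 : sin ((- l + pi) / 2) != 0.
  by apply: sin_half_addpi_neq0; rewrite normrN ger0_norm// ltW.
have i3 := L2_mul (L2J Lf) (L2B (ker_refl_L2 x s1) (ker_refl_L2 x s2)).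
have i3' := cintegrable_cmod measurableT i3.
have c4 : cmod ('i%C / (4 * pi)%:C : C) = (4 * pi)^-1.
  by rewrite cmodM cmodi mul1r cmodV cmod_real ger0_norm// mulr_ge0// ltW.
rewrite c4; apply: (@le_trans _ _ (\int[mu]_s cmod (f s * (pk l (x - s))%:C) +
  (4 * pi)^-1 * \int[mu]_s cmod ((f s)^* * (ker (x - s) (l + pi) - ker (x - s) (- l + pi))))).
  apply: lerD; first exact: cmod_cint_le (L2_mul Lf Lpk).
  by rewrite ler_pM2l ?invr_gt0 ?mulr_gt0//; exact: cmod_cint_le i3.
rewrite -RintegralZr'// -RintegralDr//; last exact: rintegrableZ.
apply: Rintegral_le => //; first by apply: rintegrableD => //; exact: rintegrableZ.
move=> s _; rewrite !cmodM cmodJ cmod_real /kk ger0_norm; last first.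
  by rewrite /pk mulr_ge0 ?pois_ge0// invr_ge0 mulr_ge0// ltW.
rewrite [leRHS]mulrDl [cmod (f s) * pk _ _]mulrC lerD2l.
rewrite mulrCA mulrC ler_wpM2r ?cmod_ge0//.
apply: (@le_trans _ _ ((4 * pi)^-1 * (4 * l * rho (x - s)))).
  by rewrite ler_pM2l ?invr_gt0 ?mulr_gt0// ker_addpi_dist.
have pn : pi != 0 :> R by rewrite gt_eqF.
rewrite le_eqVlt; apply/orP; left; apply/eqP; move: (rho _) => r.
by clear -pn; move: (pi : R) pn => p pn; field.
Qed.

Lemma gint_measurable f l : L2 f -> sin l != 0 -> cmeasurable setT (gint f ^~ l).
Proof.
move=> Lf s0; apply: rcont_cmeasurable => x; have [d hd] := cdiff_gint x Lf s0.
exact: (@ccont_hor _ (fun w => gint f (complex.Re w) (complex.Im w)) x l (cdiff_cont hd)).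
Qed.

(** By [schur_test] for the kernel [kk], of mass [1 + 2 * l]. Uniformity in [l] is
    what makes the real Hardy space closed. *)
Lemma tint_L2 f l : L2 f -> 0 < l <= pi / 2 ->
  L2 (tint f l) /\ sqint (tint f l) <= 25 * sqint f.
Proof.
move=> Lf lpi2; have p0 := pi_gt0 R.
have lpi : 0 < l < pi.
  by move/andP: lpi2 => [-> h] /=; move: h p0; clear; lra.
have /andP[l0 lp] := lpi.
have sl : 0 < sin l by apply: sin_gt0_pi; rewrite l0.
have k0 : 0 < 1 + 2 * l by move: l0; clear; lra.
have mkk : measurable_fun setT (kk l).
  apply: measurable_funD; apply: measurable_funM => //.
    exact: pois_measurable (sin_half_gt0 lpi).
  exact: measurable_rho.
have mt : cmeasurable setT (tint f l).
  apply: cmeasurableB; apply: gint_measurable => //; first by rewrite gt_eqF.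
  by rewrite sinN oppr_eq0 gt_eqF.
have K1 x : rintegrable setT (fun s => kk l (x - s)) /\ \int[mu]_s kk l (x - s) = 1 + 2 * l.
  rewrite (_ : (fun s => kk l (x - s)) = (fun s => kk l (s - x))); first exact: rintegrable_kk.
  by apply/funext => s; rewrite -kkN opprB.
have K2 s : (\int[mu]_x (kk l (x - s))%:E = (1 + 2 * l)%:E)%E.
  by have [i E] := rintegrable_kk s lpi; rewrite RintegralE// E.
have [LT h] := schur_test k0 (fun u => kk_ge0 u lpi) mkk K1 K2 Lf mt (fun x => (tint_bound x Lf lpi2).2).
split => //; apply: (le_trans h); rewrite ler_wpM2r ?sqint_ge0//.
have pi4 : pi < 4 :> R by have := pihalf_lt2 R; clear; lra.
(* [1 + 2 * l <= 5] because [2 * l <= pi < 4] *)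
rewrite (_ : 25 = 5 ^+ 2); last by ring.
rewrite ler_sqr ?nnegrE// ?ltW//; move/andP: lpi2 => [_]; move: l0 pi4; clear; lra.
Qed.

End poisson_representation.

(** * The real Hardy space through the Cauchy integral *)

Section hardy_characterization.
Context {R : realType}.
Local Notation C := R[i].
Local Notation mu := (@lebesgue_measure R).
Implicit Types (F : C -> C) (f g h : R -> C) (x y l e r : R).

Lemma sin_half_neq0_strip y : 0 < `|y| < pi -> sin (y / 2) != 0 :> R.
Proof.
move=> /andP[y0 ypi]; apply: sin_half_neq0; rewrite y0 /=.
by move: y0 ypi; clear; lra.
Qed.

Lemma conjD (z w : C) : (z + w)^*%C = z^*%C + w^*%C.
Proof. by apply: complex_eq; rewrite !(ReJ, ImJ, ReD, ImD) ?opprD. Qed.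

Lemma conjM (z w : C) : (z * w)^*%C = z^*%C * w^*%C.
Proof. by apply: complex_eq; rewrite !(ReJ, ImJ, ReM, ImM); ring. Qed.

Lemma conjB (z w : C) : (z - w)^*%C = z^*%C - w^*%C.
Proof. by apply: complex_eq; rewrite !(ReJ, ImJ, ReB, ImB) ?opprD. Qed.

Lemma conj_real r : (r%:C)^*%C = r%:C :> C.
Proof. by apply: complex_eq; rewrite !(ReJ, ImJ) //= oppr0. Qed.

Lemma conj_i_div r : ('i%C / r%:C)^*%C = - ('i%C / r%:C) :> C.
Proof.
rewrite conjM -mulNr; congr (_ * _); first by apply: complex_eq; rewrite !(ReJ, ImJ) /= ?oppr0.
by rewrite -(fmorphV (real_complex R)) conj_real.
Qed.

(** Reflection in the middle line of the strip: conjugating the kernel and using its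
    antiperiodicity exchanges the two halves of [gint]. *)
Lemma gintJ f x y : L2 f -> 0 < y < pi -> gint f x (pi - y) = (gint f x y)^*%C.
Proof.
move=> Lf ypi; have /andP[y0 yp] := ypi.
have s0 : sin (y / 2) != 0 by apply: sin_half_neq0_strip; rewrite gtr0_norm// y0.
have s1 : sin ((y + pi) / 2) != 0 by apply: sin_half_addpi_neq0; rewrite gtr0_norm.
have i0 := L2_mul Lf (ker_refl_L2 x s0); have i1 := L2_mul (L2J Lf) (ker_refl_L2 x s1).
have i2 := cintegrableJ measurableT i1.
rewrite /gint conjM conjD conj_i_div /cauchy_int -(cintJ measurableT i0) -(cintJ measurableT i1).
rewrite mulNr -mulrN opprD; congr (_ * _); rewrite addrC; congr (_ + _).
  rewrite -(cintN measurableT (cintegrableJ measurableT i0)).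
  apply: eq_cint => s _; rewrite conjM kerJ -mulrN; congr (_ * _).
  by rewrite -kerD2pi; congr ker; ring.
rewrite -(cintN measurableT i2); apply: eq_cint => s _.
rewrite conjM kerJ conjcK -mulrN; congr (_ * _).
by rewrite -kerD2pi; congr ker; ring.
Qed.

Lemma gint_lin r f g x y : L2 f -> L2 g -> 0 < `|y| < pi ->
  gint (fun t => r%:C * f t + g t) x y = r%:C * gint f x y + gint g x y.
Proof.
move=> Lf Lg ypi; have /andP[y0 yp] := ypi.
have s0 := sin_half_neq0_strip ypi; have s1 := sin_half_addpi_neq0 yp.
have K0 := ker_refl_L2 x s0; have K1 := ker_refl_L2 x s1.
have i0 := L2_mul Lf K0; have i1 := L2_mul (L2J Lf) K1.
have j0 := L2_mul Lg K0; have j1 := L2_mul (L2J Lg) K1.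
rewrite /gint /cauchy_int.
rewrite (@eq_cint _ _ _ (fun s => r%:C * (f s * ker (x - s) y) + g s * ker (x - s) y)); last first.
  by move=> s _; ring.
rewrite (cintD measurableT (cintegrableZ _ measurableT i0) j0) (cintZ _ measurableT i0).
rewrite (@eq_cint _ _ (fun s => (_ + _)^*%C * _)
  (fun s => r%:C * ((f s)^*%C * ker (x - s) (y + pi)) + (g s)^*%C * ker (x - s) (y + pi))); last first.
  by move=> s _; rewrite conjD conjM conj_real; ring.
rewrite (cintD measurableT (cintegrableZ _ measurableT i1) j1) (cintZ _ measurableT i1).
ring.
Qed.

Lemma gintB f g x y : L2 f -> L2 g -> 0 < `|y| < pi ->
  gint (fun t => f t - g t) x y = gint f x y - gint g x y.
Proof.
move=> Lf Lg ypi.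
have -> : (fun t => f t - g t) = (fun t => (-1)%:C * g t + f t).
  by apply/funext => t; rewrite rmorphN1 mulN1r addrC.
by rewrite gint_lin// rmorphN1 mulN1r addrC.
Qed.

(** Cauchy-Schwarz against the two kernels: point evaluations are continuous on
    [L2], which lets the vanishing conditions pass to limits. *)
Lemma cmod_gint_le x y : 0 < `|y| < pi -> exists2 M : R, 0 <= M &
  forall f, L2 f -> cmod (gint f x y) <= M * Num.sqrt (sqint f).
Proof.
move=> ypi; have /andP[y0 yp] := ypi.
have K0 := ker_refl_L2 x (sin_half_neq0_strip ypi).
have K1 := ker_refl_L2 x (sin_half_addpi_neq0 yp).
pose c := cmod ('i%C / (4 * pi)%:C : C).
pose k0 := Num.sqrt (sqint (fun s => ker (x - s) y : C)).
pose k1 := Num.sqrt (sqint (fun s => ker (x - s) (y + pi) : C)).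
exists (c * (k0 + k1)); first by rewrite mulr_ge0 ?cmod_ge0 ?addr_ge0 ?sqrtr_ge0.
move=> f Lf; rewrite /gint cmodM -mulrA ler_wpM2l ?cmod_ge0//.
rewrite mulrDl; apply: (le_trans (cmodD _ _)); apply: lerD.
  by rewrite mulrC /k0 -sqrtrM ?sqint_ge0//; exact: cmod_cint_mul_le.
rewrite mulrC /k1 -sqrtrM ?sqint_ge0// -(sqintJ f).
by apply: cmod_cint_mul_le => //; exact: L2J.
Qed.

(** Membership in [H] expressed by the Cauchy integral alone, hence by conditions
    that are visibly real linear and stable under limits. *)
Definition cauchy_hardy f := [/\ L2 f,
  forall x l, 0 < l < pi -> gint f x (- l) = 0 &
  forall e, 0 < e -> exists2 d : R, 0 < d & forall l, 0 < l < d -> l <= pi / 2 ->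
    sqint (fun t => tint f l t - f t) <= e].

Lemma normN_strip l : 0 < l < pi -> 0 < `|- l| < (pi : R).
Proof. by move=> /[dup] /andP[l0 _]; rewrite normrN gtr0_norm. Qed.

Lemma norm_strip l : 0 < l < pi -> 0 < `|l| < (pi : R).
Proof. by move=> /[dup] /andP[l0 _]; rewrite gtr0_norm. Qed.

Lemma half_strip l : 0 < l -> l <= pi / 2 -> 0 < l < (pi : R).
Proof. by move=> l0 lpi; rewrite l0; move: l0 lpi; clear; lra. Qed.

Lemma hardy_lines f : hardy_real R f -> exists F fpi, [/\ hardy_strip F,
  line_limit F 0 f, line_limit F pi fpi & ae_equal (fun t => (fpi t)^*) f].
Proof.
move=> [F [hF [h0 [fpi hpi ae]]]]; exists F, fpi; split => //.
  by apply/boundary_value_lower => // l lpi; exact: hardy_line_L2.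
by apply/boundary_value_upper => // l lpi; exact: hardy_line_L2.
Qed.

Lemma hardy_cauchy f : hardy_real R f -> cauchy_hardy f.
Proof.
move=> /hardy_lines[F [fpi [hF h0 hpi ae]]].
have rep x y (yp : 0 < `|y| < pi) := hardy_reproducing x hF h0 hpi ae yp.
have van x l : 0 < l < pi -> gint f x (- l) = 0.
  move=> lpi; rewrite rep ?normN_strip//.
  by case: ltP => //; rewrite oppr_gt0 => h; have /andP[/(lt_trans h)] := lpi; rewrite ltxx.
split => //; first exact: h0.1.
move=> e e0; have [d d0 hd] := h0.2 e e0; exists d => // l /andP[l0 ld] lp.
have lpi := half_strip l0 lp.
rewrite (@eq_sqint _ _ (fun t => F (t +i* l) - f t)); last first.
  by move=> t; rewrite /tint van// subr0 rep ?norm_strip// l0.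
by apply: hd => //; rewrite subr0 gtr0_norm.
Qed.

Lemma cauchy_hardy_tint f x l : cauchy_hardy f -> 0 < l < pi -> tint f l x = gint f x l.
Proof. by move=> [_ van _] lpi; rewrite /tint van// subr0. Qed.

Lemma cauchy_hardy_line f l : cauchy_hardy f -> 0 < l < pi ->
  L2 (gint f ^~ l) /\ sqint (gint f ^~ l) <= 25 * sqint f.
Proof.
move=> hf lpi; have [Lf van _] := hf; have /andP[l0 lp] := lpi.
case: (leP l (pi / 2)) => h.
  have l2 : 0 < l <= pi / 2 by rewrite l0.
  have [LT b] := tint_L2 Lf l2.
  by rewrite (_ : gint f ^~ l = tint f l) //; apply/funext => x; rewrite cauchy_hardy_tint.
have l0' : 0 < pi - l by rewrite subr_gt0.
have lp' : pi - l <= pi / 2 by move: h; clear; lra.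
have l2 : 0 < pi - l <= pi / 2 by rewrite l0'.
have [LT b] := tint_L2 Lf l2.
rewrite (_ : gint f ^~ l = fun x => (tint f (pi - l) x)^*%C).
  by split; [exact: L2J|rewrite sqintJ].
have lpi' := half_strip l0' lp'.
apply/funext => x; rewrite (cauchy_hardy_tint x hf lpi') -(gintJ x Lf lpi').
by congr gint; ring.
Qed.

(** For the converse the Cauchy integral is the analytic extension: [tint_L2] bounds
    it on the lines of the lower half of the strip, and the reflection [gintJ]
    carries the bound to the upper half and the limit at [0] to the limit at [pi]. *)
Lemma cauchy_hardyP f : hardy_real R f <-> cauchy_hardy f.
Proof.
split=> [|hf]; first exact: hardy_cauchy.
have [Lf van lim] := hf; have p0 := pi_gt0 R.
pose F w := gint f (complex.Re w) (complex.Im w).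
have hF : hardy_strip F.
  apply: (@hardy_strip_intro _ _ (25 * sqint f)) => [|l lpi]; last first.
    exact: cauchy_hardy_line.
  move=> [x y] /= ypi; apply/derivableP.
  by apply: cdiff_gint => //; rewrite gt_eqF// sin_gt0_pi.
have LF l (lpi : 0 < l < pi) := hardy_line_L2 hF lpi.
exists F; split => //; split.
  apply/(boundary_value_lower _ LF); split => // e e0; have [d d0 hd] := lim e e0.
  exists (Num.min d (pi / 2)); first by rewrite lt_min d0 divr_gt0.
  move=> l lpi; have /andP[l0 lp] := lpi; rewrite subr0 gtr0_norm// lt_min => /andP[ld l2].
  have := hd l _ (ltW l2); rewrite l0 ld => /(_ isT).
  by congr (_ <= _); apply: eq_sqint => t; rewrite cauchy_hardy_tint.
exists (fun t => (f t)^*); last by apply: ae_all => t; rewrite conjcK.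
apply/(boundary_value_upper _ LF); split; first exact: L2J.
move=> e e0; have [d d0 hd] := lim e e0.
exists (Num.min d (pi / 2)); first by rewrite lt_min d0 divr_gt0.
move=> l lpi; have /andP[l0 lp] := lpi.
have l0' : 0 < pi - l by rewrite subr_gt0.
rewrite distrC gtr0_norm// lt_min => /andP[ld l2].
have := hd (pi - l) _ (ltW l2); rewrite l0' ld => /(_ isT).
rewrite -sqintJ; congr (_ <= _); apply: eq_sqint => t.
have lpi' := half_strip l0' (ltW l2).
rewrite conjB (cauchy_hardy_tint t hf lpi') -(gintJ t Lf lpi') /F /=; congr (gint _ _ _ - _); ring.
Qed.

Lemma hardy_real_L2 f : hardy_real R f -> L2 f.
Proof. by move=> /cauchy_hardyP[]. Qed.

Lemma tint_lin r f g l x : L2 f -> L2 g -> 0 < l < pi ->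
  tint (fun t => r%:C * f t + g t) l x = r%:C * tint f l x + tint g l x.
Proof.
move=> Lf Lg lpi; rewrite /tint (gint_lin _ _ Lf Lg (norm_strip lpi)) (gint_lin _ _ Lf Lg (normN_strip lpi)).
by rewrite mulrBr opprD addrACA.
Qed.

Lemma tintB f g l x : L2 f -> L2 g -> 0 < l < pi ->
  tint (fun t => f t - g t) l x = tint f l x - tint g l x.
Proof.
move=> Lf Lg lpi; rewrite /tint (gintB _ Lf Lg (norm_strip lpi)) (gintB _ Lf Lg (normN_strip lpi)).
by move: (gint f x l) (gint g x l) (gint f x (- l)) (gint g x (- l)) => a b c d; ring.
Qed.

Lemma hardy_real_lin r f g : hardy_real R f -> hardy_real R g ->
  hardy_real R (fun t => r%:C * f t + g t).
Proof.
move=> /cauchy_hardyP[Lf vf lf] /cauchy_hardyP[Lg vg lg]; apply/cauchy_hardyP; split.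
- by apply: L2D => //; exact: L2Z.
- by move=> x l lpi; rewrite gint_lin ?normN_strip// vf// vg// mulr0 addr0.
move=> e e0; pose k := 2 * r ^+ 2 + 2.
have k0 : 0 < k by rewrite /k ltr_wpDl// mulr_ge0// sqr_ge0.
have [d1 d10 h1] := lf _ (divr_gt0 e0 k0); have [d2 d20 h2] := lg _ (divr_gt0 e0 k0).
exists (Num.min d1 d2); first by rewrite lt_min d10.
move=> l; rewrite lt_min => /and3P[l0 ld1 ld2] lp; have lpi := half_strip l0 lp.
have l2 : 0 < l <= pi / 2 by rewrite l0.
have [LT1 _] := tint_L2 Lf l2; have [LT2 _] := tint_L2 Lg l2.
have L1 := L2B LT1 Lf; have L2' := L2B LT2 Lg.
rewrite (@eq_sqint _ _ (fun t => r%:C * (tint f l t - f t) + (tint g l t - g t))); last first.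
  by move=> t; rewrite tint_lin//; ring.
apply: (le_trans (sqintD (L2Z r%:C L1) L2')).
rewrite (sqintZ _ L1) cmod_real real_normK ?num_real//.
have := h1 l _ lp; rewrite l0 ld1 => /(_ isT) b1.
have := h2 l _ lp; rewrite l0 ld2 => /(_ isT) b2.
rewrite (_ : e = 2 * (r ^+ 2 * (e / k)) + 2 * (e / k)).
  by rewrite lerD// ler_pM2l// ler_wpM2l// sqr_ge0.
rewrite mulrA -mulrDl -/k; field; exact: lt0r_neq0.
Qed.

(** [H] is closed in [L2]: the defining vanishing passes to limits because point
    evaluation of the Cauchy integral is bounded, and the boundary limit because the
    operators [tint] are uniformly bounded. *)
Lemma hardy_real_closed f : L2 f ->
  (forall e, 0 < e -> exists2 h, hardy_real R h & sqint (fun t => f t - h t) <= e) ->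
  hardy_real R f.
Proof.
move=> Lf app; apply/cauchy_hardyP; split => //.
- move=> x l lpi; apply/cmod_eq0/eqP; rewrite eq_le cmod_ge0 andbT.
  apply/ler_addgt0Pr => e e0; rewrite add0r.
  have [M M0 hM] := cmod_gint_le x (normN_strip lpi).
  have M1 : 0 < M + 1 by rewrite ltr_wpDl.
  have [h /cauchy_hardyP[Lh vh _] hfh] := app ((e / (M + 1)) ^+ 2) (exprn_gt0 2 (divr_gt0 e0 M1)).
  have := hM _ (L2B Lf Lh); rewrite gintB ?normN_strip// vh// subr0 => b.
  apply: (le_trans b); apply: (@le_trans _ _ (M * (e / (M + 1)))).
    rewrite ler_wpM2l// -[leRHS]ger0_norm ?divr_ge0 ?(ltW e0) ?(ltW M1)//.
    by rewrite -sqrtr_sqr ler_wsqrtr.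
  rewrite mulrCA ler_piMr ?(ltW e0)// ler_pdivrMr// mul1r.
  by move: M0; clear; lra.
(* [100] exceeds the total [2 * 25 + 2 * (2 + 2)] of the constants below *)
- move=> e e0; have e1 : 0 < e / 100 by rewrite divr_gt0.
  have [h /cauchy_hardyP[Lh _ lh] hfh] := app _ e1.
  have [d d0 hd] := lh _ e1; exists d => // l lld lp.
  have /andP[l0 _] := lld; have lpi := half_strip l0 lp.
  have l0p : 0 < l <= pi / 2 by rewrite l0.
  have Lfh := L2B Lf Lh; have [LT b] := tint_L2 Lfh l0p; have [LTh _] := tint_L2 Lh l0p.
  have Lth := L2B LTh Lh.
  rewrite (@eq_sqint _ _ (fun t => tint (fun s => f s - h s) l t +
     ((tint h l t - h t) - (f t - h t)))); last by move=> t; rewrite tintB//; ring.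
  have b1 := sqintD LT (L2B Lth Lfh); have b2 := sqintB Lth Lfh; have b3 := hd l lld lp.
  by apply: (le_trans b1); move: b b2 b3 hfh e0; clear; lra.
Qed.

End hardy_characterization.

(** * Completeness of the square integrable functions *)

Section riesz_fischer.
Context {R : realType}.
Local Notation C := R[i].
Local Notation mu := (@lebesgue_measure R).
Implicit Types (f g h : R -> C) (r e c : R) (n m j k : nat).

Lemma dyadic_real_cauchy (w : nat -> R) c : 0 <= c ->
  (forall n j, 2 ^+ n * (w (n + j)%N - w n) ^+ 2 <= c) -> cvgn w.
Proof.
move=> c0 h; apply/cauchy_cvgP/cauchy_exP => e e0.
have [n /(_ n (leqnn n)) hn] := geometric_small c0 (exprn_gt0 2 e0).
exists (w n), n => // m /= nm; rewrite /ball /= distrC -ltr_sqr ?nnegrE// ?(ltW e0)//.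
rewrite real_normK ?num_real//; apply: le_lt_trans hn.
by rewrite ler_pdivlMr ?exprn_gt0// mulrC -(subnKC nm).
Qed.

Lemma cmod_cvg (w : nat -> C) (l : C) :
  complex.Re (w n) @[n --> \oo] --> complex.Re l -> complex.Im (w n) @[n --> \oo] --> complex.Im l ->
  forall z : C, cmod (w n - z) ^+ 2 @[n --> \oo] --> cmod (l - z) ^+ 2.
Proof.
move=> h1 h2 z; rewrite sqr_cmod !ReB !ImB.
rewrite (_ : (fun n => _) = (fun n => (complex.Re (w n) - complex.Re z) ^+ 2 +
   (complex.Im (w n) - complex.Im z) ^+ 2)); last first.
  by apply/funext => n; rewrite sqr_cmod ReB ImB.
by apply: cvgD; rewrite !expr2; apply: cvgM; apply: cvgB => //; exact: cvg_cst.
Qed.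

Lemma dyadic_cauchy (w : nat -> C) c : 0 <= c ->
  (forall n j, 2 ^+ n * cmod (w (n + j)%N - w n) ^+ 2 <= c) ->
  exists l : C, [/\ complex.Re (w n) @[n --> \oo] --> complex.Re l,
    complex.Im (w n) @[n --> \oo] --> complex.Im l &
    forall n, 2 ^+ n * cmod (l - w n) ^+ 2 <= c].
Proof.
move=> c0 h.
have p n : 0 < 2 ^+ n :> R by rewrite exprn_gt0.
have c1 : cvgn (fun n => complex.Re (w n)).
  apply: (dyadic_real_cauchy c0) => n j; apply: le_trans (h n j).
  by rewrite ler_pM2l// sqr_cmod ReB lerDl sqr_ge0.
have c2 : cvgn (fun n => complex.Im (w n)).
  apply: (dyadic_real_cauchy c0) => n j; apply: le_trans (h n j).
  by rewrite ler_pM2l// sqr_cmod ImB lerDr sqr_ge0.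
exists (limn (fun n => complex.Re (w n)) +i* limn (fun n => complex.Im (w n))); split => //= n.
set l := _ +i* _; have := @cmod_cvg w l c1 c2 (w n) => hc.
rewrite mulrC -ler_pdivlMr//; apply: (cvgr_to_le hc).
by exists n => // m /= nm; rewrite ler_pdivlMr// mulrC -(subnKC nm).
Qed.

(** The dyadic weights absorb the factors [2] of the quadratic triangle inequality,
    so that no square roots are needed in the telescoping estimate. *)
Lemma dyadic_telescope (w : nat -> C) n j :
  2 ^+ n * cmod (w (n + j)%N - w n) ^+ 2 <=
  2 * \sum_(n <= k < n + j) 2 ^+ k * cmod (w k.+1 - w k) ^+ 2.
Proof.
elim: j n => [|j IH] n.
  by rewrite addn0 subrr cmod0 expr0n/= mulr0 mulr_ge0// sumr_ge0// => k _;
     rewrite mulr_ge0 ?exprn_ge0 ?cmod_ge0.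
rewrite -addSnnS big_ltn ?leq_addr// mulrDr.
have := IH n.+1; have := sqr_cmodD_le (w (n.+1 + j)%N - w n.+1) (w n.+1 - w n).
rewrite addrA subrK [2 ^+ n.+1]exprS => h1 h2.
apply: (@le_trans _ _ (2 ^+ n * (2 * cmod (w (n.+1 + j)%N - w n.+1) ^+ 2 + 2 * cmod (w n.+1 - w n) ^+ 2))).
  by rewrite ler_pM2l// exprn_gt0.
move: h2; set S := \sum_(_ <= _ < _) _; move: (2 ^+ n) (_ ^+ 2) (_ ^+ 2) S; clear => a b c S.
lra.
Qed.

(** The weighted series [\sum_k 2 ^ k |u k.+1 - u k| ^ 2] has a finite integral,
    so it is finite almost everywhere; there [dyadic_telescope] makes the sequence
    Cauchy and bounds its distance to the limit by a multiple of the series. *)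
Lemma riesz_fischer (u : nat -> R -> C) : (forall n, L2 (u n)) ->
  (forall n, sqint (fun t => u n.+1 t - u n t) <= (4 ^+ n)^-1) ->
  exists2 f, L2 f & forall e, 0 < e -> exists N, forall n, (N <= n)%N ->
    sqint (fun t => f t - u n t) <= e.
Proof.
move=> Lu du.
pose a k t := 2 ^+ k * cmod (u k.+1 t - u k t) ^+ 2.
have a0 k t : 0 <= a k t by rewrite mulr_ge0 ?exprn_ge0 ?cmod_ge0.
have Ld k : L2 (fun t => u k.+1 t - u k t) by exact: L2B.
have ia k : rintegrable setT (a k) by have /L2P[_ h] := Ld k; exact: rintegrableZ.
pose G t := (\sum_(k <oo) (a k t)%:E)%E.
have G0 t : (0 <= G t)%E by apply: nneseries_ge0 => k _ _; rewrite lee_fin.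
have mG : measurable_fun setT G.
  apply: ge0_emeasurable_sum => [k t _ _|k _]; first by rewrite lee_fin.
  by apply/measurable_EFinP; exact: rintegrable_measurable (ia k).
have GE : (\int[mu]_t G t <= 2%:E)%E.
  rewrite integral_nneseries//; last 2 first.
  - by move=> k; apply/measurable_EFinP; exact: rintegrable_measurable (ia k).
  - by move=> k t _; rewrite lee_fin.
  apply: lime_le.
    by apply: is_cvg_nneseries => k _ _; apply: integral_ge0 => t _; rewrite lee_fin.
  apply: nearW => n; rewrite (eq_bigr (fun k => (\int[mu]_t a k t)%:E)); last first.
    by move=> k _; rewrite RintegralE.
  rewrite sumEFin lee_fin; apply: (@le_trans _ _ (\sum_(0 <= k < n) (2 ^+ k)^-1)).
    apply: ler_sum => k _; have /L2P[_ h] := Ld k.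
    rewrite /a (RintegralZr' _ measurableT h) -/(sqint _).
    apply: (le_trans (ler_wpM2l (exprn_ge0 _ _) (du k))) => //.
    rewrite (_ : 4 = 2 * 2) ?exprMn; last by ring.
    by rewrite invfM mulrA divff ?mul1r// expf_neq0.
  have -> : \sum_(0 <= k < n) (2 ^+ k)^-1 = 2 - 2 * (2 ^+ n)^-1 :> R.
    elim: n => [|n IH]; first by rewrite big_geq// expr0; field.
    by rewrite big_nat_recr//= IH exprS invfM; field; rewrite expf_neq0.
  by rewrite lerBlDr lerDl mulr_ge0// invr_ge0 exprn_ge0.
pose A := [set t | (G t < +oo)%E].
have mA : measurable A.
  by have := emeasurable_fun_infty_o measurableT mG +oo%E; rewrite setTI.
have aeA : {ae mu, forall t, A t}.
  have iG : mu.-integrable setT G.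
    apply/integrableP; split => //; apply: le_lt_trans (ltry 2).
    by under eq_integral do rewrite gee0_abs//.
  have := integrable_ae measurableT iG; apply: ae_imp => t /(_ I).
  by rewrite ge0_fin_numE.
pose g t := \1_A t * fine (G t).
have GA t : A t -> G t = (fine (G t))%:E by move=> At; rewrite fineK// ge0_fin_numE.
have gE t : ((g t)%:E <= G t)%E.
  rewrite /g indicE; case: (boolP (t \in A)) => [|_]; last by rewrite mul0r.
  by rewrite inE => At; rewrite mul1r -GA.
have g0 t : 0 <= g t by rewrite mulr_ge0// fine_ge0.
have ig : rintegrable setT g.
  apply: rintegrable_ge0 => //.
    by apply: measurable_funM => //; exact: measurableT_comp mG.
  apply: le_lt_trans (ltry 2); apply: le_trans GE; apply: le_integral_ge0 => //.
  apply/measurable_EFinP; apply: measurable_funM => //; exact: measurableT_comp mG.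
pose v n t := (\1_A t)%:C * u n t.
have vu n : ae_equal (v n) (u n).
  move: aeA; apply: ae_imp => t At; rewrite /v indicE mem_set// mul1r.
  by [].
have Lv n : L2 (v n).
  have /L2P[mu_ iu] := Lu n; apply: (L2_le _ iu).
    by apply: cmeasurableM => //; exact: cmeasurable_real.
  move=> t; rewrite /v cmodM cmod_real indicE exprMn.
  by case: (_ \in _); rewrite ?normr1 ?normr0 ?expr1n ?mul1r// expr0n/= mul0r sqr_ge0.
have bv t n j : 2 ^+ n * cmod (v (n + j)%N t - v n t) ^+ 2 <= 2 * g t.
  rewrite /v -mulrBr cmodM cmod_real exprMn /g indicE.
  case: (boolP (t \in A)) => [|_]; last by rewrite normr0 expr0n/= !mul0r !mulr0.
  rewrite inE => At; rewrite normr1 expr1n !mul1r.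
  apply: (le_trans (dyadic_telescope (u ^~ t) n j)); rewrite ler_pM2l//.
  rewrite -lee_fin -GA// -sumEFin.
  apply: (@le_trans _ _ (\sum_(0 <= k < n + j) (a k t)%:E)%E).
    rewrite [leRHS](big_cat_nat (leq0n n) (leq_addr j n))/= leeDr//.
    by apply: sume_ge0 => k _; rewrite lee_fin.
  by apply: nneseries_lim_ge => k _ _; rewrite lee_fin.
have lim t := dyadic_cauchy (mulr_ge0 (ler0n _ 2) (g0 t)) (bv t).
pose f t := projT1 (cid (lim t)).
have f1 t : complex.Re (v n t) @[n --> \oo] --> complex.Re (f t) by rewrite /f; case: cid => l /= [].
have f2 t : complex.Im (v n t) @[n --> \oo] --> complex.Im (f t) by rewrite /f; case: cid => l /= [].
have f3 t n : 2 ^+ n * cmod (f t - v n t) ^+ 2 <= 2 * g t.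
  by rewrite /f; case: cid => l /= [].
have mf : cmeasurable setT f.
  split.
    apply: (@measurable_fun_cvg _ _ _ _ (fun n t => complex.Re (v n t))) => [n|t _]; last exact: f1.
    exact: (L2_cmeasurable (Lv n)).1.
  apply: (@measurable_fun_cvg _ _ _ _ (fun n t => complex.Im (v n t))) => [n|t _]; last exact: f2.
  exact: (L2_cmeasurable (Lv n)).2.
have f4 n t : cmod (f t - v n t) ^+ 2 <= 2 / 2 ^+ n * g t.
  by rewrite mulrAC ler_pdivlMr ?exprn_gt0// mulrC.
have Lfv n : L2 (fun t => f t - v n t).
  apply: (L2_le _ (rintegrableZ (2 / 2 ^+ n) measurableT ig) (f4 n)).
  by apply: cmeasurableB => //; exact: L2_cmeasurable.
have Lf : L2 f.
  have := L2D (Lfv 0%N) (Lv 0%N); congr L2; apply/funext => t; exact: subrK.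
exists f => // e e0.
have I0 : 0 <= 2 * \int[mu]_t g t by rewrite mulr_ge0// Rintegral_ge0.
have [N hN] := geometric_small I0 e0; exists N => n /hN hn.
rewrite (@ae_equal_sqint _ _ (fun t => f t - v n t)).
- apply: (le_trans (sqint_le (Lfv n) (rintegrableZ _ measurableT ig) (f4 n))).
  by rewrite (RintegralZr' _ measurableT ig) mulrAC ltW.
- by move: (vu n); apply: ae_imp => t ->.
- exact: L2B.
- exact: Lfv.
Qed.

End riesz_fischer.

(** * Projection onto a closed real subspace *)

Section real_projection.
Context {R : realType}.
Local Notation C := R[i].
Local Notation mu := (@lebesgue_measure R).
Implicit Types (f g h psi : R -> C) (r e c : R) (n : nat) (H : set (R -> C)).

Lemma innerE f g : inner f g = cint setT (fun t => (f t)^*%C * g t).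
Proof. by []. Qed.

Lemma innerDr f g h : L2 f -> L2 g -> L2 h ->
  inner f (fun t => g t + h t) = inner f g + inner f h.
Proof.
move=> Lf Lg Lh; rewrite !innerE -(cintD measurableT (L2_mul (L2J Lf) Lg) (L2_mul (L2J Lf) Lh)).
by apply: eq_cint => t _; rewrite mulrDr.
Qed.

Lemma innerZr (c : C) f g : L2 f -> L2 g -> inner f (fun t => c * g t) = c * inner f g.
Proof.
move=> Lf Lg; rewrite !innerE -(cintZ c measurableT (L2_mul (L2J Lf) Lg)).
by apply: eq_cint => t _; rewrite mulrCA.
Qed.

Lemma innerBr f g h : L2 f -> L2 g -> L2 h ->
  inner f (fun t => g t - h t) = inner f g - inner f h.
Proof.
move=> Lf Lg Lh; rewrite !innerE -(cintB measurableT (L2_mul (L2J Lf) Lg) (L2_mul (L2J Lf) Lh)).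
by apply: eq_cint => t _; rewrite mulrBr.
Qed.

Lemma Re_innerC f g : complex.Re (inner f g) = complex.Re (inner g f).
Proof. by apply: eq_Rintegral => t _; rewrite !ReM !ReJ !ImJ; ring. Qed.

Lemma Re_inner_self f : complex.Re (inner f f) = sqint f.
Proof. by apply: eq_Rintegral => t _; rewrite ReM ReJ ImJ sqr_cmod; ring. Qed.

Lemma Re_inner_le f g : L2 f -> L2 g ->
  `|complex.Re (inner f g)| <= Num.sqrt (sqint f * sqint g).
Proof.
move=> Lf Lg; apply: (le_trans (Re_le_cmod _)); rewrite innerE -(sqintJ f).
by apply: cmod_cint_mul_le => //; exact: L2J.
Qed.

Lemma sqint_line f g r : L2 f -> L2 g -> sqint (fun t => f t + r%:C * g t) =
  sqint f + 2 * r * complex.Re (inner g f) + r ^+ 2 * sqint g.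
Proof.
move=> Lf Lg; have i1 := (L2_mul (L2J Lg) Lf).1.
have /L2P[_ i0] := Lf; have /L2P[_ i2] := Lg.
have j1 := rintegrableZ (2 * r) measurableT i1.
have j2 := rintegrableZ (r ^+ 2) measurableT i2.
rewrite {2 3}/sqint -(RintegralZr' (2 * r) measurableT i1) -(RintegralZr' (r ^+ 2) measurableT i2).
rewrite -(RintegralDr measurableT i0 j1).
rewrite -(RintegralDr measurableT (rintegrableD measurableT i0 j1) j2).
apply: eq_Rintegral => t _; rewrite !sqr_cmod !(ReD, ImD, ReM, ImM, ReJ, ImJ) /=; ring.
Qed.

Lemma quadratic_bound (a d s : R) : 0 <= s -> (forall r, 0 <= d + 2 * r * a + r ^+ 2 * s) ->
  a ^+ 2 <= d * (s + 1).
Proof.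
move=> s0 h; have s1 : 0 < s + 1 by rewrite ltr_wpDl.
(* [s + 1] instead of [s] in the minimizer, to cover [s = 0] *)
have := h (- a / (s + 1)); rewrite -ler_pdivrMr//.
rewrite (_ : d + _ + _ = d - a ^+ 2 / (s + 1) - a ^+ 2 / (s + 1) ^+ 2).
  have : 0 <= a ^+ 2 / (s + 1) ^+ 2 by rewrite divr_ge0 ?sqr_ge0.
  by move: (a ^+ 2 / (s + 1) ^+ 2) (a ^+ 2 / (s + 1)) => p q; clear; lra.
by field; exact: lt0r_neq0.
Qed.

Definition closed_real_subspace H := [/\ H `<=` L2, H (fun=> 0),
  (forall r f g, H f -> H g -> H (fun t => r%:C * f t + g t)) &
  (forall f, L2 f -> (forall e, 0 < e -> exists2 h, H h & sqint (fun t => f t - h t) <= e) -> H f)].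

(** Moving from [f] in the direction [h] cannot bring the distance to [psi] below
    its infimum. *)
Lemma almost_orthogonal H psi f h (d : R) : closed_real_subspace H -> L2 psi ->
  (forall k, H k -> d <= sqint (fun t => psi t - k t)) -> H f -> H h ->
  complex.Re (inner h (fun t => psi t - f t)) ^+ 2 <=
  (sqint (fun t => psi t - f t) - d) * (sqint h + 1).
Proof.
move=> [HL _ Hlin _] Lpsi inf Hf Hh; have Lf := HL _ Hf; have Lh := HL _ Hh.
apply: quadratic_bound; first exact: sqint_ge0.
move=> r; have E := sqint_line r (L2B Lpsi Lf) Lh.
rewrite (_ : _ + _ + _ = sqint (fun t => psi t - f t + r%:C * h t) - d); last by rewrite E; ring.
rewrite subr_ge0.
 have := inf _ (Hlin (- r) h f Hh Hf); congr (_ <= _).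
by apply: eq_sqint => t; rewrite rmorphN /=; ring.
Qed.

(** The parallelogram identity, since the midpoint of [f] and [g] is a competitor. *)
Lemma minimizing_cauchy H psi f g (d e : R) : closed_real_subspace H -> L2 psi ->
  (forall k, H k -> d <= sqint (fun t => psi t - k t)) -> H f -> H g ->
  sqint (fun t => psi t - f t) <= d + e -> sqint (fun t => psi t - g t) <= d + e ->
  sqint (fun t => f t - g t) <= 4 * e.
Proof.
move=> [HL _ Hlin _] Lpsi inf Hf Hg bf bg; have Lf := HL _ Hf; have Lg := HL _ Hg.
have Lpf := L2B Lpsi Lf; have Lpg := L2B Lpsi Lg.
have Hm := Hlin (1/2) _ _ (Hlin (-1) _ _ Hg Hf) Hg.
have := inf _ Hm.
have E1 := sqint_line (-1) Lpf Lpg; have E2 := sqint_line 1 Lpf Lpg.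
have -> : sqint (fun t => psi t - ((1 / 2)%:C * ((-1)%:C * g t + f t) + g t)) =
   4^-1 * sqint (fun t => psi t - f t + 1%:C * (psi t - g t)).
  rewrite (_ : 4^-1 = cmod ((1/2)%:C : C) ^+ 2); last first.
    by rewrite cmod_real ger0_norm ?divr_ge0//; field.
  rewrite -sqintZ; last by apply: L2D => //; exact: L2Z.
  apply: eq_sqint => t; apply: complex_eq; rewrite !(ReD, ImD, ReB, ImB, ReN, ImN, ReM, ImM) /=; by field.
have -> : sqint (fun t => f t - g t) = sqint (fun t => psi t - f t + (-1)%:C * (psi t - g t)).
  by rewrite -sqintN; apply: eq_sqint => t; rewrite rmorphN1; ring.
rewrite E1 E2; move: bf bg; clear.
move: (sqint _) (sqint _) (complex.Re _) => a b c; lra.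
Qed.

(** A minimizing sequence is Cauchy by [minimizing_cauchy], and the almost
    orthogonality of its members passes to the limit. *)
Lemma projection_exists H psi : closed_real_subspace H -> L2 psi ->
  exists2 f, H f & forall h, H h -> complex.Re (inner h (fun t => psi t - f t)) = 0.
Proof.
move=> cH Lpsi; have [HL H0 Hlin Hcl] := cH.
pose S := [set sqint (fun t => psi t - k t) | k in H].
have S0 : has_inf S.
  split; first by exists (sqint (fun t => psi t - 0)); exists (fun=> 0).
  by exists 0 => _ [k _ <-]; exact: sqint_ge0.
have inf k : H k -> inf S <= sqint (fun t => psi t - k t).
  by move=> Hk; apply: ge_inf; [exact: S0.2|exists k].
(* the factor [4] of [minimizing_cauchy] turns this into the rate of [riesz_fischer] *)
pose ep n : R := (4 ^+ n.+1)^-1.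
have ep0 n : 0 < ep n by rewrite invr_gt0 exprn_gt0.
have ex n : exists k, H k /\ sqint (fun t => psi t - k t) <= reals.inf S + ep n.
  have [_ [k Hk <-] hk] := inf_adherent (ep0 n) S0.
  by exists k; split => //; exact: ltW.
pose u n := projT1 (cid (ex n)).
have Hu n : H (u n) by rewrite /u; case: cid => k /= [].
have bu n : sqint (fun t => psi t - u n t) <= reals.inf S + ep n by rewrite /u; case: cid => k /= [].
have epS n : ep n.+1 <= ep n.
  by rewrite lef_pV2 ?posrE ?exprn_gt0// ler_eXn2l// ltr1n.
have du n : sqint (fun t => u n.+1 t - u n t) <= (4 ^+ n)^-1.
  have h1 : sqint (fun t => psi t - u n.+1 t) <= reals.inf S + ep n.
    by apply: (le_trans (bu _)); rewrite lerD2l.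
  apply: (le_trans (minimizing_cauchy cH Lpsi inf (Hu _) (Hu n) h1 (bu n))).
  by rewrite /ep exprS invfM mulrA divff// mul1r.
have [f Lf cf] := riesz_fischer (fun n => HL _ (Hu n)) du.
have Hf : H f.
  apply: Hcl => // e e0; have [N hN] := cf e e0.
  by exists (u N); [exact: Hu|exact: hN].
exists f => // h Hh; have Lh := HL _ Hh.
set a := complex.Re _; pose s := sqint h + 1.
have s0 : 0 < s by rewrite /s ltr_wpDl// sqint_ge0.
apply/eqP; rewrite -normr_le0; apply/ler_addgt0Pr => e e0; rewrite add0r.
pose q := (e / 2) ^+ 2 / s.
have q0 : 0 < q by rewrite divr_gt0// exprn_gt0// divr_gt0.
have [N1 h1] := cf q q0.
have [N2 h2] := geometric_small ler01 q0.
pose n := maxn N1 N2; have Lu := HL _ (Hu n).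
have hn : sqint (fun t => f t - u n t) <= q by apply: h1; rewrite leq_maxl.
have en : ep n <= q.
  apply: (le_trans _ (ltW (h2 n _))); last by rewrite leq_maxr.
  rewrite mul1r lef_pV2 ?posrE ?exprn_gt0// exprS.
  apply: (@le_trans _ _ (4 ^+ n)); first by rewrite lerXn2r ?nnegrE// ler_nat.
  by rewrite ler_peMl ?exprn_ge0// ler1n.
have sq (x : R) : x ^+ 2 <= q * s -> `|x| <= e / 2.
  rewrite divfK ?lt0r_neq0// => hx; rewrite -ler_sqr ?nnegrE ?divr_ge0 ?(ltW e0)//.
  by rewrite real_normK ?num_real.
have b1 : `|complex.Re (inner h (fun t => psi t - u n t))| <= e / 2.
  apply: sq; apply: (le_trans (almost_orthogonal cH Lpsi inf (Hu n) Hh)).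
  rewrite ler_wpM2r ?(ltW s0)// lerBlDl (le_trans (bu n))// lerD2l//.
have b2 : `|complex.Re (inner h (fun t => f t - u n t))| <= e / 2.
  apply: sq; rewrite -real_normK ?num_real//.
  have := Re_inner_le Lh (L2B Lf Lu); rewrite -ler_sqr ?nnegrE ?sqrtr_ge0// => h'.
  apply: (le_trans h'); rewrite sqr_sqrtr ?mulr_ge0 ?sqint_ge0// mulrC.
  apply: ler_pM; rewrite ?sqint_ge0//.
  by rewrite /s lerDl.
have -> : a = complex.Re (inner h (fun t => psi t - u n t)) - complex.Re (inner h (fun t => f t - u n t)).
  rewrite /a -ReB -(innerBr Lh (L2B Lpsi Lu) (L2B Lf Lu)); congr (complex.Re (inner _ _)).
  by apply/funext => t; ring.
apply: (le_trans (ler_normB _ _)); rewrite (_ : e = e / 2 + e / 2); last by field.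
exact: lerD.
Qed.

Lemma projection_norm H psi f : closed_real_subspace H -> L2 psi -> H f ->
  (forall h, H h -> complex.Re (inner h (fun t => psi t - f t)) = 0) -> sqint f <= sqint psi.
Proof.
move=> [HL _ _ _] Lpsi Hf orth; have Lf := HL _ Hf; have Ld := L2B Lpsi Lf.
rewrite (@eq_sqint _ psi (fun t => f t + 1%:C * (psi t - f t))); last by move=> t; ring.
rewrite (sqint_line 1 Lf Ld) Re_innerC orth// mulr0 addr0 expr1n mul1r.
by rewrite lerDl sqint_ge0.
Qed.

Lemma projection_unique H psi f g : closed_real_subspace H -> L2 psi -> H f -> H g ->
  (forall h, H h -> complex.Re (inner h (fun t => psi t - f t)) = 0) ->
  (forall h, H h -> complex.Re (inner h (fun t => psi t - g t)) = 0) -> ae_equal f g.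
Proof.
move=> cH Lpsi Hf Hg of_ og; have [HL _ Hlin _] := cH; have Lf := HL _ Hf; have Lg := HL _ Hg.
have E : (fun t => f t - g t) = (fun t => (-1)%:C * g t + f t).
  by apply/funext => t; rewrite rmorphN1; ring.
have Hfg : H (fun t => f t - g t) by rewrite E; exact: Hlin.
have Lfg := HL _ Hfg.
have : sqint (fun t => f t - g t) = 0.
  rewrite -Re_inner_self -[RHS](subrr 0) -{1}(og _ Hfg) -(of_ _ Hfg).
  rewrite -ReB -(innerBr Lfg (L2B Lpsi Lg) (L2B Lpsi Lf)); congr (complex.Re (inner _ _)).
  by apply/funext => t; ring.
move/(sqint_eq0 Lfg); apply: ae_imp => t /eqP; rewrite subr_eq0 => /eqP.
by [].
Qed.

End real_projection.

(** * Evaluation functionals on the real Hardy space *)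

Section pole_functions.
Context {R : realType}.
Local Notation C := R[i].
Local Notation mu := (@lebesgue_measure R).
Implicit Types (F G : C -> C) (f g : R -> C) (x y l e : R) (k c : C).

Lemma line_limitD F G (l0 : R) f g :
  (forall l, 0 < l < pi -> L2 (horizontal_line F l)) ->
  (forall l, 0 < l < pi -> L2 (horizontal_line G l)) ->
  line_limit F l0 f -> line_limit G l0 g ->
  line_limit (fun w => F w + G w) l0 (fun t => f t + g t).
Proof.
move=> LF LG [Lf hf] [Lg hg]; split; first exact: L2D.
move=> e e0; have e4 : 0 < e / 4 by rewrite divr_gt0.
have [d1 d10 h1] := hf _ e4; have [d2 d20 h2] := hg _ e4.
exists (Num.min d1 d2); first by rewrite lt_min d10.
move=> l lpi; rewrite lt_min => /andP[ld1 ld2].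
have := h1 l lpi ld1; have := h2 l lpi ld2.
have := sqintD (L2B (LF l lpi) Lf) (L2B (LG l lpi) Lg).
rewrite (@eq_sqint _ _ (fun t => F (t +i* l) + G (t +i* l) - (f t + g t))).
  by clear; rewrite /horizontal_line; lra.
by move=> t; rewrite /horizontal_line; ring.
Qed.

(** The argument stays away from [0] and [pi], and the sine is smallest at an end
    point. *)
Lemma sin_half_lower y : 0 < y < pi -> exists2 a : R, 0 < a &
  forall l, 0 <= l <= pi -> a <= sin ((l + y) / 2).
Proof.
move=> /andP[y0 ypi]; have p0 := pi_gt0 R.
have mono u v : 0 < u -> u <= v -> v <= pi / 2 -> sin u <= sin v :> R.
  move=> u0 uv vp; rewrite le_eqVlt in uv; case/orP: uv => [/eqP ->//|uv].
  rewrite ltW// ltr_sin// in_itv /=; apply/andP; split; move: u0 uv vp; clear; lra.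
exists (Num.min (sin (y / 2)) (sin ((pi - y) / 2))).
  by rewrite lt_min !sin_gt0_pi//; apply/andP; split; move: y0 ypi p0; clear; lra.
move=> l /andP[l0 lpi]; rewrite ge_min; case: (leP ((l + y) / 2) (pi / 2)) => h.
  by rewrite mono//; move: y0 l0; clear; lra.
apply/orP; right; have -> : sin ((l + y) / 2) = sin (- ((l + y) / 2) + pi).
  by rewrite sinDpi sinN opprK.
by apply: mono; move: y0 ypi lpi h; clear; lra.
Qed.

(** For [0 < y < pi] the poles nearest to the strip are [x0 - i y] and
    [x0 + i (2 pi - y)], one beyond each edge. *)
Definition pole k x0 y (w : C) : C := k * ker (complex.Re w - x0) (complex.Im w + y).

Lemma pole_lines k x0 y : 0 < y < pi -> exists2 M : R, 0 <= M & forall l, 0 <= l <= pi ->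
  L2 (fun t => pole k x0 y (t +i* l)) /\ sqint (fun t => pole k x0 y (t +i* l)) <= M.
Proof.
move=> ypi; have [a a0 ha] := sin_half_lower ypi; have p0 := pi_ge0 R.
exists (cmod k ^+ 2 * (2 * pi / a ^+ 2)).
  by rewrite mulr_ge0 ?sqr_ge0// divr_ge0 ?sqr_ge0// mulr_ge0.
move=> l lpi; have hl := ha l lpi; have sl := lt_le_trans a0 hl.
have [L b] := ker_shift_L2 x0 (lt0r_neq0 sl).
split; first exact: L2Z.
rewrite (sqintZ k L) ler_wpM2l ?sqr_ge0//; apply: (le_trans b).
rewrite ler_wpM2l ?mulr_ge0// lef_pV2 ?posrE ?exprn_gt0//.
by rewrite ler_sqr ?nnegrE// ltW.
Qed.

Lemma pole_line_limit k x0 y l0 : 0 < y < pi -> 0 <= l0 <= pi ->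
  line_limit (pole k x0 y) l0 (fun t => pole k x0 y (t +i* l0)).
Proof.
move=> ypi l0pi; have [a a0 ha] := sin_half_lower ypi; have p0 := pi_ge0 R.
have [M M0 LM] := pole_lines k x0 ypi; split; first exact: (LM _ l0pi).1.
move=> e e0; pose q := cmod k ^+ 2 * (2 * pi) / (a * a) ^+ 2.
have q0 : 0 <= q by rewrite divr_ge0 ?sqr_ge0// mulr_ge0 ?sqr_ge0// mulr_ge0.
have q1 : 0 < q + 1 by rewrite ltr_wpDl.
exists (Num.min 1 (e / (q + 1))); first by rewrite lt_min ltr01 divr_gt0.
move=> l /andP[ll lp]; rewrite lt_min => /andP[d1 d2].
have lpi : 0 <= l <= pi by rewrite (ltW ll) (ltW lp).
have hl := ha l lpi; have sl := lt_le_trans a0 hl.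
have hl0 := ha l0 l0pi; have sl0 := lt_le_trans a0 hl0.
have [L b] := ker_shift_L2 x0 (lt0r_neq0 sl); have [L0 b0] := ker_shift_L2 x0 (lt0r_neq0 sl0).
rewrite (@eq_sqint _ _ (fun t => k * (ker (t - x0) (l + y) - ker (t - x0) (l0 + y)))); last first.
  by move=> t; rewrite /pole /=; ring.
rewrite (sqintZ k (L2B L L0)).
apply: (@le_trans _ _ (q * `|l - l0| ^+ 2)); last first.
  apply: (@le_trans _ _ (q * `|l - l0|)).
    by rewrite ler_wpM2l// expr2 ler_piMl// ltW.
  apply: (@le_trans _ _ (q * (e / (q + 1)))); first by rewrite ler_wpM2l// ltW.
  rewrite mulrCA ler_piMr ?(ltW e0)// ler_pdivrMr// mul1r.
  by rewrite lerDl.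
have an0 : a != 0 by rewrite lt0r_neq0.
rewrite (_ : q * _ = cmod k ^+ 2 * (2 * pi * (`|l - l0| / (a * a)) ^+ 2)); last first.
  by rewrite /q; field.
rewrite ler_wpM2l ?sqr_ge0//.
apply: (le_trans (ker_shift_lip x0 (lt0r_neq0 sl) (lt0r_neq0 sl0))).
have -> : l + y - (l0 + y) = l - l0 by ring.
rewrite ler_wpM2l ?mulr_ge0//.
have aa : 0 < a * a by rewrite mulr_gt0.
rewrite ler_sqr ?nnegrE ?divr_ge0 ?mulr_ge0 ?(ltW a0)//.
rewrite ler_wpM2l// lef_pV2 ?posrE// ?mulr_gt0 ?normr_gt0 ?lt0r_neq0//.
by apply: ler_pM; rewrite ?(ltW a0) ?(gtr0_norm sl) ?(gtr0_norm sl0).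
Qed.

Lemma cdiff_pole k x0 y x l : 0 < y < pi -> 0 < l < pi ->
  exists d, cdiff (pole k x0 y) (x +i* l) d.
Proof.
move=> ypi /andP[l0 lpi]; have [a a0 ha] := sin_half_lower ypi.
have sl : 0 < sin ((l + y) / 2) by apply: lt_le_trans a0 (ha l _); rewrite (ltW l0) ltW.
have [d hd] : exists d, cdiff (kerz (x0 +i* (- y))) (x +i* l) d.
  apply: cdiff_kerz.
  have -> : (x +i* l) - (x0 +i* (- y)) = (x - x0) +i* (l + y) :> C.
    by apply: complex_eq; rewrite /= ?opprK.
  by rewrite half_complex; apply: csinh_neq0; rewrite lt0r_neq0.
have -> : pole k x0 y = (fun w => k * kerz (x0 +i* (- y)) w).
  by apply/funext => w; rewrite /pole /kerz /= opprK.
by exists (0 * kerz (x0 +i* - y) (x +i* l) + k * d); apply: cdiffM => //; exact: cdiff_cst.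
Qed.

(** For [0 < y0 < pi] its restriction to the real line is the element of [H] that
    represents the real functional [f |-> Re (c * gint f x0 y0)]. The second pole
    is the mirror image that makes the upper edge conjugate to the lower one. *)
Definition evaluator c x0 y0 (w : C) : C :=
  pole ('i%C / (4 * pi)%:C * c^*%C) x0 y0 w + pole ('i%C / (4 * pi)%:C * c) x0 (pi - y0) w.

Lemma evaluator_conj c x0 y0 t : (evaluator c x0 y0 (t +i* pi))^*%C = evaluator c x0 y0 (t +i* 0).
Proof.
have kJ := conj_i_div (4 * pi : R); rewrite /evaluator /pole /=.
move: ('i%C / (4 * pi)%:C) kJ => k kJ; rewrite conjD !conjM conjcK kJ !kerJ !mulNr.
have E1 : ker (t - x0) (- (pi + y0)) = - ker (t - x0) (0 + (pi - y0)) :> C.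
  by rewrite -[LHS]opprK -(kerD2pi (t - x0) (- (pi + y0))); congr (- _); congr ker; ring.
have E2 : ker (t - x0) (- (pi + (pi - y0))) = - ker (t - x0) (0 + y0) :> C.
  by rewrite -[LHS]opprK -(kerD2pi (t - x0) (- (pi + (pi - y0)))); congr (- _); congr ker; ring.
by rewrite E1 E2 !mulrN !opprK addrC.
Qed.

Lemma hardy_evaluator c x0 y0 : 0 < y0 < pi ->
  hardy_real R (fun t => evaluator c x0 y0 (t +i* 0)).
Proof.
move=> ypi; have /andP[yy yp] := ypi.
have ypi' : 0 < pi - y0 < pi by rewrite subr_gt0 yp gtrBl.
set k1 := 'i%C / (4 * pi)%:C * c^*%C; set k2 := 'i%C / (4 * pi)%:C * c.
have [M1 M10 h1] := pole_lines k1 x0 ypi; have [M2 M20 h2] := pole_lines k2 x0 ypi'.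
have cl l : 0 < l < pi -> 0 <= l <= pi by move=> /andP[/ltW -> /ltW ->].
have z0 : 0 <= (0 : R) <= pi by rewrite lexx pi_ge0.
have zp : 0 <= (pi : R) <= pi by rewrite lexx pi_ge0.
have hF : hardy_strip (evaluator c x0 y0).
  apply: (@hardy_strip_intro _ _ (2 * M1 + 2 * M2)) => [|l /cl lpi].
    move=> [x y] /= xy; apply/derivableP.
    have [d1 e1] := cdiff_pole k1 x0 x ypi xy; have [d2 e2] := cdiff_pole k2 x0 x ypi' xy.
    by exists (d1 + d2); exact: cdiffD.
  have [L1 b1] := h1 l lpi; have [L2' b2] := h2 l lpi; split; first exact: L2D.
  by apply: (le_trans (sqintD L1 L2')); move: b1 b2; clear; lra.
have LF l (lpi : 0 < l < pi) := hardy_line_L2 hF lpi.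
have lim l0 : 0 <= l0 <= pi -> line_limit (evaluator c x0 y0) l0 (fun t => evaluator c x0 y0 (t +i* l0)).
  move=> l0pi; apply: line_limitD; last 2 first.
  - exact: pole_line_limit.
  - exact: pole_line_limit.
  - by move=> l /cl lpi; exact: (h1 l lpi).1.
  - by move=> l /cl lpi; exact: (h2 l lpi).1.
exists (evaluator c x0 y0); split => //; split.
  by apply/(boundary_value_lower _ LF); exact: lim.
exists (fun t => evaluator c x0 y0 (t +i* pi)).
  by apply/(boundary_value_upper _ LF); exact: lim.
by apply: ae_all => t; rewrite evaluator_conj.
Qed.

(** Conjugating the second summand of the inner product leaves its real part
    unchanged and produces the conjugate linear half of [gint]. *)
Lemma inner_evaluator c x0 y0 f : 0 < y0 < pi -> L2 f ->
  complex.Re (inner (fun t => evaluator c x0 y0 (t +i* 0)) f) = complex.Re (c * gint f x0 y0).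
Proof.
move=> ypi Lf; have /andP[yy yp] := ypi; rewrite innerE.
have ny : 0 < `|y0| < pi by rewrite gtr0_norm.
have s0 := sin_half_neq0_strip ny.
have s1 : sin ((y0 + pi) / 2) != 0 by apply: sin_half_addpi_neq0; rewrite gtr0_norm.
have K0 := ker_refl_L2 x0 s0; have K1 := ker_refl_L2 x0 s1.
pose k := 'i%C / (4 * pi)%:C : C.
have i0 := L2_mul Lf K0.
have j1 := cintegrableJ measurableT (L2_mul (L2J Lf) K1).
rewrite (@eq_cint _ _ _ (fun t => k * c * (f t * ker (x0 - t) y0) +
    (k * c)^*%C * ((f t)^*%C * ker (x0 - t) (y0 + pi))^*%C)); last first.
  have kJ : k^*%C = - k := conj_i_div (4 * pi).
  move=> t _; rewrite /evaluator /pole /= !add0r -/k; move: k kJ => k kJ.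
  rewrite conjD !conjM !conjcK kJ !kerJ.
  rewrite [ker _ (- y0)]ker_reflect.
  have -> : ker (t - x0) (- (pi - y0)) = ker (x0 - t) (- (y0 + pi)) :> C.
    by rewrite ker_reflect -[RHS]opprK -(kerD2pi (x0 - t) (- (y0 + pi))); congr (- _); congr ker; ring.
  by ring.
rewrite (cintD measurableT (cintegrableZ _ measurableT i0) (cintegrableZ _ measurableT j1)).
rewrite (cintZ _ measurableT i0) (cintZ _ measurableT j1) (cintJ measurableT (L2_mul (L2J Lf) K1)).
rewrite -conjM ReD ReJ -ReD; congr complex.Re; rewrite /gint /cauchy_int -/k; ring.
Qed.

Lemma hardy_closed_subspace : closed_real_subspace (hardy_real R).
Proof.
have L0 : L2 (fun=> 0 : C).
  have ypi : 0 < @pi R / 2 < pi by have := pi_gt0 R => p0; apply/andP; split; move: p0; clear; lra.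
  have L := hardy_real_L2 (hardy_evaluator 0 0 ypi).
  by have := L2B L L; congr L2; apply/funext => t; exact: subrr.
split.
- exact: hardy_real_L2.
- have ypi : 0 < @pi R / 2 < pi by have := pi_gt0 R => p0; apply/andP; split; move: p0; clear; lra.
  have Hk := hardy_evaluator 0 0 ypi.
  by have := hardy_real_lin (-1) Hk Hk; congr hardy_real; apply/funext => t; rewrite rmorphN1; ring.
- by move=> r f g; exact: hardy_real_lin.
- by move=> f; exact: hardy_real_closed.
Qed.

(** Orthogonality to the evaluators with [c = 1] and [c = i] determines both parts
    of the value of the Cauchy integral. *)
Lemma projection_gint psi f x y : L2 psi -> hardy_real R f ->
  (forall h, hardy_real R h -> complex.Re (inner h (fun t => psi t - f t)) = 0) ->
  0 < y < pi -> gint f x y = gint psi x y.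
Proof.
move=> Lpsi Hf orth ypi; have Lf := hardy_real_L2 Hf.
have E c : complex.Re (c * gint f x y) = complex.Re (c * gint psi x y).
  have := orth _ (hardy_evaluator c x ypi).
  rewrite (inner_evaluator c x ypi (L2B Lpsi Lf)) (gintB _ Lpsi Lf (norm_strip ypi)) mulrBr ReB.
  by move/eqP; rewrite subr_eq0 => /eqP.
have E1 := E 1; have Ei := E 'i%C; rewrite !mul1r in E1.
apply: complex_eq => //; move: Ei; rewrite !ReM /=; rewrite !mul0r !mul1r !sub0r.
exact: oppr_inj.
Qed.

End pole_functions.

(** * Poisson averages at Lebesgue points *)

Section lebesgue_points.
Context {R : realType}.
Local Notation C := R[i].
Local Notation mu := (@lebesgue_measure R).
Implicit Types (f : R -> C) (g : R -> R) (x s r a u l e : R) (k K : nat).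

(** A step majorant, up to a factor 4, of [a ^ 2 / (u ^ 2 + a ^ 2)] with
    [u = x - s]; its integrals only involve averages over balls. *)
Definition dyadic x a K s : R := \sum_(k < K.+1) (4 ^+ k)^-1 * \1_(ball x (2 ^+ k * a)) s.

Lemma indic_ball_ge0 x r s : 0 <= \1_(ball x r) s :> R.
Proof. by rewrite indicE; case: (_ \in _). Qed.

Lemma dyadic_ge0 x a K s : 0 <= dyadic x a K s.
Proof.
by apply: sumr_ge0 => k _; rewrite mulr_ge0 ?indic_ball_ge0// invr_ge0 exprn_ge0.
Qed.

Lemma dyadicS x a K s : dyadic x a K.+1 s =
  dyadic x a K s + (4 ^+ K.+1)^-1 * \1_(ball x (2 ^+ K.+1 * a)) s.
Proof. by rewrite /dyadic big_ord_recr. Qed.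

Lemma dyadic_ge x a K s : 0 < a -> `|x - s| < 2 ^+ K * a ->
  a ^+ 2 / ((x - s) ^+ 2 + a ^+ 2) <= 4 * dyadic x a K s.
Proof.
move=> a0; have a20 : 0 < a ^+ 2 by rewrite exprn_gt0.
elim: K => [|K IH] h.
  have -> : dyadic x a 0 s = 1.
    by rewrite /dyadic big_ord1 expr0 invr1 mul1r indicE mem_set//; rewrite expr0 in h.
  rewrite mulr1; apply: (@le_trans _ _ 1); last by rewrite ler1n.
  by rewrite ler_pdivrMr ?mul1r ?lerDr ?sqr_ge0// ltr_wpDl// sqr_ge0.
rewrite dyadicS mulrDr; case: (ltP `|x - s| (2 ^+ K * a)) => h'.
  by apply: (le_trans (IH h')); rewrite lerDl mulr_ge0// mulr_ge0 ?indic_ball_ge0// invr_ge0 exprn_ge0.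
apply: (@le_trans _ _ ((4 ^+ K)^-1)); last first.
  rewrite indicE mem_set// mulr1 exprS invfM mulrA divff// mul1r lerDr.
  by rewrite mulr_ge0// dyadic_ge0.
have -> : (4 ^+ K)^-1 = a ^+ 2 / (2 ^+ K * a) ^+ 2.
  rewrite exprMn -exprM mulnC exprM (_ : 2 ^+ 2 = 4); last by ring.
  by rewrite invfM mulrCA divff ?mulr1// lt0r_neq0.
have p2 : 0 < 2 ^+ K * a by rewrite mulr_gt0// exprn_gt0.
rewrite ler_pM2l// lef_pV2 ?posrE ?exprn_gt0//; last by rewrite ltr_wpDl// sqr_ge0.
rewrite -(real_normK (num_real (x - s))).
apply: (@le_trans _ _ (`|x - s| ^+ 2)); last by rewrite lerDl ltW.
by rewrite ler_sqr ?nnegrE// ltW.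
Qed.

Lemma rintegrable_dyadic x a K g : (forall r, rintegrable setT (fun s => \1_(ball x r) s * g s)) ->
  rintegrable setT (fun s => dyadic x a K s * g s) /\
  forall eta, 0 <= eta -> 0 <= a ->
   (forall k, (k <= K)%N -> \int[mu]_s (\1_(ball x (2 ^+ k * a)) s * g s) <= eta * (2 ^+ k * a)) ->
   \int[mu]_s (dyadic x a K s * g s) <= 2 * eta * a.
Proof.
move=> ib.
have E k : rintegrable setT (fun s => dyadic x a k s * g s) /\ \int[mu]_s (dyadic x a k s * g s) =
    \sum_(j < k.+1) (4 ^+ j)^-1 * \int[mu]_s (\1_(ball x (2 ^+ j * a)) s * g s).
  elim: k => [|k [IH1 IH2]].
    rewrite big_ord1 expr0 mul1r invr1 mul1r.
    have E0 : (fun s => dyadic x a 0 s * g s) = (fun s => \1_(ball x a) s * g s).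
      by apply/funext => s; rewrite /dyadic big_ord1 expr0 mul1r invr1 mul1r.
    by rewrite E0.
  have E1 : (fun s => dyadic x a k.+1 s * g s) = (fun s => dyadic x a k s * g s +
     (4 ^+ k.+1)^-1 * (\1_(ball x (2 ^+ k.+1 * a)) s * g s)).
    by apply/funext => s; rewrite dyadicS mulrDl mulrA.
  have i2 := rintegrableZ (4 ^+ k.+1)^-1 measurableT (ib (2 ^+ k.+1 * a)).
  rewrite E1; split; first exact: rintegrableD.
  rewrite (RintegralDr measurableT IH1 i2) (RintegralZr' _ measurableT (ib _)) IH2.
  by rewrite [in RHS]big_ord_recr.
split; first exact: (E K).1.
move=> eta eta0 a0 h; rewrite (E K).2.
apply: (@le_trans _ _ (\sum_(j < K.+1) eta * a * (2 ^+ j)^-1)).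
  apply: ler_sum => j _.
  apply: (@le_trans _ _ ((4 ^+ j)^-1 * (eta * (2 ^+ j * a)))).
    by rewrite ler_wpM2l ?invr_ge0 ?exprn_ge0// h// -ltnS.
  rewrite (_ : 4 = 2 * 2) ?exprMn; last by ring.
  rewrite le_eqVlt; apply/orP; left; apply/eqP; field.
  by rewrite expf_neq0.
rewrite -mulr_sumr.
have -> : \sum_(j < K.+1) (2 ^+ j)^-1 = 2 - (2 ^+ K)^-1 :> R.
  elim: K {h} => [|k IH]; first by rewrite big_ord1 expr0; field.
  by rewrite big_ord_recr/= IH exprS; field; rewrite expf_neq0.
have -> : 2 * eta * a = eta * a * 2 by ring.
by rewrite ler_wpM2l ?mulr_ge0// gerBl invr_ge0 exprn_ge0.
Qed.

Lemma rcosh_le_expR u : rcosh u <= expR `|u|.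
Proof.
rewrite /rcosh ler_pdivrMr//.
have h1 : expR u <= expR `|u| by rewrite ler_expR ler_norm.
have h2 : expR (- u) <= expR `|u| by rewrite ler_expR -normrN ler_norm.
by move: h1 h2; clear; lra.
Qed.

Lemma pois_near a u : 0 < a -> `|u| <= 2 -> pois a u <= 4 * expR 1 * (a / (u ^+ 2 + a ^+ 2)).
Proof.
move=> a0 u2; have a20 : 0 < a ^+ 2 by rewrite exprn_gt0.
have d0 : 0 < u ^+ 2 + a ^+ 2 by rewrite ltr_wpDl// sqr_ge0.
have s2 : (u / 2) ^+ 2 <= rsinh (u / 2) ^+ 2.
  rewrite -(real_normK (num_real (u / 2))) -(real_normK (num_real (rsinh (u / 2)))).
  by rewrite ler_sqr ?nnegrE// le_norm_rsinh.
have c1 : rcosh (u / 2) <= expR 1.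
  apply: (le_trans (rcosh_le_expR _)); rewrite ler_expR normrM [`|2^-1|]ger0_norm//.
  by rewrite ler_pdivrMr// mul1r.
have -> : pois a u = rcosh (u / 2) * (a / (rsinh (u / 2) ^+ 2 + a ^+ 2)) by rewrite /pois mulrA.
have -> : 4 * expR 1 * (a / (u ^+ 2 + a ^+ 2)) = expR 1 * (4 * (a / (u ^+ 2 + a ^+ 2))) by ring.
apply: ler_pM => //.
- exact: ltW (rcosh_gt0 _).
- by rewrite divr_ge0 ?(ltW a0)// addr_ge0 ?sqr_ge0.
rewrite mulrCA ler_pM2l// ler_pdivlMr// mulrC ler_pdivrMr; last by rewrite ltr_wpDl// sqr_ge0.
have -> : u ^+ 2 = 4 * (u / 2) ^+ 2 by field.
by move: s2 a20; clear; lra.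
Qed.

Lemma pois_far a u d : 0 < a -> 0 < d -> d <= `|u| ->
  pois a u <= (1 + 4 / d ^+ 2) * a * rho u.
Proof.
move=> a0 d0 du; have a20 : 0 < a ^+ 2 by rewrite exprn_gt0.
have d20 : 0 < d ^+ 2 by rewrite exprn_gt0.
have s2 : (d / 2) ^+ 2 <= rsinh (u / 2) ^+ 2.
  rewrite -(real_normK (num_real (rsinh (u / 2)))).
  rewrite ler_sqr ?nnegrE// ?divr_ge0 ?(ltW d0)//.
  apply: le_trans (le_norm_rsinh _); rewrite normrM [`|2^-1|]ger0_norm//.
  by rewrite ler_pM2r.
have S0 : 0 < rsinh (u / 2) ^+ 2 by apply: lt_le_trans s2; rewrite exprn_gt0// divr_gt0.
have c0 := rcosh_gt0 (u / 2).
rewrite /pois /rho ler_pdivrMr ?ltr_wpDl ?sqr_ge0//.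
have -> : rcosh (u / 2) * a = rcosh (u / 2) ^+ 2 * (a / rcosh (u / 2)).
  by move: (rcosh (u / 2)) (lt0r_neq0 c0) => c cn0; field.
have -> : (1 + 4 / d ^+ 2) * a / rcosh (u / 2) * (rsinh (u / 2) ^+ 2 + a ^+ 2) =
  ((1 + 4 / d ^+ 2) * (rsinh (u / 2) ^+ 2 + a ^+ 2)) * (a / rcosh (u / 2)) by ring.
rewrite (sqr_rcosh (u / 2)) (ler_pM2r (divr_gt0 a0 c0)).
have h : 1 <= 4 / d ^+ 2 * rsinh (u / 2) ^+ 2.
  rewrite mulrAC ler_pdivlMr// mul1r.
  by move: s2; rewrite (_ : (d / 2) ^+ 2 = d ^+ 2 / 4); [move: (d ^+ 2); clear => ?; lra|field].
have h' : 0 <= (1 + 4 / d ^+ 2) * a ^+ 2.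
  by rewrite mulr_ge0 ?(ltW a20)// addr_ge0// divr_ge0// ltW.
rewrite mulrDr mulrDl mul1r; move: h h'; move: (4 / d ^+ 2 * _) (_ * a ^+ 2) => p q.
by clear; lra.
Qed.

Lemma dyadic_scale a d : 0 < a < d -> exists K, d / 2 <= 2 ^+ K * a /\ 2 ^+ K * a < d.
Proof.
move=> /andP[a0 ad].
have ex : exists k, d <= 2 ^+ k * a.
  have [N /(_ N (leqnn N)) h] := geometric_small (ltW (lt_trans a0 ad)) a0.
  by exists N; rewrite ltW// mulrC -ltr_pdivrMr ?exprn_gt0.
case: (ex_minnP ex) => [[|k] hk mk]; first by move: hk; rewrite expr0 mul1r leNgt ad.
exists k; split; last by rewrite ltNge; apply/negP => /mk; rewrite ltnn.
by rewrite ler_pdivrMr// mulrAC -exprSr.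
Qed.

(** The step majorant serves up to the largest dyadic radius below [d]; beyond, the
    Poisson kernel is of order [a] times the integrable kernel [rho]. *)
Lemma pois_majorant a d x : 0 < a < d -> d <= 1 -> exists2 K, 2 ^+ K * a < d & forall s,
  pois a (x - s) <= 16 * expR 1 / a * dyadic x a K s + (1 + 16 / d ^+ 2) * a * rho (x - s).
Proof.
move=> ad d1; have [K [K1 K2]] := dyadic_scale ad; have /andP[a0 lad] := ad.
have d0 := lt_trans a0 lad; exists K => // s.
have r0 : 0 <= (1 + 16 / d ^+ 2) * a * rho (x - s).
  by rewrite mulr_ge0 ?rho_ge0// mulr_ge0 ?(ltW a0)// addr_ge0// divr_ge0 ?sqr_ge0.
have n0 : 0 <= 16 * expR 1 / a * dyadic x a K s.
  by rewrite mulr_ge0 ?dyadic_ge0// divr_ge0 ?(ltW a0)// mulr_ge0// expR_ge0.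
case: (ltP `|x - s| (2 ^+ K * a)) => h.
  apply: (@le_trans _ _ (16 * expR 1 / a * dyadic x a K s)); last by rewrite lerDl.
  apply: (le_trans (pois_near a0 _)).
    by rewrite ltW// (lt_trans h)// (lt_le_trans K2)// (le_trans d1)// ler1n.
  have := dyadic_ge a0 h.
  have -> : 16 * expR 1 / a * dyadic x a K s = (4 * expR 1 / a) * (4 * dyadic x a K s) by ring.
  have -> : 4 * expR 1 * (a / ((x - s) ^+ 2 + a ^+ 2)) =
    (4 * expR 1 / a) * (a ^+ 2 / ((x - s) ^+ 2 + a ^+ 2)).
    by field; rewrite (lt0r_neq0 a0) lt0r_neq0// ltr_wpDl ?sqr_ge0 ?exprn_gt0.
  by move=> h'; rewrite ler_pM2l// divr_gt0// mulr_gt0// expR_gt0.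
have d20 : 0 < d / 2 by rewrite divr_gt0.
apply: (le_trans (pois_far a0 d20 (le_trans K1 h))).
rewrite (_ : 4 / (d / 2) ^+ 2 = 16 / d ^+ 2); last by field; exact: lt0r_neq0.
by rewrite lerDr.
Qed.

(** Ordinary averages control Poisson averages, through [pois_majorant]. *)
Lemma poisson_average_small g x : (forall s, 0 <= g s) ->
  (forall r, rintegrable setT (fun s => \1_(ball x r) s * g s)) ->
  rintegrable setT (fun s => rho (x - s) * g s) ->
  (forall eta, 0 < eta -> exists2 d : R, 0 < d & forall r, 0 < r < d ->
     \int[mu]_s (\1_(ball x r) s * g s) <= eta * r) ->
  forall e, 0 < e -> exists2 d : R, 0 < d & forall a, 0 < a < d ->
    rintegrable setT (fun s => pois a (x - s) * g s) ->
    \int[mu]_s (pois a (x - s) * g s) <= e.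
Proof.
move=> g0 ib ir leb e e0; have E0 := expR_gt0 (1 : R).
(* the dyadic part of the majorant contributes [32 * expR 1 * eta = e / 2] *)
pose eta := e / (64 * expR 1).
have eta0 : 0 < eta by rewrite divr_gt0// mulr_gt0.
have [d1 d10 h1] := leb eta eta0; pose d := Num.min 1 d1.
have d0 : 0 < d by rewrite lt_min ltr01.
have dle1 : d <= 1 by rewrite ge_min lexx.
pose c := (1 + 16 / d ^+ 2) * \int[mu]_s (rho (x - s) * g s).
have c0 : 0 <= c.
  rewrite mulr_ge0//; first by rewrite addr_ge0// divr_ge0// sqr_ge0.
  by apply: Rintegral_ge0 => s _; rewrite mulr_ge0// rho_ge0.
exists (Num.min d (e / 2 / (c + 1))).
  by rewrite lt_min d0 !divr_gt0// ltr_wpDl.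
move=> a; rewrite lt_min => /and3P[a0 ad ac] ip.
have [K Kd maj] := pois_majorant x (ltac:(rewrite a0; exact: ad) : 0 < a < d) dle1.
have [iD hD] := rintegrable_dyadic a K ib.
have i1 := rintegrableZ (16 * expR 1 / a) measurableT iD.
have i2 := rintegrableZ ((1 + 16 / d ^+ 2) * a) measurableT ir.
apply: (@le_trans _ _ (16 * expR 1 / a * (2 * eta * a) + c * a)).
  apply: (@le_trans _ _ (\int[mu]_s (16 * expR 1 / a * (dyadic x a K s * g s) +
     (1 + 16 / d ^+ 2) * a * (rho (x - s) * g s)))).
    apply: Rintegral_le => //; first exact: rintegrableD.
    by move=> s _; rewrite !mulrA -mulrDl ler_wpM2r// -!mulrA !mulrA; exact: maj.
  rewrite (RintegralDr measurableT i1 i2) (RintegralZr' _ measurableT iD) (RintegralZr' _ measurableT ir).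
  apply: lerD; last by rewrite /c mulrAC.
  rewrite ler_wpM2l ?divr_ge0 ?(ltW a0) ?mulr_ge0 ?(ltW E0)//.
  apply: hD; [exact: ltW|exact: ltW|move=> k kK].
  apply: h1; rewrite mulr_gt0 ?exprn_gt0//=.
  apply: le_lt_trans (lt_le_trans Kd _); last by rewrite ge_min lexx orbT.
  by rewrite ler_wpM2r ?(ltW a0)// ler_weXn2l// ler1n.
have -> : 16 * expR 1 / a * (2 * eta * a) = e / 2.
  by rewrite /eta; field; rewrite (lt0r_neq0 a0) lt0r_neq0.
have : c * a <= e / 2.
  apply: (@le_trans _ _ (c * (e / 2 / (c + 1)))); first by rewrite ler_wpM2l// ltW.
  rewrite mulrCA ler_piMr ?divr_ge0 ?(ltW e0)// ler_pdivrMr ?ltr_wpDl// mul1r.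
  by rewrite lerDl.
by clear; lra.
Qed.

End lebesgue_points.

(** * Boundary values almost everywhere *)

Section ae_convergence.
Context {R : realType}.
Local Notation C := R[i].
Local Notation mu := (@lebesgue_measure R).
Implicit Types (f : R -> C) (h : R -> R) (x s r a u l e : R).

Lemma rintegrable_cst_finite (D : set R) (c : R) : measurable D -> (mu D < +oo)%E ->
  rintegrable D (fun=> c).
Proof.
move=> mD fD; have h : rintegrable D (fun=> 1).
  apply: rintegrable_ge0 => //; rewrite integral_cst// mul1e.
  by [].
have := rintegrableZ c mD h; apply: eq_rintegrable => // t _.
by rewrite mulr1.
Qed.

Lemma cmod_le_sqr (z : C) : cmod z <= 1 + cmod z ^+ 2.
Proof.
by have := sqr_ge0 (cmod z - 1); have := cmod_ge0 z; move: (cmod z) => c; clear; rewrite !expr2; lra.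
Qed.

Lemma L2_locally_integrable f h : L2 f -> measurable_fun setT h ->
  (forall t, `|h t| <= cmod (f t)) -> locally_integrable setT h.
Proof.
move=> /L2P[mf if2] mh hf; split => //; first exact: openT.
move=> K _ cK; have mK := compact_measurable cK; have fK := compact_finite_measure cK.
have i1 := rintegrable_cst_finite 1 mK fK.
have i2 := rintegrableS measurableT mK (@subsetT _ K) if2.
have ih : rintegrable K h.
  apply: (rintegrable_le mK _ (rintegrableD mK i1 i2)); first exact: measurable_funS mh.
  by move=> t _; apply: (le_trans (hf t)); exact: cmod_le_sqr.
by move/integrableP : ih => [_]; apply: le_lt_trans; rewrite le_eqVlt; apply/orP; left; apply/eqP.
Qed.

Lemma lebesgue_pt_small h x : locally_integrable setT h -> lebesgue_pt h x ->
  (forall r, rintegrable setT (fun s => \1_(ball x r) s * `|h s - h x|)) ->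
  forall eta, 0 < eta -> exists2 d : R, 0 < d & forall r, 0 < r < d ->
     \int[mu]_s (\1_(ball x r) s * `|h s - h x|) <= eta * r.
Proof.
move=> lh /fine_cvgP[_ /cvgrPdist_le lim] ib eta eta0.
have [d /= d0 hd] := lim _ (divr_gt0 eta0 (ltr0Sn _ 1)).
exists d => // r /andP[r0 rd].
have := hd r; rewrite /= sub0r normrN gtr0_norm// => /(_ rd r0).
have E : (\int[mu]_(y in ball x r) `|(center (h x) \o h) y|%:E =
          (\int[mu]_s (\1_(ball x r) s * `|h s - h x|))%:E)%E.
  rewrite -(RintegralE measurableT (ib r)) integral_mkcond; apply: eq_integral => s _.
  by rewrite patchE indicE /=; case: ifP => _; rewrite ?mul1r ?mul0r.
rewrite /davg /iavg /= E lebesgue_measure_ball ?(ltW r0)// inver.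
rewrite mulrn_eq0/= gt_eqF//= sub0r normrN ger0_norm; last first.
  rewrite mulr_ge0 ?invr_ge0 ?mulrn_wge0 ?(ltW r0)//; apply: Rintegral_ge0 => s _.
  by rewrite mulr_ge0 ?indic_ball_ge0.
rewrite mulrC ler_pdivrMr ?mulrn_wgt0// => h'; apply: (le_trans h').
by rewrite (_ : eta / 2 * (r *+ 2) = eta * r)//; rewrite -mulr_natr; field.
Qed.

Lemma cint_complex_of_real h : cint setT (fun t => (h t)%:C) = (\int[mu]_t h t)%:C.
Proof. by apply: complex_eq => //=; rewrite Rintegral_cst//= mul0r. Qed.

Lemma rintegrable_rho_cmod x f : L2 f -> rintegrable setT (fun s => rho (x - s) * cmod (f s)).
Proof.
move=> Lf; have := cintegrable_cmod measurableT (L2_mul Lf (rho_shift_L2 x)).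
apply: eq_rintegrable => // s _; rewrite cmodM cmod_real mulrC ger0_norm//.
exact: rho_ge0.
Qed.

(** Both [pk] having mass one and the regular part of [tint] being of order [l]
    enter here. *)
Lemma tint_dist_le f l x : L2 f -> 0 < l <= pi / 2 ->
  rintegrable setT (fun s => pois (sin (l / 2)) (x - s) * cmod (f s - f x)) /\
  cmod (tint f l x - f x) <= \int[mu]_s (pois (sin (l / 2)) (x - s) * cmod (f s - f x)) +
     l * \int[mu]_s (rho (x - s) * cmod (f s)).
Proof.
move=> Lf lpi2; have p0 := pi_gt0 R.
have /andP[l0 lp2] := lpi2; have lpi := half_strip l0 lp2; have s0 := sin_half_gt0 lpi.
have /andP[_ lp] := lpi.
have Lpk := pk_L2 x lpi.
have ipk : rintegrable setT (fun s => pk l (x - s)) /\ \int[mu]_s pk l (x - s) = 1.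
  rewrite (_ : (fun s => pk l (x - s)) = (fun s => pk l (s - x))); first exact: rintegrable_pk.
  by apply/funext => s; rewrite /pk -poisN opprB.
have pk0 s : 0 <= pk l (x - s).
  by rewrite /pk mulr_ge0 ?pois_ge0// invr_ge0 mulr_ge0// ltW.
have i0 : cintegrable setT (fun s => f x * (pk l (x - s))%:C).
  apply: cintegrableZ => //; apply: (cintegrable_le _ _ ipk.1) => //.
    exact: L2_cmeasurable Lpk.
  by move=> s _; rewrite cmod_real ger0_norm.
have i1 := L2_mul Lf Lpk; have i2 := cintegrableB measurableT i1 i0.
have iP : rintegrable setT (fun s => pois (sin (l / 2)) (x - s) * cmod (f s - f x)).
  have := rintegrableZ (2 * pi) measurableT (cintegrable_cmod measurableT i2).
  apply: eq_rintegrable => // s _; rewrite -mulrBl cmodM cmod_real ger0_norm// /pk.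
  by move: (pois _ _) (cmod _) (lt0r_neq0 p0) => p q; move: (pi : R) => P P0; field.
split => //; rewrite tintE//.
have s1 : sin ((l + pi) / 2) != 0 by apply: sin_half_addpi_neq0; rewrite ger0_norm// ltW.
have s2 : sin ((- l + pi) / 2) != 0.
  by apply: sin_half_addpi_neq0; rewrite normrN ger0_norm// ltW.
have i3 := L2_mul (L2J Lf) (L2B (ker_refl_L2 x s1) (ker_refl_L2 x s2)).
have fxE : f x = cint setT (fun s => f x * (pk l (x - s))%:C).
  rewrite (cintZ _ measurableT); first by rewrite cint_complex_of_real ipk.2 mulr1.
  apply: (cintegrable_le _ _ ipk.1) => //; first exact: L2_cmeasurable Lpk.
  by move=> s _; rewrite cmod_real ger0_norm.
rewrite {1}fxE addrAC -(cintB measurableT i1 i0); apply: (le_trans (cmodD _ _)); apply: lerD.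
  apply: (le_trans (cmod_cint_le measurableT i2)); apply: Rintegral_le => //.
    exact: cintegrable_cmod.
  move=> s _; rewrite -mulrBl cmodM cmod_real ger0_norm// mulrC ler_wpM2r ?cmod_ge0// /pk.
  rewrite ler_piMl ?pois_ge0// invf_le1 ?mulr_gt0//.
  by have := pihalf_ge1 R; clear; lra.
have c4 : cmod ('i%C / (4 * pi)%:C : C) = (4 * pi)^-1.
  by rewrite cmodM cmodi mul1r cmodV cmod_real ger0_norm// mulr_ge0// ltW.
have ir := rintegrable_rho_cmod x Lf.
rewrite cmodM c4; apply: (@le_trans _ _ ((4 * pi)^-1 * (4 * l * \int[mu]_s (rho (x - s) * cmod (f s))))).
  rewrite ler_pM2l ?invr_gt0 ?mulr_gt0//; apply: (le_trans (cmod_cint_le measurableT i3)).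
  rewrite -(RintegralZr' _ measurableT ir); apply: Rintegral_le => //.
  - exact: cintegrable_cmod.
  - exact: rintegrableZ.
  move=> s _; rewrite cmodM cmodJ mulrC mulrA ler_wpM2r ?cmod_ge0//.
  exact: ker_addpi_dist.
have I0 : 0 <= l * \int[mu]_s (rho (x - s) * cmod (f s)).
  by rewrite mulr_ge0 ?(ltW l0)// Rintegral_ge0// => s _; rewrite mulr_ge0 ?rho_ge0 ?cmod_ge0.
rewrite mulrC ler_pdivrMr ?mulr_gt0//; have := pihalf_ge1 R.
rewrite -mulrA; move: (l * _) I0 => I I0 p1; rewrite mulrCA ler_pM2l// ler_peMr//.
by move: p1; clear; lra.
Qed.

(** Fatou's theorem for the strip: [tint] converges at every common Lebesgue point
    of the real and the imaginary part of [f]. *)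
Lemma tint_cvg_ae f : L2 f -> {ae mu, forall x, forall e, 0 < e ->
  exists2 d : R, 0 < d & forall l, 0 < l < d -> cmod (tint f l x - f x) <= e}.
Proof.
move=> Lf; have /L2P[[m1 m2] if2] := Lf.
have l1 := L2_locally_integrable Lf m1 (fun t => Re_le_cmod _).
have l2 := L2_locally_integrable Lf m2 (fun t => Im_le_cmod _).
have := ae_and (lebesgue_differentiation l1) (lebesgue_differentiation l2).
apply: ae_imp => x [lx1 lx2] e e0.
pose g s := cmod (f s - f x).
have g0 s : 0 <= g s by exact: cmod_ge0.
have mg : measurable_fun setT g.
  apply: cmeasurable_cmod; apply: cmeasurableB; first exact: L2_cmeasurable.
  exact: cmeasurable_cst.
have mball r : measurable (ball x r) by exact: measurable_ball.
have ib1 r : rintegrable setT (\1_(ball x r) : R -> R).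
  apply: rintegrable_ge0 => //.
  have fin : (mu (ball x r) < +oo)%E.
    case: (leP 0 r) => r0; first by rewrite lebesgue_measure_ball// ltry.
    by rewrite (ball0 _ _).2 ?measure0 ?ltry// ltW.
  have -> : (fun t => (\1_(ball x r) t)%:E) = ((fun=> 1%:E) \_ (ball x r) : R -> \bar R).
    by apply/funext => t; rewrite patchE indicE; case: ifP.
  by rewrite -integral_mkcond (RintegralE (mball r) (rintegrable_cst_finite 1 (mball r) fin)) ltry.
have ibg r : rintegrable setT (fun s => \1_(ball x r) s * g s).
  have i1 := rintegrableD measurableT if2 (rintegrableZ (1 + cmod (f x)) measurableT (ib1 r)).
  apply: (rintegrable_le measurableT _ i1); first exact: measurable_funM.
  move=> s _; rewrite indicE; case: (_ \in _); last first.
    by rewrite mul0r normr0 mulr0 addr0 sqr_ge0.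
  rewrite mul1r mulr1 ger0_norm//; apply: (le_trans (cmodB _ _)).
  by have := cmod_le_sqr (f s); move: (cmod (f s)) (cmod (f s) ^+ 2) (cmod (f x)) => p q r'; clear; lra.
have sub h r : measurable_fun setT h -> (forall s, `|h s - h x| <= g s) ->
    rintegrable setT (fun s => \1_(ball x r) s * `|h s - h x|).
  move=> mh hg; apply: (rintegrable_le measurableT _ (ibg r)).
    apply: measurable_funM => //; apply: measurableT_comp => //.
    exact: measurable_funB.
  by move=> s _; rewrite ger0_norm ?mulr_ge0 ?indic_ball_ge0// ler_wpM2l ?indic_ball_ge0.
have r1 s : `|complex.Re (f s) - complex.Re (f x)| <= g s by rewrite -ReB; exact: Re_le_cmod.
have r2 s : `|complex.Im (f s) - complex.Im (f x)| <= g s by rewrite -ImB; exact: Im_le_cmod.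
have ir : rintegrable setT (fun s => rho (x - s) * g s).
  have i1 := rintegrable_rho_cmod x Lf; have i2 : rintegrable setT (fun s => rho (x - s)).
    have := rintegrable_rho x; apply: eq_rintegrable => // s _.
    by rewrite -rhoN opprB.
  have i3 := rintegrableD measurableT i1 (rintegrableZ (cmod (f x)) measurableT i2).
  apply: (rintegrable_le measurableT _ i3).
    apply: measurable_funM => //; exact: rintegrable_measurable i2.
  move=> s _; rewrite ger0_norm ?mulr_ge0 ?rho_ge0// [cmod (f x) * _]mulrC -mulrDr.
  by rewrite ler_wpM2l ?rho_ge0//; exact: cmodB.
have leb eta : 0 < eta -> exists2 d : R, 0 < d & forall r, 0 < r < d ->
     \int[mu]_s (\1_(ball x r) s * g s) <= eta * r.
  move=> eta0; have eta2 : 0 < eta / 2 by rewrite divr_gt0.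
  have [d1 d10 h1] := lebesgue_pt_small l1 lx1 (fun r => sub _ r m1 r1) eta2.
  have [d2 d20 h2] := lebesgue_pt_small l2 lx2 (fun r => sub _ r m2 r2) eta2.
  exists (Num.min d1 d2); first by rewrite lt_min d10.
  move=> r; rewrite lt_min => /and3P[r0 rd1 rd2].
  have j1 := sub _ r m1 r1; have j2 := sub _ r m2 r2.
  have b1 : 0 < r < d1 by rewrite r0. have b2 : 0 < r < d2 by rewrite r0.
  rewrite (_ : eta * r = eta / 2 * r + eta / 2 * r); last by field.
  apply: (le_trans _ (lerD (h1 r b1) (h2 r b2))).
  rewrite -(RintegralDr measurableT j1 j2); apply: Rintegral_le => //; first exact: rintegrableD.
  move=> s _; rewrite -mulrDr ler_wpM2l ?indic_ball_ge0//.
  by rewrite -ReB -ImB; exact: cmod_le_ReIm.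
have e2 : 0 < e / 2 by rewrite divr_gt0.
have [d d0 hd] := poisson_average_small g0 ibg ir leb e2.
pose I := \int[mu]_s (rho (x - s) * cmod (f s)).
have I0 : 0 <= I by apply: Rintegral_ge0 => s _; rewrite mulr_ge0 ?rho_ge0 ?cmod_ge0.
exists (Num.min (Num.min d (pi / 2)) (e / 2 / (I + 1))).
  by rewrite !lt_min d0 !divr_gt0 ?pi_gt0// ltr_wpDl.
move=> l; rewrite !lt_min => /andP[l0 /andP[/andP[ld lp] le]].
have lpi2 : 0 < l <= pi / 2 by rewrite l0 ltW.
have [iP b] := tint_dist_le x Lf lpi2.
have sl : 0 < sin (l / 2) < d.
  rewrite (sin_half_gt0 (half_strip l0 (ltW lp))) /=.
  apply: le_lt_trans ld; apply: (le_trans (ler_norm _)); apply: (le_trans (norm_sin_le _)).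
  by rewrite ger0_norm ?divr_ge0 ?(ltW l0)//; move: l0; clear; lra.
apply: (le_trans b); rewrite (_ : e = e / 2 + e / 2); last by field.
apply: lerD; first exact: hd.
rewrite -/I; apply: (@le_trans _ _ (e / 2 / (I + 1) * I)); first by rewrite ler_wpM2r// ltW.
rewrite mulrAC -mulrA ler_piMr ?(ltW e2)// ler_pdivrMr ?ltr_wpDl// mul1r.
by rewrite lerDl.
Qed.

End ae_convergence.

(** * The projection and the polarizer *)

Section boundary_formulas.
Context {R : realType}.
Local Notation C := R[i].
Local Notation mu := (@lebesgue_measure R).
Implicit Types (f h k psi : R -> C) (u v : R -> C) (x s r e eps : R) (l c : C).

(** Stated with the real modulus, so that limits can be estimated without the
    complex order. *)
Definition right_limit u l := forall e, 0 < e -> exists2 d : R, 0 < d &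
  forall eps, 0 < eps < d -> cmod (u eps - l) <= e.

Lemma right_limit_cvg u l : right_limit u l -> u eps @[eps --> (0 : R)^'+] --> (l : C^o).
Proof.
move=> h; apply: (iffRL (@cvgrPdist_le C (C^o) R (0^'+) _ u l)) => e /posC_real[r r0 ->]; have [d d0 hd] := h r r0.
exists d => // eps /=; rewrite sub0r normrN => epsd eps0.
rewrite norm_cmod lecR cmodC; apply: hd; rewrite eps0.
by rewrite gtr0_norm in epsd.
Qed.

Lemma right_limit_unique u v c l l' : (forall eps, 0 < eps < pi -> v eps = c * u eps) ->
  right_limit u l -> right_limit v l' -> l' = c * l.
Proof.
move=> uv hu hv; apply/eqP; rewrite -subr_eq0; apply/eqP/cmod_eq0/eqP.
rewrite eq_le cmod_ge0 andbT; apply/ler_addgt0Pr => e e0; rewrite add0r.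
have k0 : 0 < cmod c + 1 by rewrite ltr_wpDl// cmod_ge0.
have [d1 d10 h1] := hu _ (divr_gt0 (divr_gt0 e0 (ltr0Sn _ 1)) k0).
have [d2 d20 h2] := hv _ (divr_gt0 e0 (ltr0Sn _ 1)).
pose m := Num.min (Num.min d1 d2) pi.
have m0 : 0 < m by rewrite !lt_min d10 d20 pi_gt0.
have mh : m / 2 < m by move: m0; clear; lra.
have eps0 : 0 < m / 2 by rewrite divr_gt0.
have [md1 md2 mpi] : [/\ m <= d1, m <= d2 & m <= pi] by rewrite /m !ge_min !lexx ?orbT.
have b1 := h1 (m / 2) _; have b2 := h2 (m / 2) _.
rewrite eps0 (lt_le_trans mh md1) in b1; rewrite eps0 (lt_le_trans mh md2) in b2.
have vE := uv (m / 2) _; rewrite eps0 (lt_le_trans mh mpi) in vE.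
rewrite (_ : l' - c * l = c * (u (m / 2) - l) - (v (m / 2) - l')); last by rewrite vE//; ring.
apply: (le_trans (cmodB _ _)); rewrite cmodM (_ : e = e / 2 + e / 2); last by field.
apply: lerD; last exact: b2.
apply: (@le_trans _ _ (cmod c * (e / 2 / (cmod c + 1)))).
  by rewrite ler_wpM2l ?cmod_ge0// b1.
rewrite mulrCA ler_piMr ?divr_ge0 ?(ltW e0)// ler_pdivrMr// mul1r.
by rewrite lerDl.
Qed.

Lemma sinh_integralE psi x eps : sinh_integral psi x eps = cauchy_int psi x eps.
Proof. by apply: eq_cint => s _; rewrite /ker half_complex. Qed.

Lemma sin_half_pi : sin (@pi R / 2) != 0.
Proof. by rewrite sin_pihalf oner_eq0. Qed.

Lemma cosh_integralE psi x : L2 psi ->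
  cosh_integral psi x = 'i%C * cauchy_int (fun s => (psi s)^*%C) x pi.
Proof.
move=> Lpsi; rewrite /cauchy_int -(cintZ _ measurableT (L2_mul (L2J Lpsi) (ker_refl_L2 x sin_half_pi))).
apply: eq_cint => s _; rewrite ker_pi /rho fmorphV.
have -> : 'i%C * ((psi s)^*%C * (- 'i%C * ((rcosh ((x - s) / 2))%:C)^-1)) =
   - ('i%C ^+ 2) * ((psi s)^*%C * ((rcosh ((x - s) / 2))%:C)^-1) :> C by ring.
by rewrite sqr_i opprK mul1r.
Qed.

Lemma cauchy_int_pi_limit psi x : L2 psi ->
  right_limit (fun eps => cauchy_int psi x (eps + pi)) (cauchy_int psi x pi).
Proof.
move=> Lpsi e e0; pose I := \int[mu]_s (rho (x - s) * cmod (psi s)).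
have ir := rintegrable_rho_cmod x Lpsi.
have I0 : 0 <= I by apply: Rintegral_ge0 => s _; rewrite mulr_ge0 ?rho_ge0 ?cmod_ge0.
have I1 : 0 < 2 * I + 1 by rewrite ltr_wpDl// mulr_ge0.
exists (Num.min 1 (e / (2 * I + 1))); first by rewrite lt_min ltr01 divr_gt0.
move=> eps; rewrite lt_min => /and3P[eps0 eps1 epse].
have c2 : 2^-1 <= cos (eps / 2).
  have := dist_cos_le 0 (eps / 2); rewrite cos0 sub0r normrN => h.
  have := le_trans (ler_norm _) h; rewrite ger0_norm ?divr_ge0 ?(ltW eps0)//.
  by move: eps1; clear; lra.
have sE : sin ((eps + pi) / 2) = cos (eps / 2) by rewrite mulrDl sinDpihalf.
have c0 : 0 < cos (eps / 2) by rewrite (lt_le_trans _ c2)// invr_gt0.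
have s1 : sin ((eps + pi) / 2) != 0 by rewrite sE lt0r_neq0.
have i1 := L2_mul Lpsi (ker_refl_L2 x s1); have i2 := L2_mul Lpsi (ker_refl_L2 x sin_half_pi).
have i3 := cintegrableB measurableT i1 i2.
rewrite /cauchy_int -(cintB measurableT i1 i2); apply: (le_trans (cmod_cint_le measurableT i3)).
apply: (@le_trans _ _ (2 * eps * I)); last first.
  apply: (@le_trans _ _ (e / (2 * I + 1) * (2 * I))).
    by rewrite mulrAC mulrC ler_wpM2r ?mulr_ge0// ltW.
  rewrite mulrAC -mulrA ler_piMr ?(ltW e0)// ler_pdivrMr// mul1r.
  by rewrite lerDl.
rewrite -(RintegralZr' _ measurableT ir); apply: Rintegral_le => //.
- exact: cintegrable_cmod.
- exact: rintegrableZ.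
move=> s _; rewrite -mulrBr cmodM mulrA mulrC ler_wpM2r ?cmod_ge0//.
apply: (le_trans (ker_lip (x - s) s1 sin_half_pi)).
rewrite mulrC ler_wpM2r ?rho_ge0// addrK sE sin_pihalf normr1 mulr1 !gtr0_norm//.
rewrite ler_pdivrMr// -mulrA mulrCA ler_peMr ?(ltW eps0)//.
by move: c2; clear; lra.
Qed.

Lemma i_div4pi : 'i%C / (4 * pi)%:C != 0 :> C.
Proof.
apply: mulf_neq0; last by rewrite invr_eq0 fmorph_eq0 mulf_neq0// gt_eqF// pi_gt0.
by apply/eqP => h; have := @cmodi R; rewrite h cmod0 => /eqP; rewrite eq_sym oner_eq0.
Qed.

(** On the strip the Cauchy integral of [psi] is that of its projection [f], which
    tends to [f] almost everywhere. One of its two halves is the regularized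
    integral of [psi] against [1 / sinh], the other tends to the integral against
    [1 / cosh], so that the former converges too. *)
Lemma projection_limit_ae psi f : L2 psi -> hardy_real R f ->
  (forall h, hardy_real R h -> complex.Re (inner h (fun t => psi t - f t)) = 0) ->
  {ae mu, forall x, right_limit (sinh_integral psi x)
    (('i%C / (4 * pi)%:C)^-1 * (f x - 1 / (4 * pi)%:C * cosh_integral psi x))}.
Proof.
move=> Lpsi Hf orth; have Lf := hardy_real_L2 Hf; have cf := hardy_cauchy Hf.
have := tint_cvg_ae Lf; apply: ae_imp => x lim e e0.
have p0 := pi_gt0 R; have a0 := i_div4pi.
set a := 'i%C / (4 * pi)%:C : C.
have ca : 0 < cmod a by rewrite cmod_gt0.
have [d1 d10 h1] := lim _ (divr_gt0 (mulr_gt0 e0 ca) (ltr0Sn _ 1)).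
have [d2 d20 h2] := cauchy_int_pi_limit x (L2J Lpsi) (divr_gt0 e0 (ltr0Sn _ 1)).
exists (Num.min (Num.min d1 d2) pi); first by rewrite !lt_min d10 d20.
move=> eps; rewrite !lt_min => /andP[eps0 /andP[/andP[ed1 ed2] epi]].
have epspi : 0 < eps < pi by rewrite eps0.
have b1 := h1 eps _; rewrite eps0 ed1 in b1; have b2 := h2 eps _; rewrite eps0 ed2 in b2.
have gE : a * (cauchy_int psi x eps + cauchy_int (fun s => (psi s)^*%C) x (eps + pi)) = tint f eps x.
  rewrite (cauchy_hardy_tint x cf epspi) (projection_gint x Lpsi Hf orth epspi).
  by [].
have cE : 1 / (4 * pi)%:C * cosh_integral psi x = a * cauchy_int (fun s => (psi s)^*%C) x pi.
  by rewrite (cosh_integralE x Lpsi) /a; ring.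
rewrite sinh_integralE cE.
set A := cauchy_int psi x eps; set B := cauchy_int _ x (eps + pi) in gE b2 *.
set B0 := cauchy_int _ x pi in b2 *.
have -> : A - a^-1 * (f x - a * B0) = a^-1 * (tint f eps x - f x) - (B - B0).
  by rewrite -gE -/A; field.
apply: (le_trans (cmodB _ _)); rewrite (_ : e = e / 2 + e / 2); last by field.
apply: lerD; last exact: b2.
rewrite cmodM cmodV mulrC ler_pdivrMr//; apply: (le_trans (b1 isT)).
by rewrite mulrAC.
Qed.

Lemma sinh_integralZ c psi x eps : L2 psi -> 0 < eps < pi ->
  sinh_integral (fun t => c * psi t) x eps = c * sinh_integral psi x eps.
Proof.
move=> Lpsi epi; rewrite !sinh_integralE /cauchy_int.
have s0 := lt0r_neq0 (sin_half_gt0 epi).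
rewrite -(cintZ c measurableT (L2_mul Lpsi (ker_refl_L2 x s0))).
by apply: eq_cint => s _; rewrite mulrA.
Qed.

Lemma cosh_integralZ c psi x : L2 psi ->
  cosh_integral (fun t => c * psi t) x = c^*%C * cosh_integral psi x.
Proof.
move=> Lpsi; rewrite (cosh_integralE x Lpsi) (cosh_integralE x (L2Z c Lpsi)) mulrCA; congr (_ * _).
rewrite /cauchy_int -(cintZ _ measurableT (L2_mul (L2J Lpsi) (ker_refl_L2 x sin_half_pi))).
by apply: eq_cint => s _; rewrite conjM mulrA.
Qed.

End boundary_formulas.

Section polarizers.
Context {R : realType}.
Local Notation C := R[i].
Local Notation mu := (@lebesgue_measure R).
Implicit Types (f h k psi : R -> C) (H : set (R -> C)).

Lemma hardy_projection_exists :
  exists E, real_orthogonal_projection (hardy_real R) E.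
Proof.
have [P hP] : exists P : (R -> C) -> R -> C, forall psi, L2 psi -> hardy_real R (P psi) /\
    forall h, hardy_real R h -> complex.Re (inner h (fun t => psi t - P psi t)) = 0.
  have /choice : forall psi, exists f, L2 psi -> hardy_real R f /\
    forall h, hardy_real R h -> complex.Re (inner h (fun t => psi t - f t)) = 0.
    move=> psi; have [Lpsi|nL] := pselect (L2 psi); last by exists psi.
    by have [f Hf orth] := projection_exists hardy_closed_subspace Lpsi; exists f.
  by move=> [P hP]; exists P.
by exists P.
Qed.

Lemma Re_inner_mulNi h k : L2 h -> L2 k ->
  complex.Re (inner h (fun t => - 'i%C * k t)) = complex.Im (inner h k).
Proof. by move=> Lh Lk; rewrite innerZr// ReM /= oppr0 mul0r sub0r mulN1r opprK. Qed.

(** Compressing multiplication by [-i] to [H] gives the polarizer; additivity and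
    compatibility with almost everywhere equality come from the uniqueness of
    projections. *)
Lemma polarizer_of_projection E : real_orthogonal_projection (hardy_real R) E ->
  polarizer (hardy_real R) (fun h => E (fun t => - 'i%C * h t)).
Proof.
move=> hE; have cH := @hardy_closed_subspace R.
have LN h : hardy_real R h -> L2 (fun t => - 'i%C * h t).
  by move=> /hardy_real_L2 Lh; exact: L2Z.
split.
- by move=> h Hh; exact: (hE _ (LN h Hh)).1.
- move=> h k Hh Hk hk; have [HD od] := hE _ (LN h Hh); have [HDk ok] := hE _ (LN k Hk).
  apply: (projection_unique cH (LN h Hh) HD HDk od) => g Hg; rewrite -[RHS](ok g Hg).
  have Lg := hardy_real_L2 Hg; have LDk := hardy_real_L2 HDk.
  rewrite !innerE; congr complex.Re; apply: eq_cint_ae.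
  + exact: cintegrable_measurable (L2_mul (L2J Lg) (L2B (LN h Hh) LDk)).
  + exact: cintegrable_measurable (L2_mul (L2J Lg) (L2B (LN k Hk) LDk)).
  + by move: hk; apply: ae_imp => t ->.
- move=> a h k Hh Hk; have [HD od] := hE _ (LN h Hh); have [HDk ok] := hE _ (LN k Hk).
  have Hs := hardy_real_lin a Hh Hk; have [HDs os] := hE _ (LN _ Hs).
  apply: (projection_unique cH (LN _ Hs) HDs (hardy_real_lin a HD HDk) os) => g Hg.
  have Lg := hardy_real_L2 Hg; have LD := hardy_real_L2 HD; have LDk := hardy_real_L2 HDk.
  have L1 := L2B (LN h Hh) LD; have L2' := L2B (LN k Hk) LDk.
  have -> : (fun t => - 'i%C * (a%:C * h t + k t) - (a%:C * E (fun t => - 'i%C * h t) t + E (fun t => - 'i%C * k t) t)) =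
    (fun t => a%:C * (- 'i%C * h t - E (fun t => - 'i%C * h t) t) + (- 'i%C * k t - E (fun t => - 'i%C * k t) t)).
    by apply/funext => t; ring.
  rewrite (innerDr Lg (L2Z a%:C L1) L2') (innerZr a%:C Lg L1) ReD ReM od// ok//=.
  by rewrite mulr0 mul0r subr0 addr0.
- exists 1 => h Hh; have [HD od] := hE _ (LN h Hh); have Lh := hardy_real_L2 Hh.
  rewrite mul1e (l2norm_sqint Lh) (l2norm_sqint (hardy_real_L2 HD)) lee_fin ler_wsqrtr//.
  apply: (le_trans (projection_norm cH (LN h Hh) HD od)).
  by rewrite (sqintZ _ Lh) cmodN cmodi expr1n mul1r.
- move=> h k Hh Hk; have [HDk ok] := hE _ (LN k Hk).
  have Lh := hardy_real_L2 Hh; have Lk := hardy_real_L2 Hk; have LDk := hardy_real_L2 HDk.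
  have := ok h Hh; rewrite (innerBr Lh (LN k Hk) LDk) ReB (Re_inner_mulNi Lh Lk).
  by move/eqP; rewrite subr_eq0 => /eqP.
Qed.

End polarizers.

Theorem proposition6p1 (R : realType) :
  ((exists E, real_orthogonal_projection (hardy_real R) E) /\
   (forall E, real_orthogonal_projection (hardy_real R) E ->
    forall psi : R -> R[i], L2 psi ->
    {ae @lebesgue_measure R, forall t : R, exists l : R[i],
       sinh_integral psi t eps @[eps --> (0 : R)^'+] --> (l : R[i]^o) /\
       E psi t = 'i%C / (4 * pi)%:C * l
                 + 1 / (4 * pi)%:C * cosh_integral psi t}))
  /\
  ((exists D, polarizer (hardy_real R) D) /\
   (forall D, polarizer (hardy_real R) D ->
    forall psi : R -> R[i], hardy_real R psi ->
    {ae @lebesgue_measure R, forall t : R, exists l : R[i],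
       sinh_integral psi t eps @[eps --> (0 : R)^'+] --> (l : R[i]^o) /\
       D psi t = 'i%C * psi t + 1 / (2 * pi)%:C * l})).
Proof.
have a0 := @i_div4pi R.
split; split.
- exact: hardy_projection_exists.
- move=> E hE psi Lpsi; have [HE orth] := hE psi Lpsi.
  have := projection_limit_ae Lpsi HE orth; apply: ae_imp => t lim.
  set l := _^-1 * _ in lim; exists l; split; first exact: right_limit_cvg.
  by rewrite /l (mulVKf a0) subrK.
- have [E hE] := @hardy_projection_exists R.
  by eexists; exact: (polarizer_of_projection hE).
move=> D [DH _ _ _ Dpol] psi Hpsi; have Lpsi := hardy_real_L2 Hpsi.
have HD := DH _ Hpsi; have LD := hardy_real_L2 HD.
have LN : L2 (fun t => - 'i%C * psi t) by exact: L2Z.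
have o1 h : hardy_real R h -> complex.Re (inner h (fun t => psi t - psi t)) = 0.
  by move=> Hh; have Lh := hardy_real_L2 Hh; rewrite (innerBr Lh Lpsi Lpsi) subrr.
have o2 h : hardy_real R h -> complex.Re (inner h (fun t => - 'i%C * psi t - D psi t)) = 0.
  move=> Hh; have Lh := hardy_real_L2 Hh.
  by rewrite (innerBr Lh LN LD) ReB (Re_inner_mulNi Lh Lpsi) Dpol// subrr.
have := ae_and (projection_limit_ae Lpsi Hpsi o1) (projection_limit_ae LN HD o2).
apply: ae_imp => t [lim1 lim2].
have E := right_limit_unique (fun eps => @sinh_integralZ R (- 'i%C) psi t eps Lpsi) lim1 lim2.
set l := _^-1 * (psi t - _) in lim1 E; exists l; split; first exact: right_limit_cvg.
rewrite (cosh_integralZ (- 'i%C) t Lpsi) in E.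
have iJ : (- 'i%C)^*%C = 'i%C :> R[i] by apply: complex_eq; rewrite !(ReJ, ImJ) /= ?opprK ?oppr0.
rewrite iJ in E.
have lE : 'i%C / (4 * pi)%:C * l = psi t - 1 / (4 * pi)%:C * cosh_integral psi t.
  by rewrite /l (mulVKf a0).
have DE : D psi t = 'i%C / (4 * pi)%:C * (- 'i%C * l) + 1 / (4 * pi)%:C * ('i%C * cosh_integral psi t).
  by rewrite -E (mulVKf a0) subrK.
rewrite DE; have -> : 1 / (4 * pi)%:C * ('i%C * cosh_integral psi t) =
  'i%C * (psi t - 'i%C / (4 * pi)%:C * l) by rewrite lE; ring.
have E2 : (4 * pi)%:C = 2 * (2 * pi)%:C :> R[i].
  by apply: complex_eq; rewrite !(ReM, ImM) /=; ring.
have p0 : (2 * pi)%:C != 0 :> R[i] by rewrite fmorph_eq0 mulf_neq0// gt_eqF// pi_gt0.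
rewrite E2; move: ((2 * pi)%:C) p0 => p p0.
have -> : 'i%C / (2 * p) * (- 'i%C * l) + 'i%C * (psi t - 'i%C / (2 * p) * l) =
  'i%C * psi t - 'i%C ^+ 2 * (1 / p * l) by field.
by rewrite sqr_i mulN1r opprK.
Qed.
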